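(* Assume (in the notation of the context) that $$H \leq \min\Big(\frac{1}{4C_{\mathrm{co}}},\ \frac{c_\sigma}{C_{\mathrm{co}}+C_{\mathrm{ort}}}\Big).$$ Let $\{u^n_h\}_{n=1}^N$, $\{\theta^n_h\}_{n=1}^N$ be the solution of the classical finite element scheme and let $\{\tilde u^n_{\mathrm{ms},k}\}_{n=1}^N$, $\{\theta^n_{\mathrm{ms},k}\}_{n=1}^N$ be the solution of the localized generalized finite element scheme. Then there is a constant $C$ such that for all $n\in\{1,\dots,N\}$ $$\|u^n_h-\tilde u^n_{\mathrm{ms},k}\|_{H^1} + \|\theta^n_h-\theta^n_{\mathrm{ms},k}\|_{H^1} \leq C(H + k^{d/2}\xi^k)\big(\|g\|_{L_\infty(L_2)} +\|\dot g\|_{L_\infty(H^{-1})} +\|f\|_{L_\infty(L_2)} + \|\dot f\|_{L_\infty(L_2)} + \|\ddot f\|_{L_\infty(H^{-1})} + t_n^{-1/2}\|\theta^0_h\|_{H^1}\big).$$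
   Context: **Continuous setting.** $d\in\{2,3\}$; $\Omega\subseteq\mathbb{R}^d$ is a (bounded) polygonal/polyhedral domain; $T>0$; $\partial\Omega=\Gamma^u_D\cup\Gamma^u_N=\Gamma^\theta_D\cup\Gamma^\theta_N$ (disjoint unions). $(\cdot,\cdot)$ and $\|\cdot\|$ are the inner product and norm of $L_2(\Omega)$ (for scalar or vector functions), $(\cdot,\cdot)_\omega$ the inner product of $L_2(\omega)$; for matrix-valued functions $(A:B)=\int_\Omega A:B\,dx$ with the Frobenius product, and $(A:B)_\omega$ is the integral over $\omega$. $H^{-1}$ is the dual of $H^1=H^1(\Omega)$. $L_\infty(X)=L_\infty([0,T];X)$, and a dot is a time derivative. $V^1=\{v\in H^1(\Omega)^d: v=0 \text{ on }\Gamma^u_D\}$, $V^2=\{v\in H^1(\Omega): v=0\text{ on }\Gamma^\theta_D\}$. $\varepsilon(u)=\frac12(\nabla u+\nabla u^{\top})$, $\sigma(u)=2\mu\varepsilon(u)+\lambda(\nabla\cdot u)I$. Data: $\kappa\in L_\infty(\Omega,\mathbb{R}^{d\times d})$ symmetric with $\kappa_1|v|^2\le \kappa(x)v\cdot v\le\kappa_2|v|^2$ a.e., $0<\kappa_1\le\kappa_2<\infty$; $\mu,\lambda,\alpha\in L_\infty(\Omega,\mathbb{R})$ with $0<\mu_1\le\mu\le\mu_2<\infty$, $0<\lambda_1\le\lambda\le\lambda_2<\infty$, $0<\alpha_1\le\alpha\le\alpha_2<\infty$ a.e.; $f,\dot f\in L_\infty(L_2)$, $\ddot f\in L_\infty(H^{-1})$,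 $g\in L_\infty(L_2)$, $\dot g\in L_\infty(H^{-1})$, $\theta_0\in V^2$. There are positive constants with $c_\sigma\|v\|_{H^1}^2\le(\sigma(v):\varepsilon(v))\le C_\sigma\|v\|_{H^1}^2$ for $v\in V^1$ (Korn) and $c_\kappa\|v\|_{H^1}^2\le(\kappa\nabla v,\nabla v)\le C_\kappa\|v\|_{H^1}^2$ for $v\in V^2$. **Finite element spaces.** $\mathcal{T}_h$ (from a shape regular family) and $\mathcal{T}_H$ (from a shape regular, quasi-uniform family), $H>h$, are triangulations of $\Omega$ with maximal diameters $h,H$; $\mathcal{T}_h$ is a refinement of $\mathcal{T}_H$. $V^1_h\subset V^1$ and $V^2_h\subset V^2$ are the spaces of continuous functions that are affine on each $K\in\mathcal{T}_h$ ($\mathbb{R}^d$-valued, resp. scalar) and vanish on $\Gamma^u_D$, resp. $\Gamma^\theta_D$; $V^1_H\subseteq V^1_h$, $V^2_H\subseteq V^2_h$ are the analogous spaces on $\mathcal{T}_H$. $I_H=(I^1_H,I^2_H):V^1_h\times V^2_h\to V^1_H\times V^2_H$ is a linear projection ($I_H\circ I_H=I_H$) onto $V^1_H\times V^2_H$ such that $H_K^{-1}\|v-I_Hv\|_{L_2(K)}+\|\nabla I_Hv\|_{L_2(K)}\le C_I\|\nabla v\|_{L_2(\omega_K)}$ for all $K\in\mathcal{T}_H$, where $H_K=\operatorname{diam}K$ and $\omega_K$ is the interior of the union of the elements of $\mathcal{T}_H$ meeting $K$. $V^i_{\mathrm f}=\{v\in V^i_h: I^i_Hv=0\}$, $i=1,2$,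 so $V^i_h=V^i_H\oplus V^i_{\mathrm f}$. **Localized multiscale spaces.** $\omega_0(K)=\operatorname{int}K$ and $\omega_k(K)=\operatorname{int}\bigcup\{\hat K\in\mathcal{T}_H:\hat K\cap\overline{\omega_{k-1}(K)}\ne\emptyset\}$ for $k\ge1$. $V^1_{\mathrm f}(\omega_k(K))=\{v\in V^1_{\mathrm f}: v=0\text{ on }(\overline\Omega\setminus\Gamma^u_N)\setminus\omega_k(K)\}$, and $V^2_{\mathrm f}(\omega_k(K))$ is defined similarly with $\Gamma^\theta_N$. For $v_i\in V^i_h$ let $R^{K,i}_{\mathrm f,k}v_i\in V^i_{\mathrm f}(\omega_k(K))$ solve $(\sigma(R^{K,1}_{\mathrm f,k}v_1):\varepsilon(w))_{\omega_k(K)}=(\sigma(v_1):\varepsilon(w))_K$ for all $w\in V^1_{\mathrm f}(\omega_k(K))$, and $(\kappa\nabla R^{K,2}_{\mathrm f,k}v_2,\nabla w)_{\omega_k(K)}=(\kappa\nabla v_2,\nabla w)_K$ for all $w\in V^2_{\mathrm f}(\omega_k(K))$. $R^{K,i}_{\mathrm f}$ is the same with $\omega_k(K)$ replaced by $\Omega$ (test and trial space $V^i_{\mathrm f}$). Put $R^i_{\mathrm f,k}=\sum_{K\in\mathcal{T}_H}R^{K,i}_{\mathrm f,k}$, $R^i_{\mathrm f}=\sum_{K\in\mathcal{T}_H}R^{K,i}_{\mathrm f}$, $V^i_{\mathrm{ms},k}=\{v-R^i_{\mathrm f,k}v:v\in V^i_H\}$. $R^2_{\mathrm{ms},k}:V^2_h\to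 V^2_{\mathrm{ms},k}$ is defined by $(\kappa\nabla(v-R^2_{\mathrm{ms},k}v),\nabla w)=0$ for all $w\in V^2_{\mathrm{ms},k}$. **Schemes.** $\tau>0$, $N\tau=T$, $t_n=n\tau$, $f^n=f(t_n)$, $g^n=g(t_n)$, $\bar\partial_t v^n=(v^n-v^{n-1})/\tau$. Let $\theta^0_h\in V^2_h$ be an approximation of $\theta_0$. Classical scheme: $u^n_h\in V^1_h$, $\theta^n_h\in V^2_h$ satisfy, for $n=1,\dots,N$, $(\sigma(u^n_h):\varepsilon(v_1))-(\alpha\theta^n_h,\nabla\cdot v_1)=(f^n,v_1)$ for all $v_1\in V^1_h$ and $(\bar\partial_t\theta^n_h,v_2)+(\kappa\nabla\theta^n_h,\nabla v_2)+(\alpha\nabla\cdot\bar\partial_tu^n_h,v_2)=(g^n,v_2)$ for all $v_2\in V^2_h$; $u^0_h\in V^1_h$ is defined by the first equation with $n=0$. Localized generalized scheme: for $n=1,\dots,N$, $\tilde u^n_{\mathrm{ms},k}=u^n_{\mathrm{ms},k}+u^n_{\mathrm f,k}$, $u^n_{\mathrm f,k}=\sum_{K\in\mathcal{T}_H}u^{n,K}_{\mathrm f,k}$, with $u^n_{\mathrm{ms},k}\in V^1_{\mathrm{ms},k}$, $u^{n,K}_{\mathrm f,k}\in V^1_{\mathrm f}(\omega_k(K))$, $\theta^n_{\mathrm{ms},k}\in V^2_{\mathrm{ms},k}$ such that (i) $(\sigma(\tilde u^n_{\mathrm{ms},k}):\varepsilon(v_1))-(\alpha\theta^n_{\mathrm{ms},k},\nabla\cdot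 v_1)=(f^n,v_1)$ for all $v_1\in V^1_{\mathrm{ms},k}$; (ii) $(\bar\partial_t\theta^n_{\mathrm{ms},k},v_2)+(\kappa\nabla\theta^n_{\mathrm{ms},k},\nabla v_2)+(\alpha\nabla\cdot\bar\partial_t\tilde u^n_{\mathrm{ms},k},v_2)=(g^n,v_2)$ for all $v_2\in V^2_{\mathrm{ms},k}$; (iii) $(\sigma(u^{n,K}_{\mathrm f,k}):\varepsilon(w_1))-(\alpha\theta^n_{\mathrm{ms},k},\nabla\cdot w_1)_K=0$ for all $w_1\in V^1_{\mathrm f}(\omega_k(K))$, $K\in\mathcal{T}_H$. Initial values: $\theta^0_{\mathrm{ms},k}=R^2_{\mathrm{ms},k}\theta^0_h$; $u^{0,K}_{\mathrm f,k}$ is given by (iii) with $n=0$ and $u^0_{\mathrm{ms},k}\in V^1_{\mathrm{ms},k}$ by (i) with $n=0$. **Constants.** $C$ denotes a positive constant that may depend on $d$, $\Omega$, the boundary parts, $T$, the mesh regularity, $C_I$ and the upper/lower bounds of the coefficients, but not on $h,H,k,\tau,n$, the data $f,g,\theta^0_h$, or derivatives of the coefficients. $\xi\in(0,1)$ is the fixed decay constant, independent of $h,H,k$ and of the functions involved, of the known localization estimates: $\|R^i_{\mathrm f,k}v-R^i_{\mathrm f}v\|_{H^1}^2\le Ck^d\xi^{2k}\sum_K\|R^{K,i}_{\mathrm f}v\|_{H^1}^2$ for $v\in V^i_h$, $i=1,2$; and, for $\psi\in L_2(\Omega)$, if $z^K\in V^1_{\mathrm f}$ and $z^K_k\in V^1_{\mathrm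 f}(\omega_k(K))$ solve $(\sigma(\cdot):\varepsilon(w))=(\psi,\nabla\cdot w)_K$ for all $w$ in the respective space, then $\|\sum_K(z^K-z^K_k)\|_{H^1}^2\le Ck^d\xi^{2k}\sum_K\|z^K\|_{H^1}^2$. $C_{\mathrm{ort}}$ and $C_{\mathrm{co}}$ are the constants (of the type $C$) in the bounds $(\sigma(v):\varepsilon(w))\le C_{\mathrm{ort}}k^{d/2}\xi^k\|v\|_{H^1}\|w\|_{H^1}$ for $v\in V^1_{\mathrm{ms},k}$, $w\in V^1_{\mathrm f}$, and $|(\sigma(u^n_{\mathrm f,k}):\varepsilon(w))-(\alpha\theta^n_{\mathrm{ms},k},\nabla\cdot w)|\le C_{\mathrm{co}}k^{d/2}\xi^k\|\theta^n_{\mathrm{ms},k}\|\|w\|_{H^1}$ for $w\in V^1_{\mathrm f}$ (the latter bound with the same constant also when $(u^n_{\mathrm f,k},\theta^n_{\mathrm{ms},k})$ is replaced by any pair related in the same way through (iii)). The localization parameter $k\ge1$ is chosen (of the form $k=c\log(H^{-1})$) so that $k^{d/2}\xi^k\le H$. *)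

(* Defs.v *)
From HB Require Import structures.
From mathcomp Require Import all_boot all_order all_algebra.
From mathcomp Require Import all_classical all_reals all_analysis.
From mathcomp Require Import ess_sup_inf.
Set Implicit Arguments. Unset Strict Implicit. Unset Printing Implicit Defensive.
Import Order.TTheory GRing.Theory Num.Def Num.Theory numFieldNormedType.Exports.
Local Open Scope classical_set_scope.
Local Open Scope ring_scope.

Definition rV_display : measure_display. Proof. exact. Qed.

(* Product sigma-algebra of the Borel sigma-algebra of R (= Borel sets of R^n). *)
Section measurable_rV.
Variables (R : realType) (n : nat).
Let coords : 'I_n -> 'rV[R]_n -> R := fun i x => x ord0 i.
Let rV_set0 : g_sigma_preimage coords set0.
Proof. exact: sigma_algebra0. Qed.
Let rV_setC A : g_sigma_preimage coords A -> g_sigma_preimage coords (~` A).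
Proof. exact: sigma_algebraC. Qed.
Let rV_bigcup (F : _^nat) : (forall i, g_sigma_preimage coords (F i)) ->
  g_sigma_preimage coords (\bigcup_i (F i)).
Proof. exact: sigma_algebra_bigcup. Qed.
HB.instance Definition _ := @isMeasurable.Build rV_display
  'rV[R]_n (g_sigma_preimage coords) rV_set0 rV_setC rV_bigcup.
End measurable_rV.

Lemma measurable_coord (R : realType) n (i : 'I_n) :
  measurable_fun setT (fun x : 'rV[R]_n => x ord0 i).
Proof.
move=> _ Y mY; rewrite setTI; apply: sub_sigma_algebra => /=.
rewrite -bigcup_seq/=; exists i => /=; first by rewrite mem_index_enum.
by exists Y => //; rewrite setTI.
Qed.

Lemma measurable_fun_rVP d (T : measurableType d) (R : realType) n (f : T -> 'rV[R]_n) :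
  (forall i, measurable_fun setT (fun x => f x ord0 i)) -> measurable_fun setT f.
Proof.
move=> mf; pose c : 'I_n -> 'rV[R]_n -> R := fun i x => x ord0 i.
suff H : g_sigma_preimage (fun i => c i \o f) `<=` measurable.
  move=> _ A mA; apply: H; rewrite g_sigma_preimage_comp; by exists A.
apply: smallest_sub; first exact: sigma_algebra_measurable.
case: n => [|n] in f c mf *; first by rewrite big_ord0.
rewrite -bigcup_mkord_ord; apply: bigcup_sub => i Ii.
by move=> A [B mB <-]; exact: mf.
Qed.

Section lebesgue_rV_step.
Variables (R : realType) (n : nat) (mu : {sigma_finite_measure set 'rV[R]_n -> \bar R}).

Definition rV_cons (p : measurableTypeR R * 'rV[R]_n) : 'rV[R]_n.+1 :=
  row_mx (p.1%:M : 'rV[R]_1) p.2.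

Lemma rV_cons0 p : rV_cons p ord0 ord0 = p.1.
Proof.
have -> : (ord0 : 'I_n.+1) = lshift n (ord0 : 'I_1) by exact/val_inj.
by rewrite /rV_cons (row_mxEl (p.1%:M : 'rV_1)) mxE eqxx mulr1n.
Qed.

Lemma rV_consS p i : rV_cons p ord0 (lift ord0 i) = p.2 ord0 i.
Proof.
have -> : lift ord0 i = rshift 1 i by exact/val_inj.
by rewrite /rV_cons (row_mxEr (p.1%:M : 'rV_1)).
Qed.

Lemma measurable_rV_cons : measurable_fun setT rV_cons.
Proof.
apply: measurable_fun_rVP => i; have [j ->|->] := unliftP ord0 i.
  rewrite (_ : (fun _ => _) = (fun x : 'rV[R]_n => x ord0 j) \o snd); last first.
    by apply/funext => p /=; rewrite rV_consS.
  by apply: measurableT_comp => //; exact: measurable_coord.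
rewrite (_ : (fun _ => _) = fst) //.
by apply/funext => p /=; rewrite rV_cons0.
Qed.

Definition lebesgue_rV_step : set 'rV[R]_n.+1 -> \bar R :=
  pushforward (@lebesgue_measure R \x mu)%E rV_cons.

Let step0 : lebesgue_rV_step set0 = 0%E.
Proof. by rewrite /lebesgue_rV_step /pushforward preimage_set0 measure0. Qed.
Let step_ge0 A : (0 <= lebesgue_rV_step A)%E.
Proof. by rewrite /lebesgue_rV_step /pushforward measure_ge0. Qed.
Let step_sigma : semi_sigma_additive lebesgue_rV_step.
Proof.
move=> F mF tF mUF; rewrite /lebesgue_rV_step /pushforward preimage_bigcup.
apply: measure_semi_sigma_additive.
- by move=> k; rewrite -[X in measurable X]setTI; apply: measurable_rV_cons.
- apply/trivIsetP => /= i j _ _ ij; rewrite -preimage_setI.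
  by move/trivIsetP : tF => /(_ _ _ _ _ ij) ->//; rewrite preimage_set0.
- by rewrite -preimage_bigcup -[X in measurable X]setTI; exact: measurable_rV_cons.
Qed.
HB.instance Definition _ := isMeasure.Build _ _ _ lebesgue_rV_step step0 step_ge0 step_sigma.

Let step_sfin : sigma_finite setT lebesgue_rV_step.
Proof.
have /sigma_finiteP[F [TF ndF Foo]] := sigma_finiteT (@lebesgue_measure R).
have /sigma_finiteP[G [TG ndG Goo]] := sigma_finiteT mu.
pose uc (x : 'rV[R]_n.+1) : measurableTypeR R * 'rV[R]_n :=
  (x ord0 ord0, \row_j x ord0 (lift ord0 j)).
have ucK : cancel uc rV_cons.
  move=> x; apply/rowP => i; have [j ->|->] := unliftP ord0 i.
    by rewrite rV_consS mxE.
  by rewrite rV_cons0.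
have consK : cancel rV_cons uc.
  case=> a x; rewrite /uc rV_cons0; congr pair.
  by apply/rowP => j; rewrite mxE rV_consS.
have muc : measurable_fun setT uc.
  apply/measurable_fun_pairP; split.
    exact: measurable_coord.
  apply: measurable_fun_rVP => i /=.
  rewrite (_ : (fun _ => _) = (fun x : 'rV[R]_n.+1 => x ord0 (lift ord0 i))).
    exact: measurable_coord.
  by apply/funext => x /=; rewrite mxE.
exists (fun k => uc @^-1` (F k `*` G k)).
  rewrite -preimage_bigcup -[LHS](preimage_setT uc); congr (_ @^-1` _).
  rewrite -setXTT TF TG predeqE => -[x y]; split.
    move=> [/= [i _ Fx] [j _ Gy]]; exists (maxn i j) => //; split.
      by move: x Fx; exact/subsetPset/ndF/leq_maxl.
    by move: y Gy; exact/subsetPset/ndG/leq_maxr.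
  by move=> [i _ []/= ? ?]; split; exists i.
move=> k; have [? ?] := Foo k; have [? ?] := Goo k; split.
  by rewrite -[X in measurable X]setTI; apply: muc => //; exact: measurableX.
rewrite /lebesgue_rV_step /pushforward -comp_preimage.
rewrite (_ : uc \o rV_cons = id); last by apply/funext => p /=; rewrite consK.
by rewrite preimage_id product_measure1E// lte_mul_pinfty// ge0_fin_numE.
Qed.
HB.instance Definition _ := Measure_isSigmaFinite.Build _ _ _ lebesgue_rV_step step_sfin.
End lebesgue_rV_step.

(* Lebesgue measure on R^n: the n-fold product of the Lebesgue measure on R. *)
Fixpoint lebesgue_rV (R : realType) n : {sigma_finite_measure set 'rV[R]_n -> \bar R} :=
  match n with
  | 0 => \d_(0 : 'rV[R]_0)
  | m.+1 => lebesgue_rV_step (lebesgue_rV R m)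
  end.

(* Fields of any kind on R^d are functions 'rV_d -> 'M_(p, q): a scalar field is
   'rV_1-valued, a vector field 'rV_d-valued, and the gradient of an 'rV_m-valued
   field is 'M_(d, m)-valued with entries (i, j) |-> d_i v_j. *)
Section fields.
Variables (R : realType) (d : nat).
Local Notation pt := 'rV[R]_d.
Local Notation leb := (lebesgue_rV R d).

Definition frob p q (A B : 'M[R]_(p, q)) : R := \sum_i \sum_j A i j * B i j.

(* Euclidean norm; the library norm of a matrix is the sup norm. *)
Definition enorm p q (A : 'M[R]_(p, q)) : R := Num.sqrt (frob A A).

Definition L2 (w : set pt) p q (F : pt -> 'M[R]_(p, q)) : Prop :=
  forall i j, measurable_fun w (fun x => F x i j) /\
    leb.-integrable w (fun x => ((F x i j) ^+ 2)%:E).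

Definition ip (w : set pt) p q (F G : pt -> 'M[R]_(p, q)) : R :=
  \int[leb]_(x in w) frob (F x) (G x).

Definition l2norm (w : set pt) p q (F : pt -> 'M[R]_(p, q)) : R :=
  Num.sqrt (ip w F F).

Definition partial (i : 'I_d) (phi : pt -> R) : pt -> R :=
  fun x => 'D_(delta_mx ord0 i) phi x.

Definition smooth (phi : pt -> R) : Prop :=
  forall (s : seq 'I_d) (x : pt), differentiable (foldr partial phi s) x.

Definition test_function (Om : set pt) (phi : pt -> R) : Prop :=
  smooth phi /\
  exists K : set pt, [/\ compact K, K `<=` Om & forall x, ~ K x -> phi x = 0].

Definition weak_gradient (Om : set pt) m (v : pt -> 'rV[R]_m)
    (G : pt -> 'M[R]_(d, m)) : Prop :=
  forall phi, test_function Om phi -> forall i j,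
    \int[leb]_(x in Om) (v x ord0 j * partial i phi x) =
    - \int[leb]_(x in Om) (G x i j * phi x).

(* v is in H^1(Om)^m with weak gradient G. *)
Definition H1 (Om : set pt) m (v : pt -> 'rV[R]_m) (G : pt -> 'M[R]_(d, m)) : Prop :=
  [/\ L2 Om v, L2 Om G & weak_gradient Om v G].

Definition H1norm (Om : set pt) m (v : pt -> 'rV[R]_m) (G : pt -> 'M[R]_(d, m)) : R :=
  Num.sqrt (l2norm Om v ^+ 2 + l2norm Om G ^+ 2).

(* v is in H^1(Om)^m, has weak gradient G, and its trace vanishes on GD, i.e. v is
   an H^1-limit of H^1 functions that are continuous up to the boundary and
   vanish on GD. *)
Definition H1D (Om GD : set pt) m (v : pt -> 'rV[R]_m) (G : pt -> 'M[R]_(d, m)) : Prop :=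
  H1 Om v G /\
  forall e : R, 0 < e -> exists w Gw,
    [/\ H1 Om w Gw, {within closure Om, continuous w},
        (forall x, GD x -> w x = 0) &
        H1norm Om (fun x => v x - w x) (fun x => G x - Gw x) < e].

(* Classical gradient, used for finite element functions: for a continuous
   piecewise affine function it exists off the element boundaries and is the
   weak gradient. *)
Definition grad m (v : pt -> 'rV[R]_m) : pt -> 'M[R]_(d, m) := fun x => 'J v x.

Definition h1norm (Om : set pt) m (v : pt -> 'rV[R]_m) : R := H1norm Om v (grad v).

(* (q, div v)_w *)
Definition div_form (w : set pt) (q : pt -> 'rV[R]_1) (v : pt -> pt) : R :=
  \int[leb]_(x in w) (q x ord0 ord0 * \tr (grad v x)).

End fields.

Section coefficients.
Variables (R : realType) (d : nat).
Local Notation pt := 'rV[R]_d.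
Local Notation leb := (lebesgue_rV R d).

Record coefficients := Coefficients {
  kappa : pt -> 'M[R]_d;
  lame_mu : pt -> R;
  lame_la : pt -> R;
  alpha : pt -> R }.

Definition coefficient_bounds (Om : set pt) (c : coefficients)
    (ka1 ka2 mu1 mu2 la1 la2 al1 al2 : R) : Prop :=
  [/\ (forall i j, measurable_fun Om (fun x => kappa c x i j)),
      measurable_fun Om (lame_mu c),
      measurable_fun Om (lame_la c),
      measurable_fun Om (alpha c) &
      \forall x \ae leb, Om x ->
        [/\ (kappa c x)^T = kappa c x,
            (forall v : 'cV[R]_d, ka1 * enorm v ^+ 2 <= frob (kappa c x *m v) v
                                  <= ka2 * enorm v ^+ 2),
            mu1 <= lame_mu c x <= mu2,
            la1 <= lame_la c x <= la2 &
            al1 <= alpha c x <= al2] ].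

(* strain and stress as functions of the displacement gradient *)
Definition strain (G : 'M[R]_d) : 'M[R]_d := 2^-1 *: (G + G^T).
Definition stress (c : coefficients) (x : pt) (G : 'M[R]_d) : 'M[R]_d :=
  (2 * lame_mu c x) *: strain G + (lame_la c x * \tr G)%:M.

Definition elastic_energy (c : coefficients) (w : set pt) (G E : pt -> 'M[R]_d) : R :=
  \int[leb]_(x in w) frob (stress c x (G x)) (strain (E x)).
Definition heat_energy (c : coefficients) (w : set pt) (G E : pt -> 'cV[R]_d) : R :=
  \int[leb]_(x in w) frob (kappa c x *m G x) (E x).

(* (sigma(u) : eps(v))_w and (kappa grad u, grad v)_w *)
Definition elastic_form c (w : set pt) (u v : pt -> 'rV[R]_d) : R :=
  elastic_energy c w (grad u) (grad v).
Definition heat_form c (w : set pt) (u v : pt -> 'rV[R]_1) : R :=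
  heat_energy c w (grad u) (grad v).

Definition elastic_coercive (Om GD : set pt) c (cs Cs : R) : Prop :=
  forall v G, H1D Om GD v G ->
    cs * H1norm Om v G ^+ 2 <= elastic_energy c Om G G <= Cs * H1norm Om v G ^+ 2.
Definition heat_coercive (Om GD : set pt) c (ck Ck : R) : Prop :=
  forall (v : pt -> 'rV[R]_1) G, H1D Om GD v G ->
    ck * H1norm Om v G ^+ 2 <= heat_energy c Om G G <= Ck * H1norm Om v G ^+ 2.

Definition times_alpha c (q : pt -> 'rV[R]_1) : pt -> 'rV[R]_1 :=
  fun x => alpha c x *: q x.

End coefficients.

Section meshes.
Variables (R : realType) (d : nat).
Local Notation pt := 'rV[R]_d.

(* A simplex is given by the matrix whose d + 1 rows are its vertices. *)
Definition face (A : 'M[R]_(d.+1, d)) (S : pred 'I_d.+1) : set pt :=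
  [set x | exists lam : 'rV[R]_d.+1,
    [/\ forall i, 0 <= lam ord0 i, forall i, ~~ S i -> lam ord0 i = 0,
        \sum_i lam ord0 i = 1 & x = lam *m A] ].
Definition simplex (A : 'M[R]_(d.+1, d)) : set pt := face A predT.
Definition nondegenerate (A : 'M[R]_(d.+1, d)) : bool :=
  row_free (row_mx A (const_mx 1 : 'cV[R]_d.+1)).

Definition boundary (Om : set pt) : set pt := closure Om `\` Om°.

(* Om = int (cl Om) excludes domains with slits. *)
Definition polyhedral_domain (Om : set pt) : Prop :=
  [/\ open Om, connected Om, Om !=set0, (closure Om)° = Om &
      exists (M : nat) (T : 'I_M -> 'M[R]_(d.+1, d)),
        (forall i, nondegenerate (T i)) /\
        closure Om = \bigcup_i simplex (T i)].

Definition boundary_splitting (Om GD GN : set pt) : Prop :=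
  GD `|` GN = boundary Om /\ GD `&` GN = set0.

Definition mesh M := 'I_M -> 'M[R]_(d.+1, d).

Definition diam (K : set pt) : R :=
  sup [set r | exists x y, [/\ K x, K y & r = enorm (x - y)] ].

Definition mesh_size M (T : mesh M) : R := \big[Num.max/0]_(i < M) diam (simplex (T i)).

(* Conforming: two elements meet exactly in the face spanned by their common
   vertices (empty if there are none). *)
Definition triangulation (Om : set pt) M (T : mesh M) : Prop :=
  [/\ forall i, nondegenerate (T i),
      closure Om = \bigcup_i simplex (T i),
      forall i j, i != j -> simplex (T i) <> simplex (T j) &
      forall i j, simplex (T i) `&` simplex (T j) =
        face (T i) (fun a => [exists b, row a (T i) == row b (T j)]) ].

Definition refines M N (Th : mesh M) (TH : mesh N) : Prop :=
  forall i, exists j, simplex (Th i) `<=` simplex (TH j).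

(* Every element K contains a ball of radius diam K / g. *)
Definition shape_regular (g : R) M (T : mesh M) : Prop :=
  forall i, exists x, forall y, enorm (y - x) <= diam (simplex (T i)) / g ->
    simplex (T i) y.

Definition quasi_uniform (q : R) M (T : mesh M) : Prop :=
  forall i, mesh_size T <= q * diam (simplex (T i)).

(* omega_k(K) for the element K of index i *)
Fixpoint omega M (T : mesh M) (k : nat) (i : 'I_M) : set pt :=
  match k with
  | 0 => (simplex (T i))°
  | l.+1 => (\bigcup_(j in [set j | simplex (T j) `&` closure (omega T l i) !=set0])
               simplex (T j))°
  end.

End meshes.

Section spaces.
Variables (R : realType) (d m : nat).
Local Notation pt := 'rV[R]_d.
Local Notation fct := (pt -> 'rV[R]_m).

(* Continuous 'rV_m-valued functions on cl Om, affine on each element, vanishing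
   on GD; they are extended by 0 outside cl Om so that equality of functions is
   equality on cl Om. The last clause records the inclusion in the space of
   H^1 functions with vanishing trace on GD. *)
Definition fe_space (Om GD : set pt) M (T : mesh R d M) (v : fct) : Prop :=
  [/\ {within closure Om, continuous v},
      (forall i, exists (A : 'M[R]_(d, m)) (b : 'rV[R]_m),
        forall x, simplex (T i) x -> v x = x *m A + b),
      (forall x, GD x -> v x = 0),
      (forall x, ~ closure Om x -> v x = 0) &
      H1D Om GD v (grad v)].

(* I is a linear projection of Vh onto VH with local stability and
   approximation constant CI; L_2(K) is taken over the interior of K. *)
Definition quasi_interpolation (CI : R) (Vh VH : fct -> Prop) M (TH : mesh R d M)
    (I : fct -> fct) : Prop :=
  [/\ forall v, Vh v -> VH (I v),
      forall a v w, Vh v -> Vh w -> I (a *: v + w) = a *: I v + I w,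
      forall v, Vh v -> I (I v) = I v,
      forall v, VH v -> exists2 w, Vh w & I w = v &
      forall i v, Vh v ->
        (diam (simplex (TH i)))^-1 * l2norm (omega TH 0 i) (v - I v)
          + l2norm (omega TH 0 i) (grad (I v))
        <= CI * l2norm (omega TH 1 i) (grad v)].

Definition fine_space (Vh : fct -> Prop) (I : fct -> fct) (v : fct) : Prop :=
  Vh v /\ I v = 0.

Definition local_fine_space (Om GN : set pt) (Vh : fct -> Prop) (I : fct -> fct)
    (w : set pt) (v : fct) : Prop :=
  fine_space Vh I v /\ forall x, (closure Om `\` GN) x -> ~ w x -> v x = 0.

(* RK i v is in W i and a_(w i)(RK i v, z) = a_(K_i)(v, z) for all z in W i. *)
Definition element_correctors (a : set pt -> fct -> fct -> R) (Vh : fct -> Prop)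
    M (TH : mesh R d M) (w : 'I_M -> set pt) (W : 'I_M -> fct -> Prop)
    (RK : 'I_M -> fct -> fct) : Prop :=
  forall i v, Vh v ->
    W i (RK i v) /\ forall z, W i z -> a (w i) (RK i v) z = a (omega TH 0 i) v z.

Definition corrector M (RK : 'I_M -> fct -> fct) (v : fct) : fct := \sum_i RK i v.

Definition ms_space (VH : fct -> Prop) (Rf : fct -> fct) (v : fct) : Prop :=
  exists2 w, VH w & v = w - Rf w.

Definition corrector_localization (Om : set pt) (Cloc xi : R) (k : nat)
    (Vh : fct -> Prop) M (RkK RK : 'I_M -> fct -> fct) : Prop :=
  forall v, Vh v ->
    h1norm Om (corrector RkK v - corrector RK v) ^+ 2
    <= Cloc * k%:R ^+ d * xi ^+ (2 * k) * \sum_i h1norm Om (RK i v) ^+ 2.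

End spaces.

Section data.
Variables (R : realType) (d : nat) (Om : set 'rV[R]_d) (T : R).
Local Notation pt := 'rV[R]_d.

(* L_infty(0, T) norm of t |-> N t >= 0 *)
Definition Linf_norm (N : R -> \bar R) : \bar R :=
  ess_sup (@lebesgue_measure R) (fun t => if (0 <= t <= T) then N t else 0%E).

Definition dual_norm m (l : (pt -> 'rV[R]_m) -> R) : \bar R :=
  ereal_sup [set r | exists v G, [/\ H1 Om v G, H1norm Om v G <= 1 & r = `|l v|%:E] ].

Definition Linf_L2_norm m (f : R -> pt -> 'rV[R]_m) : \bar R :=
  Linf_norm (fun t => (l2norm Om (f t))%:E).
Definition Linf_dual_norm m (l : R -> (pt -> 'rV[R]_m) -> R) : \bar R :=
  Linf_norm (fun t => dual_norm (l t)).

Definition Linf_L2 m (f : R -> pt -> 'rV[R]_m) : Prop :=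
  [/\ forall t, 0 <= t <= T -> L2 Om (f t),
      forall v, L2 Om v -> measurable_fun `[0, T] (fun t => ip Om (f t) v) &
      (Linf_L2_norm f < +oo)%E].

Definition Linf_dual m (l : R -> (pt -> 'rV[R]_m) -> R) : Prop :=
  [/\ forall t, 0 <= t <= T -> (dual_norm (l t) < +oo)%E /\
        forall a v Gv w Gw, H1 Om v Gv -> H1 Om w Gw ->
          l t (a *: v + w) = a * l t v + l t w,
      forall v G, H1 Om v G -> measurable_fun `[0, T] (fun t => l t v) &
      (Linf_dual_norm l < +oo)%E].

Definition in_L2 m (v : pt -> 'rV[R]_m) : Prop := L2 Om v.
Definition in_H1 m (v : pt -> 'rV[R]_m) : Prop := exists G, H1 Om v G.

(* An element of L_2 as a functional. *)
Definition riesz m (f : R -> pt -> 'rV[R]_m) : R -> (pt -> 'rV[R]_m) -> R :=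
  fun t v => ip Om (f t) v.

(* l' is the time derivative of l as functionals on X:
   l(t) - l(s) = int_s^t l'(r) dr.  This selects the continuous representative
   of l, the one that is evaluated at the time nodes. *)
Definition time_derivative m (X : (pt -> 'rV[R]_m) -> Prop)
    (l l' : R -> (pt -> 'rV[R]_m) -> R) : Prop :=
  forall v, X v -> forall s t, 0 <= s -> s <= t -> t <= T ->
    l t v - l s v = \int[@lebesgue_measure R]_(r in `[s, t]) l' r v.

Definition regular_data (f f1 : R -> pt -> pt) (f2 : R -> (pt -> pt) -> R)
    (g : R -> pt -> 'rV[R]_1) (g1 : R -> (pt -> 'rV[R]_1) -> R) : Prop :=
  [/\ Linf_L2 f, Linf_L2 f1, Linf_dual f2, Linf_L2 g & Linf_dual g1] /\
  [/\ time_derivative (@in_L2 d) (riesz f) (riesz f1),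
      time_derivative (@in_H1 d) (riesz f1) f2 &
      time_derivative (@in_H1 1) (riesz g) g1].

Definition data_norm (f f1 : R -> pt -> pt) (f2 : R -> (pt -> pt) -> R)
    (g : R -> pt -> 'rV[R]_1) (g1 : R -> (pt -> 'rV[R]_1) -> R) : R :=
  fine (Linf_L2_norm g) + fine (Linf_dual_norm g1) + fine (Linf_L2_norm f)
  + fine (Linf_L2_norm f1) + fine (Linf_dual_norm f2).

End data.

Section schemes.
Variables (R : realType) (d : nat) (Om : set 'rV[R]_d) (c : coefficients R d).
Variables (tau : R) (N : nat).
Variables (f : R -> 'rV[R]_d -> 'rV[R]_d) (g : R -> 'rV[R]_d -> 'rV[R]_1).
Local Notation pt := 'rV[R]_d.
Local Notation vfct := (pt -> 'rV[R]_d).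
Local Notation sfct := (pt -> 'rV[R]_1).

Definition tnode (n : nat) : R := n%:R * tau.

Definition bdiff m (v : nat -> pt -> 'rV[R]_m) (n : nat) : pt -> 'rV[R]_m :=
  tau^-1 *: (v n - v n.-1).

Definition mechanics (V1 : vfct -> Prop) (u : vfct) (theta : sfct) (n : nat) : Prop :=
  forall v, V1 v ->
    elastic_form c Om u v - div_form Om (times_alpha c theta) v = ip Om (f (tnode n)) v.

(* (alpha div dt u, v) is written (alpha v, div dt u). *)
Definition heat_step (V2 : sfct -> Prop) (u : nat -> vfct) (theta : nat -> sfct)
    (n : nat) : Prop :=
  forall v, V2 v ->
    ip Om (bdiff theta n) v + heat_form c Om (theta n) v
      + div_form Om (times_alpha c v) (bdiff u n) = ip Om (g (tnode n)) v.

Definition classical_scheme (V1h : vfct -> Prop) (V2h : sfct -> Prop) (theta0 : sfct)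
    (u : nat -> vfct) (theta : nat -> sfct) : Prop :=
  [/\ theta 0%N = theta0,
      forall n, (n <= N)%N -> V1h (u n) /\ V2h (theta n),
      forall n, (n <= N)%N -> mechanics V1h (u n) (theta n) n &
      forall n, (1 <= n <= N)%N -> heat_step V2h u theta n].

(* uK i is the fine scale correction for theta on the patch of the element i. *)
Definition fine_correction M (TH : mesh R d M) (W : 'I_M -> vfct -> Prop)
    (uK : 'I_M -> vfct) (theta : sfct) : Prop :=
  forall i, W i (uK i) /\ forall z, W i z ->
    elastic_form c Om (uK i) z - div_form (omega TH 0 i) (times_alpha c theta) z = 0.

Definition localized_scheme M (TH : mesh R d M) (V1ms : vfct -> Prop)
    (V2ms : sfct -> Prop) (W : 'I_M -> vfct -> Prop) (theta0 : sfct)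
    (ums : nat -> vfct) (uK : nat -> 'I_M -> vfct) (theta : nat -> sfct) : Prop :=
  let utilde n := ums n + \sum_i uK n i in
  [/\ forall z, V2ms z -> heat_form c Om (theta0 - theta 0%N) z = 0,
      forall n, (n <= N)%N -> V1ms (ums n) /\ V2ms (theta n),
      forall n, (n <= N)%N -> mechanics V1ms (utilde n) (theta n) n,
      forall n, (1 <= n <= N)%N -> heat_step V2ms utilde theta n &
      forall n, (n <= N)%N -> fine_correction TH W (uK n) (theta n)].

(* ||sum_K (z^K - z^K_k)||^2 <= Cloc k^d xi^(2k) sum_K ||z^K||^2 for the solutions of
   (sigma(z) : eps(w)) = (psi, div w)_K in the global, resp. localized, fine space *)
Definition divergence_localization (Cloc xi : R) (k : nat) M (TH : mesh R d M)
    (Vf : vfct -> Prop) (W : 'I_M -> vfct -> Prop) : Prop :=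
  forall (psi : sfct) (z zk : 'I_M -> vfct), L2 Om psi ->
    (forall i, Vf (z i) /\ forall w, Vf w ->
       elastic_form c Om (z i) w = div_form (omega TH 0 i) psi w) ->
    (forall i, W i (zk i) /\ forall w, W i w ->
       elastic_form c Om (zk i) w = div_form (omega TH 0 i) psi w) ->
    h1norm Om (\sum_i (z i - zk i)) ^+ 2
    <= Cloc * k%:R ^+ d * xi ^+ (2 * k) * \sum_i h1norm Om (z i) ^+ 2.

(* k^(d/2) xi^k *)
Definition decay (xi : R) (k : nat) : R := k%:R `^ (d%:R / 2) * xi ^+ k.

Definition almost_orthogonal (Cort xi : R) (k : nat) (V1ms Vf : vfct -> Prop) : Prop :=
  forall v w, V1ms v -> Vf w ->
    elastic_form c Om v w <= Cort * decay xi k * h1norm Om v * h1norm Om w.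

Definition almost_corrected (Cco xi : R) (k : nat) M (TH : mesh R d M)
    (V2ms : sfct -> Prop) (Vf : vfct -> Prop) (W : 'I_M -> vfct -> Prop) : Prop :=
  forall (theta : sfct) (uK : 'I_M -> vfct), V2ms theta ->
    fine_correction TH W uK theta -> forall w, Vf w ->
    `|elastic_form c Om (\sum_i uK i) w - div_form Om (times_alpha c theta) w|
    <= Cco * decay xi k * l2norm Om theta * h1norm Om w.

End schemes.

(* Main.v *)
(* Solving the mechanics for a given temperature q gives a displacement S q + w, so each scheme
   is an implicit Euler scheme for the temperature alone.  Its time derivative is measured in
   M(q, q') = (q, q') + (alpha q, div (S q')), an inner product equivalent to that of L_2.  In the
   multiscale scheme the almost orthogonality of V_ms and V_f, together with the bound
   |v| <= C H |grad v| on V_f, makes its displacement differ by O(H) from S q + w; the resulting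
   perturbation of the temperature equation is O(H) as well.  The temperature error is split by
   the Ritz projection onto V_ms.  The same two properties of V_f give an O(H) bound for that
   projection without any regularity of the coefficients, and energy estimates with weight t_n
   produce the factor t_n^(-1/2) in front of the initial value. *)
Require Import Defs.
From HB Require Import structures.
From mathcomp Require Import all_boot all_order all_algebra.
From mathcomp Require Import all_classical all_reals all_analysis.
From mathcomp Require Import measurable_realfun ess_sup_inf ring lra.
Set Implicit Arguments. Unset Strict Implicit. Unset Printing Implicit Defensive.
Import Order.TTheory GRing.Theory Num.Def Num.Theory numFieldNormedType.Exports.
Local Open Scope classical_set_scope.
Local Open Scope ring_scope.

(** * Positive semidefinite forms *)

(** The residual of the multiscale temperature equation is bounded by the discrete time derivative
    of the multiscale temperature, for which only a sum of squares over the time steps is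
    controlled. Smoothing in time is therefore taken from the classical scheme alone, and the
    residual enters the weighted estimate only through that sum. The smallness of [H] is what yields
    the sum: in the energy balance of the localized scheme the coercivity of the elastic form
    absorbs the defect of orthogonality.

    The growth of the weight [t_n] costs an unweighted sum of the energy error, which has its own
    estimate; it closes at order [H] because duality gives the Ritz error the order [H ^+ 2] in the
    norm of [M].

    The estimates are proved for abstract forms on vector spaces, and their hypotheses are verified
    at the end for finite element functions. The classical gradient is linear in the function only
    almost everywhere, so the concrete forms become bilinear only after integration, and on the
    finite element spaces rather than on all functions. *)

Lemma le_of_nonneg_quadratic (R : realType) (A B C : R) : 0 <= A -> 0 <= C ->
  (forall t, 0 <= t ^+ 2 * A + 2 * t * B + C) -> B ^+ 2 <= A * C.
Proof.
move=> A0 C0 q; have [a0|a0] := eqVneq A 0.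
  suff -> : B = 0 by rewrite a0 mul0r expr0n.
  apply/eqP; apply: contraT => b0.
  (* For [A = 0] the expression is affine in [t]; this value of [t] makes it [-1]. *)
  have := q (- (C + 1) / (2 * B)); rewrite a0.
  have -> : ((- (C + 1) / (2 * B)) ^+ 2 * 0 + 2 * (- (C + 1) / (2 * B)) * B + C) = -1 by field.
  lra.
have gt : 0 < A by rewrite lt_def a0.
have := q (- B / A).
have -> : ((- B / A) ^+ 2 * A + 2 * (- B / A) * B + C) = (A * C - B ^+ 2) / A by field.
by rewrite pmulr_lge0 ?invr_gt0// subr_ge0.
Qed.

Section psd_forms.
Variables (R : realType) (X : lmodType R).

(** Only semidefinite: an energy over a subdomain vanishes on functions that live elsewhere.
    Linearity in the second argument follows from symmetry. *)
Record psd_form (a : X -> X -> R) : Prop := PsdForm {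
  psd_linear : forall k x y z, a (k *: x + y) z = k * a x z + a y z;
  psdC : forall x y, a x y = a y x;
  psd_ge0 : forall x, 0 <= a x x }.

Definition subspace (P : X -> Prop) : Prop :=
  P 0 /\ forall k x y, P x -> P y -> P (k *: x + y).

Definition linear_functional (l : X -> R) : Prop :=
  forall k x y, l (k *: x + y) = k * l x + l y.

Lemma lfun0 l : linear_functional l -> l 0 = 0.
Proof. by move=> ll; have := ll 1 0 0; rewrite scale1r addr0; lra. Qed.
Lemma lfunD l : linear_functional l -> {morph l : x y / x + y}.
Proof. by move=> ll x y; have := ll 1 x y; rewrite scale1r mul1r. Qed.
Lemma lfunZ l : linear_functional l -> forall k x, l (k *: x) = k * l x.
Proof. by move=> ll k x; rewrite -[in LHS](addr0 (k *: x)) ll lfun0// addr0. Qed.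
Lemma lfunN l : linear_functional l -> {morph l : x / - x}.
Proof. by move=> ll x; rewrite -scaleN1r lfunZ// mulN1r. Qed.
Lemma lfunB l : linear_functional l -> {morph l : x y / x - y}.
Proof. by move=> ll x y; rewrite lfunD// lfunN. Qed.
Section subspaces.
Variables (P : X -> Prop) (sP : subspace P).
Lemma subspace0 : P 0. Proof. by case: sP. Qed.
Lemma subspaceZ k x : P x -> P (k *: x).
Proof. by case: sP => P0 sL Px; rewrite -[k *: x]addr0; exact: sL. Qed.
Lemma subspaceD x y : P x -> P y -> P (x + y).
Proof. by case: sP => P0 sL Px Py; rewrite -[x]scale1r; exact: sL. Qed.
Lemma subspaceB x y : P x -> P y -> P (x - y).
Proof.
by move=> Px Py; apply: subspaceD => //; rewrite -scaleN1r; exact: subspaceZ.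
Qed.
Lemma subspace_sum I (r : seq I) (Q : pred I) F :
  (forall i, P (F i)) -> P (\sum_(i <- r | Q i) F i).
Proof.
by move=> PF; apply: big_ind => //; [exact: subspace0|exact: subspaceD].
Qed.
End subspaces.

Section theory.
Variables (a : X -> X -> R) (pa : psd_form a).

Lemma psd_funl z : linear_functional (a^~ z).
Proof. by move=> k x y; exact: psd_linear. Qed.
Lemma psd_funr z : linear_functional (a z).
Proof. by move=> k x y; rewrite psdC// psd_linear// !(psdC pa z). Qed.

Lemma psdDl x y z : a (x + y) z = a x z + a y z. Proof. exact: (lfunD (psd_funl z)). Qed.
Lemma psdDr x y z : a z (x + y) = a z x + a z y. Proof. exact: (lfunD (psd_funr z)). Qed.
Lemma psdBl x y z : a (x - y) z = a x z - a y z. Proof. exact: (lfunB (psd_funl z)). Qed.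
Lemma psdBr x y z : a z (x - y) = a z x - a z y. Proof. exact: (lfunB (psd_funr z)). Qed.
Lemma psdNl x z : a (- x) z = - a x z. Proof. exact: (lfunN (psd_funl z)). Qed.
Lemma psdNr x z : a z (- x) = - a z x. Proof. exact: (lfunN (psd_funr z)). Qed.
Lemma psdZl k x z : a (k *: x) z = k * a x z. Proof. exact: (lfunZ (psd_funl z)). Qed.
Lemma psdZr k x z : a z (k *: x) = k * a z x. Proof. exact: (lfunZ (psd_funr z)). Qed.
Lemma psd0l z : a 0 z = 0. Proof. exact: (lfun0 (psd_funl z)). Qed.
Lemma psd0r z : a z 0 = 0. Proof. exact: (lfun0 (psd_funr z)). Qed.
Definition psdE := (psdDl, psdDr, psdNl, psdNr, psdZl, psdZr, psd0l, psd0r).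

Lemma psd_CS2 x y : a x y ^+ 2 <= a x x * a y y.
Proof.
apply: le_of_nonneg_quadratic; rewrite ?psd_ge0// => t.
have := psd_ge0 pa (t *: x + y); rewrite !psdE (psdC pa y x); lra.
Qed.

Definition fnorm x : R := Num.sqrt (a x x).
Lemma fnorm_ge0 x : 0 <= fnorm x. Proof. exact: sqrtr_ge0. Qed.
Lemma fnorm2 x : fnorm x ^+ 2 = a x x. Proof. by rewrite sqr_sqrtr// psd_ge0. Qed.

Lemma psd_CS x y : `|a x y| <= fnorm x * fnorm y.
Proof.
rewrite /fnorm -sqrtrM ?psd_ge0// -sqrtr_sqr.
by rewrite ler_wsqrtr// psd_CS2.
Qed.

Lemma psd_CSW x y : a x y <= fnorm x * fnorm y.
Proof. exact: le_trans (ler_norm _) (psd_CS x y). Qed.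

Lemma fnormD x y : fnorm (x + y) <= fnorm x + fnorm y.
Proof.
rewrite -ler_sqr ?nnegrE ?addr_ge0 ?fnorm_ge0// fnorm2 !psdE sqrrD !fnorm2.
have := psd_CSW x y; rewrite (psdC pa y x); lra.
Qed.

Lemma fnormZ k x : fnorm (k *: x) = `|k| * fnorm x.
Proof.
by rewrite /fnorm !psdE mulrA -expr2 sqrtrM ?sqr_ge0// sqrtr_sqr.
Qed.

Lemma fnormN x : fnorm (- x) = fnorm x.
Proof. by rewrite -scaleN1r fnormZ normrN1 mul1r. Qed.

End theory.

(* Riesz representation on a subspace on which the form and the functional only
   see the values of finitely many functionals [phi 0], ..., [phi n.-1]. *)
Lemma riesz_exists (a : X -> X -> R) (pa : psd_form a) (l : X -> R) (K : R) n
    (phi : nat -> X -> R) (P : X -> Prop) :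
  (forall i, linear_functional (phi i)) -> linear_functional l -> subspace P ->
  (forall v, P v -> l v ^+ 2 <= K * a v v) ->
  (forall v, P v -> (forall i, (i < n)%N -> phi i v = 0) -> a v v = 0) ->
  exists2 p, P p & forall v, P v -> a p v = l v.
Proof.
move=> lphi.
elim: n => [|n IH] in l K P *.
  move=> ll [P0 PL] lK phi0; exists 0 => // v Pv; rewrite psd0l//.
  have := lK v Pv; rewrite phi0// mulr0 => l2.
  by have := sqr_ge0 (l v); move=> l2'; apply/esym/eqP; rewrite -sqrf_eq0; lra.
move=> ll sP lK phi0.
have [[v0 Pv0 v01]|nv] := pselect (exists2 v, P v & phi n v <> 0); last first.
  apply: (IH l K) => // v Pv h; apply: phi0 => // i.
  rewrite ltnS leq_eqVlt => /orP[/eqP ->|]; last exact: h.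
  by have [//|ne] := pselect (phi n v = 0); case: nv; exists v.
pose P' v := P v /\ phi n v = 0.
have sP' : subspace P'.
  split; first by split; [exact: subspace0|exact: lfun0].
  move=> k x y [Px hx] [Py hy]; split; first by case: sP => _; apply.
  by rewrite lphi hx hy mulr0 addr0.
have h' v : P' v -> (forall i, (i < n)%N -> phi i v = 0) -> a v v = 0.
  move=> [Pv hv] h; apply: phi0 => // i.
  by rewrite ltnS leq_eqVlt => /orP[/eqP ->|]; last exact: h.
have [p1 [Pp1 _] hp1] : exists2 p, P' p & forall v, P' v -> a p v = l v.
  by apply: (IH l K) => // v [Pv _]; exact: lK.
have [p2 [Pp2 fp2] hp2] : exists2 p, P' p & forall v, P' v -> a p v = a v0 v.
  apply: (IH (a v0) (a v0 v0)) => //; first exact: psd_funr.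
  by move=> v [Pv _]; exact: psd_CS2.
(* [p2] represents [a v0] on the kernel, so [w] is orthogonal to the kernel and still spans a
   complement of it. *)
pose w := v0 - p2.
have Pw : P w by exact: subspaceB.
have fw : phi n w <> 0 by rewrite lfunB// fp2 subr0.
have aw v : P' v -> a w v = 0 by move=> Pv; rewrite psdBl// hp2// subrr.
have ap1 v : P' v -> a v w = 0 by move=> Pv; rewrite psdC// aw.
clearbody w.
exists (p1 + (l w - a p1 w) / a w w *: w).
  by apply: subspaceD => //; exact: subspaceZ.
move=> v Pv; have fwn : phi n w != 0 by exact/eqP.
have [v' Pv' ->] : exists2 v', P' v' & v = v' + (phi n v / phi n w) *: w.
  exists (v - (phi n v / phi n w) *: w); last by rewrite subrK.
  split; first by apply: subspaceB => //; exact: subspaceZ.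
  by rewrite lfunB// lfunZ// divfK// subrr.
rewrite !psdE// hp1// (aw _ Pv') lfunD// lfunZ//.
(* If [w] has zero energy, the bound on [l] gives [l w = 0], and the coefficient of [w], a quotient
   by zero, is 0 by convention. *)
have [w0|w0] := eqVneq (a w w) 0; last first.
  by field; rewrite ?w0 ?fwn.
have lw : l w = 0.
  by have := lK w Pw; rewrite w0 mulr0 => h; apply/eqP; rewrite -sqrf_eq0 eq_le h sqr_ge0.
have apw : a p1 w = 0.
  have := psd_CS2 pa p1 w; rewrite w0 mulr0 => h.
  by apply/eqP; rewrite -sqrf_eq0 eq_le h sqr_ge0.
by rewrite lw apw w0; ring.
Qed.

End psd_forms.

(** * Subspaces as vector spaces *)

Section sub_space.
Variables (R : realType) (E : lmodType R) (P : E -> Prop).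

(** The proof of [subspace P] is an argument so that the closure instance can be inferred from the
    predicate itself. *)
Definition sub_pred (_ : subspace P) : {pred E} := fun x => `[< P x >].

Variable sP : subspace P.

Lemma sub_pred_submod : GRing.submod_closed (sub_pred sP).
Proof.
split; first by apply/asboolP; exact: subspace0.
move=> k x y /asboolP Px /asboolP Py; apply/asboolP.
by apply: subspaceD => //; exact: subspaceZ.
Qed.
HB.instance Definition _ := GRing.isSubmodClosed.Build R E (sub_pred sP) sub_pred_submod.

Definition sub_space := {x : E | x \in sub_pred sP}.
HB.instance Definition _ := [isSub of sub_space for @sval E _].
HB.instance Definition _ := [Choice of sub_space by <:].
HB.instance Definition _ := [SubChoice_isSubLmodule of sub_space by <:].

Lemma sub_spaceP (x : sub_space) : P (val x).
Proof. by have /asboolP := valP x. Qed.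

Definition to_sub_space x (Px : P x) : sub_space := exist _ x (asboolT Px).

Lemma val_sub_lin k (x y : sub_space) : val (k *: x + y) = k *: val x + val y.
Proof. exact: linearP. Qed.

End sub_space.

(** * Parabolic problems and the Ritz projection *)

Lemma telescope_sum_le (R : realDomainType) (E p q : nat -> R) n :
  (forall j, (j < n)%N -> E j.+1 + p j <= E j + q j) ->
  E n + \sum_(j < n) p j <= E 0%N + \sum_(j < n) q j.
Proof.
elim: n => [|n IH] h; first by rewrite !big_ord0.
rewrite !big_ord_recr /=.
have := IH (fun j jn => h j (ltnW jn)); have := h n (ltnSn n); lra.
Qed.

(** * Difference quotients in time *)

Section difference_quotient.
Variables (R : realType) (X : lmodType R) (tau : R) (tau_gt0 : 0 < tau).

(** At [n = 0] the value is 0, since [0.-1 = 0]; the estimates use positive indices. *)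
Definition dquot (v : nat -> X) (n : nat) : X := tau^-1 *: (v n - v n.-1).

Lemma dquotK v n : tau *: dquot v n.+1 = v n.+1 - v n.
Proof. by rewrite scalerA divff ?gt_eqF// scale1r. Qed.

Lemma dquotB v w n : dquot (fun j => v j - w j) n = dquot v n - dquot w n.
Proof. by rewrite /dquot -scalerBr !opprD !opprK addrACA. Qed.

Lemma subspace_dquot P v n : subspace P -> P (v n) -> P (v n.-1) -> P (dquot v n).
Proof. by move=> sP Pn Pn1; apply: subspaceZ => //; exact: subspaceB. Qed.

Variables (a : X -> X -> R) (pa : psd_form a).

(** From 2 a(x, x - y) = a(x, x) - a(y, y) + a(x - y, x - y): dropping the last term is the
    dissipation of implicit Euler. *)
Lemma psd_dquot v n :
  a (v n.+1) (v n.+1) - a (v n) (v n) <= 2 * tau * a (v n.+1) (dquot v n.+1).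
Proof.
rewrite -mulrA -(psdZr pa) dquotK (psdBr pa).
have := psd_ge0 pa (v n.+1 - v n); rewrite !(psdE pa).
rewrite (psdC pa (v n) (v n.+1)); lra.
Qed.

Lemma psd_sub_le (x y : X) : a (x - y) (x - y) <= 2 * a x x + 2 * a y y.
Proof.
have := psd_ge0 pa (x + y); rewrite !(psdE pa) (psdC pa y x); lra.
Qed.
End difference_quotient.

(** * Ritz projection *)

Section ritz.
Variables (R : realType) (X : lmodType R) (b : X -> X -> R) (pb : psd_form b).
Variables (B : X -> Prop) (sB : subspace B).

(** A relation, since existence is a separate fact and uniqueness holds only up to vectors of zero
    energy. *)
Definition ritz (v p : X) : Prop := B p /\ forall z, B z -> b (v - p) z = 0.

Lemma ritz_lin k v p w q : ritz v p -> ritz w q -> ritz (k *: v + w) (k *: p + q).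
Proof.
move=> [Bp hp] [Bq hq]; split; first by case: sB => _; apply.
move=> z Bz; have := hp _ Bz; have := hq _ Bz; rewrite !(psdE pb); nra.
Qed.

Lemma ritz_pythagoras v p : ritz v p -> b v v = b (v - p) (v - p) + b p p.
Proof.
move=> [Bp hp]; have := hp _ Bp; rewrite !(psdE pb) (psdC pb p v); lra.
Qed.

Lemma ritz_le v p : ritz v p -> b (v - p) (v - p) <= b v v.
Proof. by move=> r; rewrite (ritz_pythagoras r) lerDl psd_ge0. Qed.

Lemma ritz_le2 v p : ritz v p -> b p p <= b v v.
Proof. by move=> r; rewrite (ritz_pythagoras r) lerDr psd_ge0. Qed.
End ritz.

(** * Error of a perturbed Galerkin method for implicit Euler *)

Section parabolic.
Variables (R : realType) (X : lmodType R) (M b : X -> X -> R).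
Variables (B : X -> Prop) (K H T D tau : R) (N : nat).
Hypotheses (pM : psd_form M) (pb : psd_form b) (sB : subspace B).
Hypotheses (K_ge1 : 1 <= K) (H_gt0 : 0 < H) (D_ge0 : 0 <= D) (tau_gt0 : 0 < tau).
Hypothesis tauN : N%:R * tau <= T.
Hypothesis M_le_b : forall q, M q q <= K * b q q.
Hypothesis ritz_ex : forall v, exists p, ritz b B v p.
Hypothesis ritz_b : forall v p k, ritz b B v p ->
  (forall q, `|b v q| <= k * fnorm M q) -> b (v - p) (v - p) <= K ^+ 2 * H ^+ 2 * k ^+ 2.
Hypothesis ritz_M : forall v p, ritz b B v p ->
  M (v - p) (v - p) <= K ^+ 2 * H ^+ 2 * b (v - p) (v - p).
Variables (th tht : nat -> X) (l r : nat -> X -> R).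
Local Notation dt := (dquot tau).
Local Notation sq a v := (a v v).
Hypothesis th_eq : forall n, (n < N)%N -> forall q,
  M (dt th n.+1) q + b (th n.+1) q = l n.+1 q.
Hypothesis tht_B : forall n, (n <= N)%N -> B (tht n).
Hypothesis tht_eq : forall n, (n < N)%N -> forall q, B q ->
  M (dt tht n.+1) q + b (tht n.+1) q = l n.+1 q + r n.+1 q.
Hypothesis tht0 : ritz b B (th 0%N) (tht 0%N).
Hypothesis l_le : forall n, (n < N)%N -> forall q, `|l n.+1 q| <= D * fnorm M q.
Hypothesis dl_le : forall n, (n.+1 < N)%N -> forall q,
  `|l n.+2 q - l n.+1 q| <= tau * D * fnorm b q.
Hypothesis r_le : forall n, (n < N)%N -> forall q, B q ->
  `|r n.+1 q| <= K * H * (fnorm M (dt tht n.+1) + D) * fnorm M q.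

(** The size of the data: initial energy plus the squared load integrated in time. The bound
    [tht_stab] is assumed at this level; it is obtained from the coupled system, where the smallness
    conditions act. *)
Definition Y n : R := sq b (th 0%N) + n%:R * tau * D ^+ 2.
Hypothesis tht_stab : forall n, (n <= N)%N ->
  \sum_(j < n) tau * sq M (dt tht j.+1) <= K * Y n.

Let Ygeb0 n : sq b (th 0%N) <= Y n.
Proof. by rewrite /Y lerDl !mulr_ge0// ?ler0n ?(ltW tau_gt0)// sqr_ge0. Qed.
Let Yge_D n : n%:R * tau * D ^+ 2 <= Y n.
Proof. by rewrite /Y lerDr psd_ge0. Qed.
Let tn_le n : (n <= N)%N -> n%:R * tau <= T.
Proof. by move=> nN; apply: le_trans tauN; rewrite ler_pM2r// ler_nat. Qed.
Let tn_ge0 n : 0 <= n%:R * tau.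
Proof. by rewrite mulr_ge0// ltW. Qed.
Let sumtauD n : \sum_(j < n) tau * D ^+ 2 = n%:R * tau * D ^+ 2.
Proof. by rewrite sumr_const card_ord -[LHS]mulr_natl mulrA. Qed.

(** Testing with [dt th] and Young's inequality: half of the [M] term absorbs the load. *)
Lemma th_energy n : (n <= N)%N ->
  sq b (th n) + \sum_(j < n) tau * sq M (dt th j.+1) <= Y n.
Proof.
move=> nN; rewrite /Y -sumtauD; apply: (telescope_sum_le (E := fun j => sq b (th j))
  (p := fun j => tau * sq M (dt th j.+1)) (q := fun=> tau * D ^+ 2)).
move=> j jn; have jN := leq_trans jn nN.
have e := th_eq jN (dt th j.+1).
have := le_trans (ler_norm _) (l_le jN (dt th j.+1)); rewrite -e.
have := psd_dquot tau_gt0 pb th j.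
rewrite -(fnorm2 pM (dt th j.+1)); set x := fnorm M _ => h1 h2.
have h3 : 2 * (D * x) <= D ^+ 2 + x ^+ 2 by have := sqr_ge0 (D - x); lra.
have := ler_wpM2l (ltW tau_gt0) h2; have := ler_wpM2l (ltW tau_gt0) h3; lra.
Qed.

(** Parabolic smoothing: the difference of two consecutive equations is tested with the newer
    quotient and multiplied by [t_n]. The weight grows by [tau] per step, which leaves
    [tau * M (dt th) (dt th)], summed by [th_energy]. No bound on a time derivative at time zero
    enters. *)
Lemma dth_energy n : (n < N)%N ->
  n.+1%:R * tau * sq M (dt th n.+1)
   + \sum_(j < n.+1) tau * (j.+1%:R * tau * sq b (dt th j.+1)) <= (6 + T) * Y n.+1.
Proof.
move=> nN.
have step j : (j < n)%N ->
    j.+2%:R * tau * sq M (dt th j.+2) + tau * (j.+2%:R * tau * sq b (dt th j.+2))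
    <= j.+1%:R * tau * sq M (dt th j.+1)
       + (tau * sq M (dt th j.+1) + T * (tau * D ^+ 2)).
  move=> jn; have jN : (j.+1 < N)%N by apply: leq_ltn_trans nN.
  have e2 := th_eq jN (dt th j.+2).
  have e1 := th_eq (ltnW jN) (dt th j.+2).
  have := le_trans (ler_norm _) (dl_le jN (dt th j.+2)); rewrite -e2 -e1.
  have := psd_dquot tau_gt0 pM (dt th) j.+1.
  rewrite -[b (th j.+2) _ ](subrK (b (th j.+1) (dt th j.+2))) -(psdBl pb).
  rewrite -(dquotK tau_gt0) (psdZl pb tau (dt th j.+2)).
  have -> : 2 * tau * M (dt th j.+2) (dt (dt th) j.+2) =
     2 * (M (dt th j.+2) (dt th j.+2) - M (dt th j.+1) (dt th j.+2)).
    rewrite -mulrA -(psdZr pM) (dquotK tau_gt0) (psdBr pM) (psdC pM (dt th j.+2) (dt th j.+1)).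
    by [].
  rewrite -(fnorm2 pb (dt th j.+2)); set x := fnorm b _ => h1 h2.
  have h3 : 2 * (D * x) <= D ^+ 2 + x ^+ 2 by have := sqr_ge0 (D - x); lra.
  have h4 : sq M (dt th j.+2) + tau * x ^+ 2 <= sq M (dt th j.+1) + tau * D ^+ 2.
    have := ler_wpM2l (ltW tau_gt0) h3; lra.
  have := ler_wpM2l (tn_ge0 j.+2) h4.
  have tT : j.+2%:R * tau * (tau * D ^+ 2) <= T * (tau * D ^+ 2).
    by rewrite ler_wpM2r ?tn_le// mulr_ge0 ?sqr_ge0// ltW.
  rewrite -[j.+2]addn1 natrD; move: tT; rewrite -[j.+2]addn1 natrD; lra.
have := telescope_sum_le (E := fun j => j.+1%:R * tau * sq M (dt th j.+1)) step.
have -> : \sum_(j < n) (tau * sq M (dt th j.+1) + T * (tau * D ^+ 2)) =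
    \sum_(j < n) tau * sq M (dt th j.+1) + T * (n%:R * tau * D ^+ 2).
  by rewrite big_split /=; congr (_ + _); rewrite -mulr_sumr sumtauD.
rewrite mul1r big_ord_recl /= mul1r.
have t1 : \sum_(j < n) tau * sq M (dt th j.+1) <= Y n.+1.
  apply: le_trans (th_energy nN); rewrite big_ord_recr /=.
  have := psd_ge0 pb (th n.+1); have := mulr_ge0 (ltW tau_gt0) (psd_ge0 pM (dt th n.+1)); lra.
have t2 : T * (n%:R * tau * D ^+ 2) <= T * Y n.+1.
  apply: ler_wpM2l; first exact: le_trans (tn_ge0 _) (tn_le nN).
  apply: le_trans (Yge_D n.+1); rewrite ler_wpM2r ?sqr_ge0// ler_wpM2r ?(ltW tau_gt0)//.
  by rewrite ler_nat.
have Y1 : Y 1 <= Y n.+1.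
  by rewrite /Y lerD2l ler_wpM2r ?sqr_ge0// ler_wpM2r ?(ltW tau_gt0)// ler_nat.
have := th_energy (leq_ltn_trans (leq0n n) nN).
rewrite big_ord_recl big_ord0 /= => h1.
(* The first step has no predecessor; there [tau *: dt th 1] is a difference of two vectors of
   bounded energy. This 4 and one [Y] from each of two [M] terms add up to the 6. *)
have b1 : tau * (tau * sq b (dt th 1)) <= 4 * Y n.+1.
  rewrite -(psdZr pb) -(psdZl pb) (dquotK tau_gt0).
  have := psd_sub_le pb (th 1%N) (th 0%N).
  have := mulr_ge0 (ltW tau_gt0) (psd_ge0 pM (dt th 1)); have := Ygeb0 n.+1; lra.
have := psd_ge0 pb (th 1%N); lra.
Qed.

Variable p : nat -> X.
Hypothesis p_ritz : forall n, ritz b B (th n) (p n).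

Local Notation rho n := (th n - p n).
Local Notation drho := (dquot tau (fun n => th n - p n)).
Local Notation eta n := (p n - tht n).
Local Notation deta := (dquot tau (fun n => p n - tht n)).
Local Notation err n := (th n - tht n).
Local Notation derr := (dquot tau (fun n => th n - tht n)).

Let K_ge0 : 0 <= K. Proof. exact: le_trans ler01 K_ge1. Qed.
Let KH0 : 0 <= K ^+ 2 * H ^+ 2.
Proof. by apply: mulr_ge0; exact: sqr_ge0. Qed.
Let eB n : (n <= N)%N -> B (eta n).
Proof. by move=> nN; apply: subspaceB => //; [case: (p_ritz n)|exact: tht_B]. Qed.
Let eeta n : (n <= N)%N -> sq b (err n) = sq b (rho n) + sq b (eta n).
Proof.
move=> nN; have [_ /(_ _ (eB nN))] := p_ritz n.
rewrite /=; set x := th n - p n; set y := p n - tht n => h.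
have -> : th n - tht n = x + y by rewrite /x /y addrA subrK.
clearbody x y; rewrite !(psdE pb) (psdC pb y x) h; ring.
Qed.

(** The equation itself bounds the functional [b (th n.+1)] in the norm of [M], by the load and
    [dt th]; this is what the Ritz estimate [ritz_b] requires. *)
Lemma rho_b n : (n < N)%N -> sq b (rho n.+1) <=
  2 * (K ^+ 2 * H ^+ 2) * (D ^+ 2 + sq M (dt th n.+1)).
Proof.
move=> nN; apply: le_trans (ritz_b (k := D + fnorm M (dt th n.+1)) (p_ritz n.+1) _) _.
  move=> q; have -> : b (th n.+1) q = l n.+1 q - M (dt th n.+1) q.
    by rewrite -th_eq// addrC addKr.
  rewrite mulrDl (le_trans (ler_normB _ _))// lerD// ?l_le//; exact: psd_CS.
rewrite -(fnorm2 pM (dt th n.+1)); set x := fnorm M _.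
rewrite [leRHS](_ : _ = K ^+ 2 * H ^+ 2 * (2 * (D ^+ 2 + x ^+ 2))); last by ring.
rewrite (ler_wpM2l KH0)//. have := sqr_ge0 (D - x); lra.
Qed.

Lemma rho_M n : (n < N)%N -> sq M (rho n.+1) <=
  2 * (K ^+ 2 * H ^+ 2) ^+ 2 * (D ^+ 2 + sq M (dt th n.+1)).
Proof.
move=> nN; apply: le_trans (ritz_M (p_ritz n.+1)) _.
rewrite [leRHS](_ : _ = (K ^+ 2 * H ^+ 2) *
  (2 * (K ^+ 2 * H ^+ 2) * (D ^+ 2 + sq M (dt th n.+1)))); last by ring.
by rewrite (ler_wpM2l KH0)// rho_b.
Qed.

(** Ritz projection commutes with difference quotients, so duality and stability in energy apply to
    [dt th] directly. *)
Lemma drho_M n : (n < N)%N ->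
  sq M (drho n.+1) <= K ^+ 2 * H ^+ 2 * sq b (dt th n.+1).
Proof.
move=> nN.
have rd : ritz b B (dt th n.+1) (dt p n.+1).
  have dE (v : nat -> X) : dt v n.+1 = tau^-1 *: v n.+1 + (- tau^-1 *: v n + 0).
    by rewrite addr0 /dquot scalerBr scaleNr.
  rewrite !dE; apply: ritz_lin => //; apply: ritz_lin => //.
  by split; [exact: subspace0|move=> z _; rewrite subr0 psd0l].
rewrite dquotB; apply: le_trans (ritz_M rd) _.
by rewrite (ler_wpM2l KH0)// (ritz_le pb rd).
Qed.

Let r_eta n q : (n < N)%N -> B q -> forall s, sq M q <= K * s ->
  2 * `|r n.+1 q| <= s + 2 * (K ^+ 3 * H ^+ 2) * (D ^+ 2 + sq M (dt tht n.+1)).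
Proof.
move=> nN Bq s Ms.
have := r_le nN Bq; rewrite -(fnorm2 pM (dt tht n.+1)); set x := fnorm M (dt tht n.+1) => h.
set y := fnorm M q in h *; have y2 : y ^+ 2 <= K * s by rewrite fnorm2.
have K0 : 0 < K := lt_le_trans ltr01 K_ge1.
rewrite -(ler_pM2l K0); apply: (@le_trans _ _ (K * (2 * (K * H * (x + D) * y)))).
  by rewrite !ler_pM2l.
have := sqr_ge0 (K * (K * H * (x + D)) - y).
have := mulr_ge0 (sqr_ge0 (K * K * H)) (sqr_ge0 (x - D)); lra.
Qed.

(** [K ^+ 2] is due to the initial error, the bracket is the cost of one step, and [2 + K] bounds
    the sums of the load, of [dt th] and of [dt tht] by [Y]. *)
Definition C1 : R := K ^+ 2 + (4 * K ^+ 2 + 2 + 2 * K ^+ 4 + 2 * K ^+ 3) * (2 + K).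

(** The error equation is tested with [eta], the part of the error in [B]. This unweighted bound
    pays for the growth of the weight in [parabolic_error]. *)
Lemma err_L2 n : (n <= N)%N ->
  \sum_(j < n) tau * sq b (err j.+1) <= C1 * H ^+ 2 * Y n.
Proof.
move=> nN; pose C2 := 4 * K ^+ 2 + 2 + 2 * K ^+ 4 + 2 * K ^+ 3.
have step j : (j < n)%N -> sq M (err j.+1) + tau * sq b (err j.+1) <= sq M (err j) +
    C2 * H ^+ 2 * (tau * D ^+ 2 + tau * sq M (dt th j.+1) + tau * sq M (dt tht j.+1)).
  move=> jn; have jN := leq_trans jn nN.
  have Beta := eB jN.
  set e := err j.+1; set eps := derr j.+1.
  have epsE : eps = dt th j.+1 - dt tht j.+1 by rewrite /eps dquotB.
  have eq1 : M eps (eta j.+1) + b e (eta j.+1) = - r j.+1 (eta j.+1).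
    rewrite epsE /e (psdBl pM) (psdBl pb); have := th_eq jN (eta j.+1); have := tht_eq jN Beta.
    by set u := eta j.+1; lra.
  have eE : e = rho j.+1 + eta j.+1 by rewrite /e /= addrA subrK.
  have ber : b e (rho j.+1) = sq b (rho j.+1).
    have [_ /(_ _ Beta)] := p_ritz j.+1; rewrite eE; set x := rho j.+1; set y := eta j.+1.
    by rewrite (psdDl pb) (psdC pb y x) => ->; rewrite addr0.
  have eq2 : M eps e + b e e = M eps (rho j.+1) + sq b (rho j.+1) - r j.+1 (eta j.+1).
    have := psdDr pM (rho j.+1) (eta j.+1) eps; have := psdDr pb (rho j.+1) (eta j.+1) e.
    rewrite -eE; move: eq1 ber; lra.
  have s1 := psd_dquot tau_gt0 pM (fun n => err n) j; rewrite (psdC pM (err j.+1)) in s1.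
  (* Young's inequality with a factor [H ^+ 2] and its inverse: the inverse is compensated by the
     bound of order [H ^+ 4] in [rho_M]. *)
  have s2 : 2 * M eps (rho j.+1) <= H ^+ 2 * sq M eps
      + 2 * K ^+ 4 * H ^+ 2 * (D ^+ 2 + sq M (dt th j.+1)).
    have H2 : 0 < H ^+ 2 by rewrite exprn_gt0.
    have := psd_ge0 pM (H ^+ 2 *: eps - rho j.+1).
    have := rho_M jN; rewrite /=; set x := th j.+1 - p j.+1; clearbody x eps; rewrite !(psdE pM) (psdC pM x eps) => h1 h2.
    rewrite -(ler_pM2l H2); lra.
  have s3 : sq M eps <= 2 * sq M (dt th j.+1) + 2 * sq M (dt tht j.+1).
    by rewrite epsE; exact: psd_sub_le.
  have s4 := rho_b jN.
  have s5 : 2 * - r j.+1 (eta j.+1) <= b e e +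
     2 * (K ^+ 3 * H ^+ 2) * (D ^+ 2 + sq M (dt tht j.+1)).
    apply: (@le_trans _ _ (2 * `|r j.+1 (eta j.+1)|)).
      by rewrite ler_pM2l// -normrN ler_norm.
    apply: r_eta => //; apply: le_trans (M_le_b _) _.
    by rewrite ler_wpM2l// /e eeta// lerDr (psd_ge0 pb).
  have s3' := ler_wpM2l (sqr_ge0 H) s3.
  have s6 : 2 * (M eps e + b e e) <= b e e + C2 * H ^+ 2 *
      (D ^+ 2 + sq M (dt th j.+1) + sq M (dt tht j.+1)).
    rewrite eq2 /C2.
    have p1 : 0 <= H ^+ 2 * D ^+ 2 by rewrite mulr_ge0 ?sqr_ge0.
    have p2 : 0 <= H ^+ 2 * sq M (dt th j.+1) by rewrite mulr_ge0 ?sqr_ge0 ?(psd_ge0 pM).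
    have p3 : 0 <= H ^+ 2 * sq M (dt tht j.+1) by rewrite mulr_ge0 ?sqr_ge0 ?(psd_ge0 pM).
    have k2 : 0 <= K ^+ 2 by rewrite exprn_ge0.
    have k3 : 0 <= K ^+ 3 by rewrite exprn_ge0.
    have k4 : 0 <= K ^+ 4 by rewrite exprn_ge0.
    have := mulr_ge0 k2 p3; have := mulr_ge0 k3 p2; have := mulr_ge0 k4 p3; lra.
  have := ler_wpM2l (ltW tau_gt0) s6.
  move: s1; rewrite -/e -/eps; lra.
have := telescope_sum_le (E := fun j => sq M (err j)) step.
have -> : \sum_(j < n) C2 * H ^+ 2 *
      (tau * D ^+ 2 + tau * sq M (dt th j.+1) + tau * sq M (dt tht j.+1)) =
    C2 * H ^+ 2 * (n%:R * tau * D ^+ 2 + \sum_(j < n) tau * sq M (dt th j.+1)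
      + \sum_(j < n) tau * sq M (dt tht j.+1)).
  by rewrite -mulr_sumr !big_split /= sumtauD.
move=> h.
have e0 : sq M (err 0%N) <= K ^+ 2 * H ^+ 2 * Y n.
  apply: le_trans (ritz_M tht0) _; rewrite (ler_wpM2l KH0)//.
  exact: le_trans (ritz_le pb tht0) (Ygeb0 n).
have C20 : 0 <= C2 * H ^+ 2.
  by rewrite mulr_ge0 ?sqr_ge0// /C2 !addr_ge0// mulr_ge0// exprn_ge0.
have hth : \sum_(j < n) tau * sq M (dt th j.+1) <= Y n.
  by apply: le_trans (th_energy nN); rewrite lerDr (psd_ge0 pb).
have : n%:R * tau * D ^+ 2 + \sum_(j < n) tau * sq M (dt th j.+1)
    + \sum_(j < n) tau * sq M (dt tht j.+1) <= (2 + K) * Y n.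
  have := Yge_D n; have := tht_stab nN; lra.
move=> /(ler_wpM2l C20) => h'.
have := psd_ge0 pM (err n); rewrite /C1 -/C2; move: h h' e0 => /=; lra.
Qed.

(** The summands come from the growth of the weight, from [drho], from the residual [r] and from
    [rho] at the final time. *)
Definition Cpar : R := C1 + K ^+ 2 * (6 + T) + 2 * K ^+ 2 * T * (K + 1)
  + 2 * K ^+ 2 * (7 + T).

(** Testing with [deta] provides the term [M deta deta], which absorbs the parts of [drho] and of
    the residual in that direction. What remains is summable with the weight [t_n]. *)
Lemma parabolic_error n : (n < N)%N ->
  n.+1%:R * tau * sq b (err n.+1) <= Cpar * H ^+ 2 * Y n.+1.
Proof.
move=> nN.
have step j : (j < n.+1)%N -> j.+1%:R * tau * sq b (eta j.+1) + 0 <=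
    j%:R * tau * sq b (eta j) + (tau * sq b (eta j)
     + K ^+ 2 * H ^+ 2 * (tau * (j.+1%:R * tau * sq b (dt th j.+1)))
     + 2 * K ^+ 2 * H ^+ 2 * T * (tau * D ^+ 2 + tau * sq M (dt tht j.+1))).
  move=> jn; have jN := leq_trans jn nN.
  set z := deta j.+1.
  have Bz : B z by apply: subspace_dquot => //; apply: eB => //; exact: ltnW.
  have zE : dt th j.+1 - dt tht j.+1 = drho j.+1 + z.
    by rewrite /z !dquotB addrA subrK.
  have s1 : b (eta j.+1) (eta j.+1) - b (eta j) (eta j) <= 2 * tau * b (eta j.+1) z :=
    psd_dquot tau_gt0 pb (fun n => eta n) j.
  have s3 := drho_M jN.
  set w := drho j.+1 in zE s3 *; clearbody w z.
  have eq1 : M w z + sq M z + b (eta j.+1) z = - r j.+1 z.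
    rewrite -(psdDl pM) -zE (psdBl pM).
    have := th_eq jN z; have := tht_eq jN Bz.
    have [_ /(_ _ Bz)] := p_ritz j.+1.
    have -> : b (eta j.+1) z = b (p j.+1) z - b (tht j.+1) z by rewrite (psdBl pb).
    rewrite (psdBl pb); lra.
  have s2 : - 2 * M w z <= sq M w + sq M z.
    have := psd_ge0 pM (w + z); rewrite !(psdE pM) (psdC pM z w); lra.
  have s4 : - 2 * r j.+1 z <= sq M z + 2 * (K ^+ 2 * H ^+ 2) * (D ^+ 2 + sq M (dt tht j.+1)).
    apply: (@le_trans _ _ (2 * `|r j.+1 z|)).
      by rewrite mulNr -mulrN ler_pM2l// -normrN ler_norm.
    have := r_le jN Bz; rewrite -!(fnorm2 pM).
    set x := fnorm M (dt tht j.+1); set y := fnorm M z => h.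
    have := sqr_ge0 (K * H * (x + D) - y).
    have := mulr_ge0 (sqr_ge0 (K * H)) (sqr_ge0 (x - D)); lra.
  have s5 : 2 * b (eta j.+1) z <= K ^+ 2 * H ^+ 2 * sq b (dt th j.+1)
      + 2 * (K ^+ 2 * H ^+ 2) * (D ^+ 2 + sq M (dt tht j.+1)) by lra.
  have s6 := ler_wpM2l (ltW tau_gt0) s5.
  have s7 : sq b (eta j.+1) <= sq b (eta j) + tau * (K ^+ 2 * H ^+ 2 * sq b (dt th j.+1)
      + 2 * (K ^+ 2 * H ^+ 2) * (D ^+ 2 + sq M (dt tht j.+1))).
    by move: s1 s6; lra.
  have s8 := ler_wpM2l (tn_ge0 j.+1) s7.
  have s9 : j.+1%:R * tau * (2 * (K ^+ 2 * H ^+ 2) * (tau * D ^+ 2 + tau * sq M (dt tht j.+1)))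
     <= T * (2 * (K ^+ 2 * H ^+ 2) * (tau * D ^+ 2 + tau * sq M (dt tht j.+1))).
    apply: ler_wpM2r (tn_le jN); apply: mulr_ge0; first exact: mulr_ge0 (ler0n R 2) KH0.
    apply: addr_ge0; apply: mulr_ge0; rewrite ?(ltW tau_gt0) ?sqr_ge0//; exact: psd_ge0.
  move: s8 s9; rewrite -[j.+1]addn1 natrD; lra.
have := telescope_sum_le (E := fun j => j%:R * tau * sq b (eta j)) (p := fun=> 0) step.
have -> : \sum_(j < n.+1) (tau * sq b (eta j)
     + K ^+ 2 * H ^+ 2 * (tau * (j.+1%:R * tau * sq b (dt th j.+1)))
     + 2 * K ^+ 2 * H ^+ 2 * T * (tau * D ^+ 2 + tau * sq M (dt tht j.+1))) =
    \sum_(j < n.+1) tau * sq b (eta j)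
     + K ^+ 2 * H ^+ 2 * \sum_(j < n.+1) (tau * (j.+1%:R * tau * sq b (dt th j.+1)))
     + 2 * K ^+ 2 * H ^+ 2 * T * (n.+1%:R * tau * D ^+ 2
          + \sum_(j < n.+1) tau * sq M (dt tht j.+1)).
  rewrite !big_split /= -sumtauD; congr (_ + _ + _); first by rewrite mulr_sumr.
  by rewrite -big_split mulr_sumr.
rewrite big1// addr0 !mul0r add0r => h.
have T0 : 0 <= T by apply: le_trans tauN; exact: tn_ge0.
(* [p 0] and [tht 0] are both Ritz projections of [th 0], hence differ by a vector of zero
   energy. *)
have eta0 : sq b (eta 0%N) = 0.
  have [_ /(_ _ (eB (leq0n N)))] := p_ritz 0%N; have [_ /(_ _ (eB (leq0n N)))] := tht0.
  rewrite !(psdBl pb) => h1 h2; lra.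
have h1 : \sum_(j < n.+1) tau * sq b (eta j) <= C1 * H ^+ 2 * Y n.+1.
  rewrite big_ord_recl /= eta0 mulr0 add0r.
  apply: le_trans (err_L2 nN); rewrite [leRHS]big_ord_recr /=.
  apply: (@le_trans _ _ (\sum_(j < n) tau * sq b (err j.+1))).
    apply: ler_sum => j _; rewrite ler_pM2l// eeta; last exact: ltnW (leq_ltn_trans (ltn_ord j) nN).
    by rewrite lerDr (psd_ge0 pb).
  by rewrite lerDl mulr_ge0 ?(ltW tau_gt0)// (psd_ge0 pb).
have dE := dth_energy nN.
have tM0 : 0 <= n.+1%:R * tau * sq M (dt th n.+1) by rewrite mulr_ge0// (psd_ge0 pM).
have h2 : \sum_(j < n.+1) (tau * (j.+1%:R * tau * sq b (dt th j.+1))) <= (6 + T) * Y n.+1.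
  by apply: le_trans dE; rewrite lerDr.
have tb0 : 0 <= \sum_(j < n.+1) (tau * (j.+1%:R * tau * sq b (dt th j.+1))).
  by apply: sumr_ge0 => j _; rewrite mulr_ge0 ?(ltW tau_gt0)// mulr_ge0// (psd_ge0 pb).
have h3 := ler_wpM2l KH0 h2.
have h4 : n.+1%:R * tau * D ^+ 2 + \sum_(j < n.+1) tau * sq M (dt tht j.+1)
    <= (K + 1) * Y n.+1.
  have := tht_stab nN; have := Yge_D n.+1; lra.
have h5 := ler_wpM2l (mulr_ge0 KH0 T0) h4.
have h6 := ler_wpM2l (tn_ge0 n.+1) (rho_b nN).
have h7 : n.+1%:R * tau * (D ^+ 2 + sq M (dt th n.+1)) <= (7 + T) * Y n.+1.
  have := Yge_D n.+1; lra.
have h8 := ler_wpM2l KH0 h7.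
rewrite eeta// /Cpar; move: h h1 h3 h5 h6 h8 => /=; lra.
Qed.
End parabolic.

(** * The coupled problem *)

Lemma le_of_sqr_le_mul (R : realDomainType) (x c : R) :
  0 <= x -> 0 <= c -> x ^+ 2 <= c * x -> x <= c.
Proof.
move=> x0 c0; rewrite expr2; have [->//|xn] := eqVneq x 0.
by rewrite ler_pM2r// lt_def xn x0.
Qed.

Lemma fnorm_le_mul (R : realType) (X X' : lmodType R) (a : X -> X -> R)
    (b : X' -> X' -> R) (pa : psd_form a) (pb : psd_form b) c x y :
  0 <= c -> a x x <= c ^+ 2 * b y y -> fnorm a x <= c * fnorm b y.
Proof.
move=> c0 h; rewrite -ler_sqr ?nnegrE ?mulr_ge0 ?fnorm_ge0//.
by rewrite exprMn !fnorm2.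
Qed.

Lemma fnorm_le_mul1 (R : realType) (X X' : lmodType R) (a : X -> X -> R)
    (b : X' -> X' -> R) (pa : psd_form a) (pb : psd_form b) c x y :
  1 <= c -> a x x <= c * b y y -> fnorm a x <= c * fnorm b y.
Proof.
move=> c1 h; apply: fnorm_le_mul => //; first by lra.
apply: le_trans h _; rewrite ler_wpM2r ?(psd_ge0 pb)// expr2.
by rewrite ler_peMr//; lra.
Qed.

Lemma Cpar_ge0 (R : realType) (K T : R) : 0 <= K -> 0 <= T -> 0 <= Cpar K T.
Proof.
move=> K0 T0; have h n : 0 <= K ^+ n by exact: exprn_ge0.
have hT : 0 <= K ^+ 2 * T by exact: mulr_ge0.
have := mulr_ge0 hT K0; have := mulr_ge0 (h 2) K0; have := mulr_ge0 (h 3) K0.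
have := mulr_ge0 (h 4) K0; have := h 2; have := h 3; have := h 4.
rewrite /Cpar /C1; lra.
Qed.

Section coupled.
Variables (R : realType) (X1 X2 : lmodType R).
Variables (a h1 m1 : X1 -> X1 -> R) (b h2 m : X2 -> X2 -> R) (d : X2 -> X1 -> R).
Variables (A F : X1 -> Prop) (B G : X2 -> Prop) (fc : X2 -> X1 -> Prop).
Variables (K H T D tau cs del eps : R) (N : nat).
Hypotheses (pa : psd_form a) (ph1 : psd_form h1) (pm1 : psd_form m1).
Hypotheses (pb : psd_form b) (ph2 : psd_form h2) (pm : psd_form m).
Hypothesis dl : forall v, linear_functional (d^~ v).
Hypothesis dr : forall q, linear_functional (d q).
Hypotheses (sA : subspace A) (sB : subspace B).
Hypotheses (K_ge1 : 1 <= K) (H_gt0 : 0 < H) (D_ge0 : 0 <= D) (tau_gt0 : 0 < tau).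
Hypotheses (del_ge0 : 0 <= del) (eps_ge0 : 0 <= eps).
Hypothesis tauN : N%:R * tau <= T.
Hypothesis a_lo : forall v, cs * h1 v v <= a v v.
Hypothesis a_hi : forall v, a v v <= K * h1 v v.
Hypothesis csK : 1 <= K * cs.
Hypothesis b_lo : forall q, h2 q q <= K * b q q.
Hypothesis b_hi : forall q, b q q <= K * h2 q q.
Hypothesis m_le : forall q, m q q <= h2 q q.
Hypothesis m1_le : forall v, m1 v v <= h1 v v.
Hypothesis d_le : forall q v, `|d q v| <= K * fnorm m q * fnorm h1 v.
Hypothesis F_m1 : forall w, F w -> m1 w w <= (K * H) ^+ 2 * h1 w w.
Hypothesis G_m : forall w, G w -> m w w <= (K * H) ^+ 2 * h2 w w.
Hypothesis decomp1 : forall v, exists vA vF, [/\ A vA, F vF & v = vA + vF].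
Hypothesis decomp2 : forall q, exists qB qG,
  [/\ B qB, G qG, q = qB + qG & h2 qG qG <= K * h2 q q].
Hypothesis a_orth : forall v w, A v -> F w ->
  `|a v w| <= del * fnorm h1 v * fnorm h1 w.
Hypothesis b_orth : forall v w, B v -> G w ->
  `|b v w| <= K * H * fnorm h2 v * fnorm h2 w.
Hypothesis fc_lin : forall k q v q' v', fc q v -> fc q' v' ->
  fc (k *: q + q') (k *: v + v').
Hypothesis fcF : forall q v, fc q v -> F v.
Hypothesis fc_le : forall q v, B q -> fc q v -> forall w, F w ->
  `|a v w - d q w| <= eps * fnorm m q * fnorm h1 w.
Hypothesis delH : del <= K * H.
Hypothesis epsH : eps <= K * H.
Hypothesis eps4 : 4 * eps <= 1.
Hypothesis del_eps : del + eps <= cs.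
Hypothesis del_cs : cs <= K * (cs - del).

Variables (n1 n2 : nat) (phi1 : nat -> X1 -> R) (phi2 : nat -> X2 -> R).
Hypothesis lphi1 : forall i, linear_functional (phi1 i).
Hypothesis lphi2 : forall i, linear_functional (phi2 i).
Hypothesis phi1_inj : forall v, (forall i, (i < n1)%N -> phi1 i v = 0) -> v = 0.
Hypothesis phi2_inj : forall v, (forall i, (i < n2)%N -> phi2 i v = 0) -> v = 0.

Variables (f : nat -> X1 -> R) (g : nat -> X2 -> R).
Hypothesis lf : forall n, linear_functional (f n).
Hypothesis f_le : forall n, (n <= N)%N -> forall v, `|f n v| <= D * fnorm m1 v.
Hypothesis df_le : forall n, (n < N)%N -> forall v,
  `|f n.+1 v - f n v| <= tau * D * fnorm m1 v.
Hypothesis ddf_le : forall n, (n.+1 < N)%N -> forall v,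
  `|f n.+2 v - f n.+1 v - (f n.+1 v - f n v)| <= tau ^+ 2 * (2 * D) * fnorm h1 v.
Hypothesis g_le : forall n, (n < N)%N -> forall q, `|g n.+1 q| <= D * fnorm m q.
Hypothesis dg_le : forall n, (n.+1 < N)%N -> forall q,
  `|g n.+2 q - g n.+1 q| <= tau * D * fnorm h2 q.

Local Notation dt := (dquot tau).
Local Notation sq a v := (a v v).

Variables (u : nat -> X1) (th : nat -> X2).
Hypothesis u_eq : forall n, (n <= N)%N -> forall v, a (u n) v - d (th n) v = f n v.
Hypothesis th_eq : forall n, (n < N)%N -> forall q,
  m (dt th n.+1) q + b (th n.+1) q + d q (dt u n.+1) = g n.+1 q.

Variables (uA uF : nat -> X1) (tht : nat -> X2).
Local Notation ut n := (uA n + uF n).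
Hypothesis uA_A : forall n, (n <= N)%N -> A (uA n).
Hypothesis tht_B : forall n, (n <= N)%N -> B (tht n).
Hypothesis uF_fc : forall n, (n <= N)%N -> fc (tht n) (uF n).
Hypothesis ut_eq : forall n, (n <= N)%N -> forall v, A v ->
  a (ut n) v - d (tht n) v = f n v.
Hypothesis tht_eq : forall n, (n < N)%N -> forall q, B q ->
  m (dt tht n.+1) q + b (tht n.+1) q + d q (dt (fun n => ut n) n.+1) = g n.+1 q.
Hypothesis tht0 : forall z, B z -> b (th 0%N - tht 0%N) z = 0.

Let K_ge0 : 0 <= K. Proof. exact: le_trans ler01 K_ge1. Qed.
Let K_gt0 : 0 < K. Proof. exact: lt_le_trans ltr01 K_ge1. Qed.
Let cs_gt0 : 0 < cs.
Proof. by rewrite -(pmulr_rgt0 _ K_gt0); exact: lt_le_trans csK. Qed.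
Let H_ge0 : 0 <= H. Proof. exact: ltW. Qed.
Let KH_ge0 : 0 <= K * H. Proof. by rewrite mulr_ge0// ltW. Qed.

Let h1_a v : sq h1 v <= K * sq a v.
Proof.
apply: le_trans (ler_wpM2l K_ge0 (a_lo v)); rewrite mulrA.
by rewrite ler_peMl// (psd_ge0 ph1).
Qed.

(** Stands in for uniqueness of the elliptic problem: two solutions differ by a vector of zero
    energy, which the coupling does not see. *)
Let h1_zero v q : sq a v = 0 -> d q v = 0.
Proof.
move=> av; have := d_le q v; rewrite {2}/fnorm.
have -> : sq h1 v = 0.
  by apply/eqP; rewrite eq_le (psd_ge0 ph1) andbT; apply: le_trans (h1_a v) _; rewrite av mulr0.
by rewrite sqrtr0 mulr0 normr_le0 => /eqP.
Qed.

Let elliptic_le v c : 0 <= c -> sq a v <= c * fnorm h1 v -> fnorm h1 v <= K * c.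
Proof.
move=> c0 av; apply: le_of_sqr_le_mul; rewrite ?fnorm_ge0 ?mulr_ge0//.
rewrite (fnorm2 ph1); apply: le_trans (h1_a v) _.
by rewrite -mulrA ler_wpM2l.
Qed.

Let S_ex q : exists v, forall w, a v w = d q w.
Proof.
have [|||v _ hv] := @riesz_exists _ _ a pa (d q) (K ^+ 3 * sq m q) n1 phi1 (fun=> True) lphi1 (dr q).
- by [].
- move=> w _; have := d_le q w; rewrite -[`|_|]ger0_norm// -ler_sqr ?nnegrE ?normr_ge0//.
    rewrite normr_id real_normK ?num_real// !exprMn !fnorm2// => h.
    apply: le_trans h _; rewrite [leRHS](_ : _ = K ^+ 2 * sq m q * (K * sq a w)); last by ring.
    by rewrite ler_wpM2l// mulr_ge0 ?sqr_ge0// (psd_ge0 pm).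
  by rewrite !mulr_ge0// ?fnorm_ge0.
- by move=> w _ /phi1_inj ->; rewrite (psd0l pa).
by exists v => w; exact: hv.
Qed.

Let w_ex n : (n <= N)%N -> exists v, forall w, a v w = f n w.
Proof.
move=> nN.
have [|||v _ hv] := @riesz_exists _ _ a pa (f n) (K * D ^+ 2) n1 phi1 (fun=> True) lphi1 (lf n).
- by [].
- move=> w _; have := f_le nN w; rewrite -[`|_|]ger0_norm// -ler_sqr ?nnegrE ?normr_ge0//.
    rewrite normr_id real_normK ?num_real// !exprMn !fnorm2// => h.
    apply: le_trans h _; rewrite [leRHS](_ : _ = D ^+ 2 * (K * sq a w)); last by ring.
    rewrite ler_wpM2l ?sqr_ge0//; exact: le_trans (m1_le w) (h1_a w).
  by rewrite !mulr_ge0// ?fnorm_ge0.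
- by move=> w _ /phi1_inj ->; rewrite (psd0l pa).
by exists v => w; exact: hv.
Qed.

Lemma ritz_ex v : exists p, ritz b B v p.
Proof.
have [||p Bp hp] := @riesz_exists _ _ b pb (b v) (sq b v) n2 phi2 B lphi2 (psd_funr pb v) sB.
- by move=> w _; exact: psd_CS2.
- by move=> w _ /phi2_inj ->; rewrite (psd0l pb).
by exists p; split => // z Bz; rewrite (psdBl pb) hp// subrr.
Qed.

(** Solution of the dual problem in the duality argument of [ritz_error_M]. *)
Lemma dual_ex (M : X2 -> X2 -> R) (c : R) e : psd_form M ->
  (forall q, sq M q <= c * sq b q) -> exists z, forall q, b z q = M e q.
Proof.
move=> pM Mb.
have [|||p _ hp] := @riesz_exists _ _ b pb (M e) (sq M e * c) n2 phi2 (fun=> True)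
  lphi2 (psd_funr pM e).
- by [].
- move=> w _; apply: le_trans (psd_CS2 pM e w) _.
  by rewrite -mulrA ler_wpM2l// (psd_ge0 pM).
- by move=> w _ /phi2_inj ->; rewrite (psd0l pb).
by exists p => z; exact: hp.
Qed.

Let a_le v w : a v w <= K ^+ 2 * fnorm h1 v * fnorm h1 w.
Proof.
apply: le_trans (psd_CSW pa v w) _.
rewrite [leRHS](_ : _ = K * fnorm h1 v * (K * fnorm h1 w)); last by ring.
by rewrite ler_pM ?fnorm_ge0//; exact: fnorm_le_mul1.
Qed.

(** Almost orthogonality bounds the energy of [v] below by [cs - del] times the sum of the two
    squared norms, so the splitting is stable; [del_cs] keeps the constant uniform. *)
Let decomp1_le v vA vF : A vA -> F vF -> v = vA + vF ->
  fnorm h1 vF <= K ^+ 2 * fnorm h1 v.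
Proof.
move=> AvA FvF vE; apply: fnorm_le_mul => //; first exact: exprn_ge0.
have o := le_trans (ler_norm _) (a_orth AvA FvF).
have oN : - a vA vF <= del * fnorm h1 vA * fnorm h1 vF.
  by apply: le_trans (a_orth AvA FvF); rewrite -normrN ler_norm.
have av : sq a v = sq a vA + 2 * a vA vF + sq a vF.
  by rewrite vE !(psdE pa) (psdC pa vF vA); ring.
have lA := a_lo vA; have lF := a_lo vF.
rewrite -!(fnorm2 ph1) in lA lF *.
set x := fnorm h1 vA in oN lA *; set y := fnorm h1 vF in oN lA lF *.
have p1 : (cs - del) * y ^+ 2 <= sq a v.
  have := mulr_ge0 del_ge0 (sqr_ge0 (x - y)).
  have : 0 <= (cs - del) * x ^+ 2.
    rewrite mulr_ge0 ?sqr_ge0//; move: del_eps eps_ge0; lra.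
  lra.
have p2 : cs * y ^+ 2 <= K * sq a v.
  apply: (@le_trans _ _ (K * (cs - del) * y ^+ 2)); first by rewrite ler_wpM2r ?sqr_ge0.
  by rewrite -mulrA ler_wpM2l.
have p3 : y ^+ 2 <= K ^+ 2 * sq a v.
  apply: (@le_trans _ _ (K * cs * y ^+ 2)); first by rewrite ler_peMl ?sqr_ge0.
  by rewrite -mulrA expr2 -mulrA ler_wpM2l.
apply: le_trans p3 _; rewrite (fnorm2 ph1).
apply: (@le_trans _ _ (K ^+ 2 * (K * sq h1 v))); first by rewrite ler_wpM2l ?exprn_ge0.
rewrite -exprM mulrA ler_wpM2r ?(psd_ge0 ph1)// -exprSr.
by rewrite ler_weXn2l.
Qed.

(** [K ^+ 4] collects coercivity, the factor of [H] and the stability of the splitting; the bracket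
    bounds the norm of [vA] together with the data. *)
Definition Kc : R := K ^+ 4 * (K ^+ 2 + K ^+ 4 * (K + 1) + K + 1).

(* [vA + vF] differs from the solution [U] of the unlocalized elliptic problem with
   the same temperature only through its component in [F]. *)
Lemma elliptic_consistency q vA vF U (l : X1 -> R) P :
  0 <= P -> (forall v, `|l v| <= P * fnorm m1 v) ->
  B q -> A vA -> fc q vF -> (forall v, A v -> a (vA + vF) v - d q v = l v) ->
  (forall v, a U v - d q v = l v) ->
  fnorm h1 (vA + vF - U) <= Kc * H * (fnorm m q + P).
Proof.
move=> P0 lP Bq AvA fcq eqA eqU.
have FvF := fcF fcq.
have m1h v : fnorm m1 v <= fnorm h1 v.
  by rewrite -[leRHS]mul1r; apply: fnorm_le_mul1 => //; rewrite mul1r.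
set z := fnorm m q; have z0 : 0 <= z := fnorm_ge0 _ _.
set y := fnorm h1 vF; have y0 : 0 <= y := fnorm_ge0 _ _.
set x := fnorm h1 vA; have x0 : 0 <= x := fnorm_ge0 _ _.
have hy : y <= K * ((K + 1) * z).
  apply: elliptic_le; first by rewrite mulr_ge0// addr_ge0.
  have := le_trans (ler_norm _) (fc_le Bq fcq FvF); rewrite -/z -/y => i1.
  have := le_trans (ler_norm _) (d_le q vF); rewrite -/z -/y => i2.
  have : 4 * eps * (z * y) <= 1 * (z * y) by rewrite ler_wpM2r// mulr_ge0.
  have := mulr_ge0 eps_ge0 (mulr_ge0 z0 y0); lra.
have hx : x <= K * (K * z + P + K ^+ 2 * y).
  apply: elliptic_le; first by rewrite !addr_ge0// mulr_ge0// exprn_ge0.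
  have := eqA _ AvA; rewrite (psdDl pa) => i0.
  have := le_trans (ler_norm _) (d_le q vA); rewrite -/z -/x => i1.
  have := le_trans (ler_norm _) (lP vA) => i2.
  have i3 := ler_wpM2l P0 (m1h vA); rewrite -/x in i3.
  have i4 := a_le (- vF) vA; rewrite (psdNl pa) (fnormN ph1) -/x -/y in i4.
  rewrite -/x; lra.
set e := vA + vF - U.
(* Galerkin orthogonality: tested with itself, the error leaves only its component [wF] in [F]. *)
have eA v : A v -> a e v = 0.
  by move=> Av; have := eqA _ Av; have := eqU v; rewrite /e (psdBl pa); lra.
have [wA [wF [AwA FwF ewE]]] := decomp1 e.
have wFe := decomp1_le AwA FwF ewE.
have KE : fnorm h1 e <= K * (K ^+ 3 * H * (x + z + P)).
  apply: elliptic_le; first by rewrite !mulr_ge0 ?addr_ge0 ?exprn_ge0// ltW.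
  have -> : sq a e = a e wF by rewrite {2}ewE (psdDr pa) eA// add0r.
  (* The three defects on [F]: almost orthogonality, localization of the fine correction, and the
     load that the correction ignores. The last is small because [wF] is small in the norm of
     [m1]. *)
  have -> : a e wF = a vA wF + (a vF wF - d q wF) - l wF.
    have := eqU wF; rewrite /e (psdBl pa) (psdDl pa); lra.
  have i1 := le_trans (ler_norm _) (a_orth AvA FwF).
  have i2 := le_trans (ler_norm _) (fc_le Bq fcq FwF).
  have i3 : - l wF <= P * (K * H * fnorm h1 wF).
    apply: le_trans (_ : P * fnorm m1 wF <= _).
      by apply: le_trans (lP wF); rewrite -normrN ler_norm.
    by rewrite ler_wpM2l//; apply: fnorm_le_mul => //; exact: F_m1.
  rewrite -/x -/z in i1 i2; set w := fnorm h1 wF in i1 i2 i3 wFe.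
  have w0 : 0 <= w := fnorm_ge0 _ _.
  have i4 : del * x * w <= K * H * x * w by rewrite !ler_wpM2r.
  have i5 : eps * z * w <= K * H * z * w by rewrite !ler_wpM2r.
  apply: (@le_trans _ _ (K * H * (x + z + P) * w)); first lra.
  apply: (@le_trans _ _ (K * H * (x + z + P) * (K ^+ 2 * fnorm h1 e))).
    by rewrite ler_wpM2l// mulr_ge0// !addr_ge0.
  by rewrite le_eqVlt; apply/orP; left; apply/eqP; ring.
apply: le_trans KE _; rewrite /Kc.
rewrite [leLHS](_ : _ = K ^+ 4 * H * (x + z + P)); last by ring.
rewrite [leRHS](_ : _ = K ^+ 4 * H * ((K ^+ 2 + K ^+ 4 * (K + 1) + K + 1) * (z + P))); last by ring.
rewrite ler_wpM2l//; first by rewrite mulr_ge0 ?exprn_ge0// ltW.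
have j1 := ler_wpM2l (exprn_ge0 3 K_ge0) hy.
have j2 : 0 <= K ^+ 4 * (K + 1) * P by rewrite !mulr_ge0 ?exprn_ge0// addr_ge0.
have j3 : 0 <= K ^+ 2 * P by rewrite mulr_ge0 ?exprn_ge0.
have j4 : 0 <= K * z by rewrite mulr_ge0.
lra.
Qed.

(** * Elimination of the displacement *)

Section reduction.
Variables (S : X2 -> X1) (w : nat -> X1).
Hypothesis S_eq : forall q v, a (S q) v = d q v.
Hypothesis w_eq : forall n, (n <= N)%N -> forall v, a (w n) v = f n v.

Definition M (q q' : X2) : R := m q q' + d q (S q').

(** The coupling part of [M] is [a (S q) (S q')], hence symmetric and nonnegative. *)
Lemma psd_M : psd_form M.
Proof.
split.
- by move=> k x y z; rewrite /M (psd_linear pm) (dl (S z)); ring.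
- by move=> x y; rewrite /M (psdC pm) -!S_eq (psdC pa).
- by move=> x; rewrite /M addr_ge0 ?(psd_ge0 pm)// -S_eq (psd_ge0 pa).
Qed.

Let m_M q : sq m q <= sq M q.
Proof. by rewrite /M lerDl -S_eq (psd_ge0 pa). Qed.

Let S_le q : fnorm h1 (S q) <= K * (K * fnorm m q).
Proof.
apply: elliptic_le; first by rewrite mulr_ge0 ?fnorm_ge0.
by rewrite S_eq; exact: le_trans (ler_norm _) (d_le _ _).
Qed.

Definition L : R := 1 + K ^+ 3.
Let L_ge1 : 1 <= L. Proof. by rewrite /L lerDl exprn_ge0. Qed.
Let L_ge0 : 0 <= L. Proof. exact: le_trans L_ge1. Qed.

Let M_m q : sq M q <= L * sq m q.
Proof.
rewrite /M /L mulrDl mul1r lerD2l.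
apply: le_trans (le_trans (ler_norm _) (d_le _ _)) _.
rewrite -(fnorm2 pm) [leRHS](_ : _ = K * fnorm m q * (K * (K * fnorm m q))); last by ring.
by rewrite ler_wpM2l// mulr_ge0 ?fnorm_ge0.
Qed.

Let M_b q : sq M q <= L * K * sq b q.
Proof.
apply: le_trans (M_m q) _; rewrite -mulrA ler_wpM2l//.
exact: le_trans (m_le q) (b_lo q).
Qed.

Let nM_m q : fnorm M q <= L * fnorm m q.
Proof. by apply: fnorm_le_mul1 => //; exact: psd_M. Qed.

Let nm_M q : fnorm m q <= fnorm M q.
Proof.
rewrite -[leRHS]mul1r; apply: fnorm_le_mul1 => //; first exact: psd_M.
by rewrite mul1r.
Qed.

Let nh2_b q : fnorm h2 q <= K * fnorm b q.
Proof. exact: fnorm_le_mul1. Qed.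

Let LK_ge1 : 1 <= L * K.
Proof. by rewrite -[1]mulr1 ler_pM. Qed.

Definition Kritz : R := K ^+ 3 * L * (1 + K ^+ 2).
Let Kritz_ge0 : 0 <= Kritz.
Proof. by rewrite /Kritz !mulr_ge0 ?addr_ge0 ?exprn_ge0. Qed.

(** The error is orthogonal to [B], so its energy is [b v eG - b p eG] with [eG] its fine part: the
    first term is small because [eG] is small in [m], the second by almost orthogonality. *)
Lemma ritz_error_b v p k : 0 <= k -> ritz b B v p ->
  (forall q, `|b v q| <= k * fnorm M q) -> fnorm b (v - p) <= Kritz * H * k.
Proof.
move=> k0 rvp bv; have [Bp hp] := rvp; set e := v - p in hp *.
have [eB [eG [BeB GeG eE eG2]]] := decomp2 e.
have neG : fnorm h2 eG <= K ^+ 2 * fnorm b e.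
  rewrite expr2 -mulrA; apply: le_trans (ler_wpM2l K_ge0 (nh2_b e)).
  exact: fnorm_le_mul1.
have nv : fnorm b v <= k * (L * K).
  apply: le_of_sqr_le_mul; rewrite ?fnorm_ge0 ?mulr_ge0// (fnorm2 pb).
  apply: le_trans (le_trans (ler_norm _) (bv v)) _.
  by rewrite -mulrA ler_wpM2l//; apply: fnorm_le_mul1 => //; exact: psd_M.
have np : fnorm h2 p <= K * (k * (L * K)).
  apply: le_trans (nh2_b p) _; rewrite ler_wpM2l//; apply: le_trans nv.
  by rewrite ler_wsqrtr// (ritz_le2 pb rvp).
apply: le_of_sqr_le_mul;
  [exact: fnorm_ge0|exact: mulr_ge0 (mulr_ge0 Kritz_ge0 (ltW H_gt0)) k0|rewrite (fnorm2 pb)].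
have -> : b e e = b v eG - b p eG.
  by rewrite {2}eE (psdDr pb) hp// add0r /e (psdBl pb).
have i1 := le_trans (ler_norm _) (bv eG).
have i2 : - b p eG <= K * H * fnorm h2 p * fnorm h2 eG.
  by apply: le_trans (b_orth Bp GeG); rewrite -normrN ler_norm.
have i3 : fnorm M eG <= L * (K * H * fnorm h2 eG).
  apply: le_trans (nM_m eG) _; rewrite ler_wpM2l//.
  by apply: fnorm_le_mul => //; exact: G_m.
have w0 : 0 <= fnorm h2 eG := fnorm_ge0 _ _.
have i4 := ler_wpM2l k0 i3.
have i5 : K * H * fnorm h2 p * fnorm h2 eG <= K * H * (K * (k * (L * K))) * fnorm h2 eG.
  by rewrite ler_wpM2r// ler_wpM2l.
apply: (@le_trans _ _ (K * H * L * k * (1 + K ^+ 2) * fnorm h2 eG)); first lra.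
apply: (@le_trans _ _ (K * H * L * k * (1 + K ^+ 2) * (K ^+ 2 * fnorm b e))).
  by rewrite ler_wpM2l// !mulr_ge0 ?addr_ge0 ?exprn_ge0.
by rewrite /Kritz le_eqVlt; apply/orP; left; apply/eqP; ring.
Qed.

(** Duality without elliptic regularity: the functional of the dual problem is bounded in the norm
    of [M], so [ritz_error_b] applies to the dual solution. *)
Lemma ritz_error_M v p : ritz b B v p -> fnorm M (v - p) <= Kritz * H * fnorm b (v - p).
Proof.
move=> rvp; have [Bp hp] := rvp; set e := v - p in hp *.
have [z hz] := dual_ex e psd_M M_b.
have [pz rz] := ritz_ex z; have [Bpz _] := rz.
have zz : fnorm b (z - pz) <= Kritz * H * fnorm M e.
  apply: ritz_error_b => //; first exact: fnorm_ge0.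
  by move=> q; rewrite hz; exact: (psd_CS psd_M).
apply: le_of_sqr_le_mul; [exact: fnorm_ge0| |].
  exact: mulr_ge0 (mulr_ge0 Kritz_ge0 (ltW H_gt0)) (fnorm_ge0 _ _).
rewrite (fnorm2 psd_M) -hz.
have -> : b z e = b (z - pz) e by rewrite (psdBl pb) (psdC pb pz) hp// subr0.
apply: le_trans (psd_CSW pb _ _) _.
rewrite [leRHS](_ : _ = Kritz * H * fnorm M e * fnorm b e); last by ring.
by rewrite ler_wpM2r ?fnorm_ge0.
Qed.

(** The heat equation is tested with [dt tht], the differenced mechanics with [dt uA], and the
    defect bound [fc_le] with [dt uF]. The coupling then becomes elastic energy up to terms of size
    [del] and [eps], absorbed by [del + eps <= cs] and [4 * eps <= 1]. *)
Lemma localized_stability n : (n <= N)%N ->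
  sq b (tht n) + \sum_(j < n) tau * sq m (dt tht j.+1)
  <= sq b (th 0%N) + (K + 2) * (n%:R * tau * D ^+ 2).
Proof.
move=> nN.
have step j : (j < n)%N -> sq b (tht j.+1) + tau * sq m (dt tht j.+1)
    <= sq b (tht j) + (K + 2) * (tau * D ^+ 2).
  move=> jn; have jN := leq_trans jn nN.
  set q := dt tht j.+1; set vA := dt uA j.+1; set vF := dt uF j.+1.
  have Bq : B q.
    exact: (subspace_dquot tau (v := tht) (n := j.+1) sB (tht_B jN) (tht_B (ltnW jN))).
  have AvA : A vA.
    exact: (subspace_dquot tau (v := uA) (n := j.+1) sA (uA_A jN) (uA_A (ltnW jN))).
  have fcv : fc q vF.
    (* [fc] is only known to be closed under linear combinations, so the zero pair is obtained by
       cancelling an existing pair. *)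
    have fc0 : fc 0 0.
      have := fc_lin (- 1) (uF_fc jN) (uF_fc jN).
      by rewrite !scaleN1r !addNr.
    have := fc_lin (tau^-1) (fc_lin (- 1) (uF_fc (ltnW jN)) (uF_fc jN)) fc0.
    by rewrite !scaleN1r !addr0 ![- _ + _]addrC.
  have FvF := fcF fcv.
  have vE : dt (fun n => ut n) j.+1 = vA + vF.
    by rewrite /dquot -scalerDr opprD addrACA.
  have eqA v : A v -> a (vA + vF) v - d q v = tau^-1 * (f j.+1 v - f j v).
    move=> Av; rewrite -vE /q /dquot (psdZl pa) (psdBl pa) (lfunZ (dl v)) (lfunB (dl v)).
    rewrite -(ut_eq jN Av) -(ut_eq (ltnW jN) Av) /=; ring.
  have dfA : tau^-1 * (f j.+1 vA - f j vA) <= D * fnorm h1 vA.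
    rewrite ler_pdivrMl// mulrA; apply: le_trans (le_trans (ler_norm _) (df_le jN vA)) _.
    rewrite ler_wpM2l ?mulr_ge0// ?(ltW tau_gt0)//.
    by rewrite ler_wsqrtr.
  have s1 := psd_dquot tau_gt0 pb tht j; rewrite -/q in s1.
  have := tht_eq jN Bq; rewrite vE -/q (lfunD (dr q)) => s2.
  have := le_trans (ler_norm _) (g_le jN q) => s3.
  have s4 := le_trans (ler_norm _) (fc_le Bq fcv FvF).
  have s5 : - a vA vF <= del * fnorm h1 vA * fnorm h1 vF.
    by apply: le_trans (a_orth AvA FvF); rewrite -normrN ler_norm.
  have := eqA _ AvA; rewrite (psdDl pa) (psdC pa vF vA) => s6.
  have lA := a_lo vA; have lF := a_lo vF.
  rewrite -!(fnorm2 ph1) in lA lF.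
  rewrite -(fnorm2 pm q) in s2 *.
  clearbody q vA vF.
  set x := fnorm h1 vA in dfA s5 lA; set y := fnorm h1 vF in s4 s5 lF.
  set z := fnorm m q in s2 s3 s4 *.
  have x0 : 0 <= x := fnorm_ge0 _ _.
  have y0 : 0 <= y := fnorm_ge0 _ _.
  have z0 : 0 <= z := fnorm_ge0 _ _.
  have k1 : 2 * (del * x * y) <= del * x ^+ 2 + del * y ^+ 2.
    have := mulr_ge0 del_ge0 (sqr_ge0 (x - y)); lra.
  have k2 : 4 * (eps * z * y) <= 4 * eps * z ^+ 2 + eps * y ^+ 2.
    have := mulr_ge0 eps_ge0 (sqr_ge0 (2 * z - y)); lra.
  have k3 : 4 * eps * z ^+ 2 <= 1 * z ^+ 2 by rewrite ler_wpM2r ?sqr_ge0.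
  have k4 : (del + eps) * x ^+ 2 <= cs * x ^+ 2 by rewrite ler_wpM2r ?sqr_ge0.
  have k5 : (del + eps) * y ^+ 2 <= cs * y ^+ 2 by rewrite ler_wpM2r ?sqr_ge0.
  have k6 : 2 * (D * x) <= cs * x ^+ 2 + K * D ^+ 2.
    rewrite -(ler_pM2l cs_gt0).
    have := sqr_ge0 (cs * x - D); have := ler_wpM2r (sqr_ge0 D) csK; lra.
  have k7 : D * z <= 4^-1 * z ^+ 2 + D ^+ 2.
    have := sqr_ge0 (2^-1 * z - D); lra.
  have k8 : 0 <= eps * x ^+ 2 by rewrite mulr_ge0 ?sqr_ge0.
  have k9 : 0 <= eps * y ^+ 2 by rewrite mulr_ge0 ?sqr_ge0.
  have k10 : 0 <= cs * y ^+ 2 by rewrite mulr_ge0 ?sqr_ge0// ltW.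
  have : 2 * b (tht j.+1) q + z ^+ 2 <= (K + 2) * D ^+ 2.
    rewrite -s6 in dfA; lra.
  move=> /(ler_wpM2l (ltW tau_gt0)); lra.
have := telescope_sum_le (E := fun j => sq b (tht j)) step.
rewrite -[X in _ <= _ + X]mulr_sumr sumr_const card_ord -[X in _ * X]mulr_natl.
have b0 : sq b (tht 0%N) <= sq b (th 0%N).
  by apply: (ritz_le2 pb (B := B)); split; [exact: tht_B|exact: tht0].
rewrite -[X in _ -> _ <= _ + (_ * X)]mulrA; lra.
Qed.

Let a_dw n v : (n < N)%N -> a (dt w n.+1) v = tau^-1 * (f n.+1 v - f n v).
Proof.
by move=> nN; rewrite /dquot (psdZl pa) (psdBl pa) !w_eq// ltnW.
Qed.

Let m1_h1 v : fnorm m1 v <= fnorm h1 v.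
Proof. exact: ler_wsqrtr. Qed.

Let m_h2 q : fnorm m q <= fnorm h2 q.
Proof. exact: ler_wsqrtr. Qed.

Let dw_le n : (n < N)%N -> fnorm h1 (dt w n.+1) <= K * D.
Proof.
move=> nN; apply: elliptic_le => //; rewrite a_dw// ler_pdivrMl// mulrA.
apply: le_trans (le_trans (ler_norm _) (df_le nN _)) _.
by rewrite ler_wpM2l// mulr_ge0// ltW.
Qed.

Let ddw_le n : (n.+1 < N)%N -> fnorm h1 (dt w n.+2 - dt w n.+1) <= K * (tau * (2 * D)).
Proof.
move=> nN; apply: elliptic_le; first by rewrite !mulr_ge0// ltW.
set v := dt w n.+2 - dt w n.+1.
rewrite {1}/v (psdBl pa) !a_dw ?(ltnW nN)// -mulrBr ler_pdivrMl// !mulrA -expr2.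
rewrite -[tau ^+ 2 * 2 * D]mulrA.
exact: le_trans (ler_norm _) (ddf_le nN v).
Qed.

(** [l] is the load of the reduced equation, with the displacement due to [f] moved to the right.
    [r] measures, through the coupling, how far the multiscale displacement is from the full elastic
    response to the multiscale temperature. *)
Let l n q : R := g n q - d q (dt w n).
Let r n q : R := d q (S (dt tht n) + dt w n - dt (fun n => ut n) n).
(** Factor between the data and the bounds on [l] and its increments; the 2 stems from the second
    differences of [f], the last [K] from passing to the norm of [b]. *)
Let K5 : R := (1 + 2 * K ^+ 2) * K.
Let D' : R := K5 * D.
(** A sum, so as to dominate every constant that [parabolic_error] needs: comparison of [M] with
    [b], Ritz errors, residual, stability. *)
Let Kp : R := 1 + L * K + Kritz + K * Kc + L * (K + 2).

Let Kc_ge0 : 0 <= Kc. Proof. by rewrite /Kc mulr_ge0 ?exprn_ge0// !addr_ge0 ?exprn_ge0// mulr_ge0 ?exprn_ge0// addr_ge0. Qed.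
Let p1 : 0 <= L * K. Proof. exact: mulr_ge0. Qed.
Let p2 : 0 <= K * Kc. Proof. exact: mulr_ge0. Qed.
Let p3 : 0 <= L * (K + 2). Proof. by rewrite mulr_ge0// addr_ge0. Qed.
Let K5_ge1 : 1 <= K5.
Proof.
rewrite /K5; have := mulr_ge0 K_ge0 (exprn_ge0 2 K_ge0).
by move: K_ge1; lra.
Qed.
Let D_D' : D <= D'. Proof. by rewrite /D' ler_peMl. Qed.
Let Kp_ge1 : 1 <= Kp. Proof. by rewrite /Kp; move: p1 p2 p3 Kritz_ge0; lra. Qed.
Let Kritz_Kp : Kritz <= Kp. Proof. by rewrite /Kp; move: p1 p2 p3 Kritz_ge0; lra. Qed.

(** [dt u] and [S (dt th) + dt w] solve the same elliptic problem, so by [h1_zero] the coupling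
    takes equal values on them. *)
Let th_eqM n : (n < N)%N -> forall q, M (dt th n.+1) q + b (th n.+1) q = l n.+1 q.
Proof.
move=> nN q; rewrite (psdC psd_M) /M (psdC pm) /l -(th_eq nN q).
have : d q (S (dt th n.+1) + dt w n.+1 - dt u n.+1) = 0.
  apply: h1_zero; set v := _ - _; rewrite {1}/v (psdBl pa) (psdDl pa) S_eq a_dw//.
  have -> : a (dt u n.+1) v = tau^-1 * (a (u n.+1) v - a (u n) v).
    by rewrite /dquot (psdZl pa) (psdBl pa).
  have -> : d (dt th n.+1) v = tau^-1 * (d (th n.+1) v - d (th n) v).
    by rewrite /dquot (lfunZ (dl v)) (lfunB (dl v)).
  rewrite -!u_eq ?(ltnW nN)//; ring.
rewrite (lfunB (dr q)) (lfunD (dr q)); lra.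
Qed.

Let tht_eqM n : (n < N)%N -> forall q, B q ->
  M (dt tht n.+1) q + b (tht n.+1) q = l n.+1 q + r n.+1 q.
Proof.
move=> nN q Bq; rewrite (psdC psd_M) /M (psdC pm) /l -(tht_eq nN Bq) /r.
rewrite (lfunB (dr q)) (lfunD (dr q)); lra.
Qed.

Let l_le n : (n < N)%N -> forall q, `|l n.+1 q| <= D' * fnorm M q.
Proof.
move=> nN q; rewrite /l (le_trans (ler_normB _ _))//.
have i1 := g_le nN q; have i2 := d_le q (dt w n.+1).
have z0 : 0 <= fnorm m q := fnorm_ge0 _ _.
have i3 : K * fnorm m q * fnorm h1 (dt w n.+1) <= K * fnorm m q * (K * D).
  by rewrite ler_wpM2l ?dw_le// mulr_ge0.
have i4 : D' * fnorm m q <= D' * fnorm M q.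
  by rewrite ler_wpM2l//; exact: le_trans D_D'.
apply: le_trans i4; rewrite /D' /K5.
have i5 : 0 <= D * fnorm m q by exact: mulr_ge0.
have i6 := ler_wpM2r i5 K_ge1.
have i7 : 1 * (K ^+ 2 * (D * fnorm m q)) <= K * (K ^+ 2 * (D * fnorm m q)).
  by rewrite ler_wpM2r// mulr_ge0 ?exprn_ge0.
have i8 : 0 <= K ^+ 2 * (D * fnorm m q) by rewrite mulr_ge0 ?exprn_ge0.
lra.
Qed.

Let dl_le n : (n.+1 < N)%N -> forall q, `|l n.+2 q - l n.+1 q| <= tau * D' * fnorm b q.
Proof.
move=> nN q.
have -> : l n.+2 q - l n.+1 q = (g n.+2 q - g n.+1 q) - d q (dt w n.+2 - dt w n.+1).
  by rewrite /l (lfunB (dr q)); ring.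
rewrite (le_trans (ler_normB _ _))//.
have i1 := dg_le nN q; have i2 := d_le q (dt w n.+2 - dt w n.+1).
have z0 : 0 <= fnorm m q := fnorm_ge0 _ _.
have i3 : K * fnorm m q * fnorm h1 (dt w n.+2 - dt w n.+1)
    <= K * fnorm m q * (K * (tau * (2 * D))).
  by rewrite ler_wpM2l ?ddw_le// mulr_ge0.
have tD0 : 0 <= tau * D by rewrite mulr_ge0// ltW.
have i4 : 2 * K ^+ 2 * (tau * D) * fnorm m q <= 2 * K ^+ 2 * (tau * D) * fnorm h2 q.
  by rewrite ler_wpM2l// !mulr_ge0 ?exprn_ge0// ltW.
have i5 : (1 + 2 * K ^+ 2) * (tau * D) * fnorm h2 q <=
    (1 + 2 * K ^+ 2) * (tau * D) * (K * fnorm b q).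
  rewrite ler_wpM2l// mulr_ge0// addr_ge0// mulr_ge0// exprn_ge0//.
rewrite /D' /K5; lra.
Qed.

Let fc_dquot n : (n < N)%N -> fc (dt tht n.+1) (dt uF n.+1).
Proof.
move=> nN.
have fc0 : fc 0 0.
  by have := fc_lin (- 1) (uF_fc nN) (uF_fc nN); rewrite !scaleN1r !addNr.
have := fc_lin (tau^-1) (fc_lin (- 1) (uF_fc (ltnW nN)) (uF_fc nN)) fc0.
by rewrite !scaleN1r !addr0 ![- _ + _]addrC.
Qed.

Let ut_dquot n : dt (fun n => ut n) n.+1 = dt uA n.+1 + dt uF n.+1.
Proof. by rewrite /dquot -scalerDr opprD addrACA. Qed.

(** The difference quotients solve elliptic problems of the same kind, with the difference quotient
    of [f] as load, so [elliptic_consistency] applies to them. *)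
Let r_le n : (n < N)%N -> forall q, B q ->
  `|r n.+1 q| <= Kp * H * (fnorm M (dt tht n.+1) + D') * fnorm M q.
Proof.
move=> nN q Bq; apply: le_trans (d_le _ _) _.
set v := _ - _; set z := fnorm m (dt tht n.+1).
have vE : fnorm h1 v <= Kc * H * (z + D).
  rewrite -(fnormN ph1) /v opprB ut_dquot.
  apply: (elliptic_consistency (l := fun v => tau^-1 * (f n.+1 v - f n v))) => //.
  - move=> x; rewrite normrM gtr0_norm ?invr_gt0// ler_pdivrMl// mulrA.
    exact: df_le.
  - exact: (subspace_dquot tau (v := tht) (n := n.+1) sB (tht_B nN) (tht_B (ltnW nN))).
  - exact: (subspace_dquot tau (v := uA) (n := n.+1) sA (uA_A nN) (uA_A (ltnW nN))).
  - exact: fc_dquot.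
  - move=> x Ax; rewrite -ut_dquot /dquot (psdZl pa) (psdBl pa) (lfunZ (dl x)) (lfunB (dl x)).
    rewrite -(ut_eq nN Ax) -(ut_eq (ltnW nN) Ax) /=; ring.
  - by move=> x; rewrite (psdDl pa) S_eq a_dw//; ring.
have z0 : 0 <= z := fnorm_ge0 _ _.
have q0 : 0 <= fnorm m q := fnorm_ge0 _ _.
have i1 : K * fnorm m q * fnorm h1 v <= K * fnorm m q * (Kc * H * (z + D)).
  by rewrite ler_wpM2l// mulr_ge0.
apply: le_trans i1 _.
rewrite [leLHS](_ : _ = K * Kc * H * (z + D) * fnorm m q); last by ring.
have zD0 : 0 <= z + D by exact: addr_ge0.
apply: ler_pM => //; first exact: mulr_ge0 (mulr_ge0 p2 H_ge0) zD0.
apply: ler_pM => //; first exact: mulr_ge0.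
  by rewrite ler_wpM2r// /Kp; move: p1 p2 p3 Kritz_ge0; lra.
by rewrite lerD// nm_M.
Qed.

(** The first summand is the temperature error with the displacement error that it causes, the
    second the consistency error of the displacement. *)
Definition Ccoupled : R := (1 + 2 * K ^+ 4) * K * Cpar Kp T * K5 ^+ 2 * K
  + 4 * Kc ^+ 2 * (T * K * (K + 2) * K + 1).

Lemma coupled_error_aux n : (n < N)%N ->
  n.+1%:R * tau * (sq h1 (u n.+1 - ut n.+1) + sq h2 (th n.+1 - tht n.+1))
  <= Ccoupled * H ^+ 2 * (sq h2 (th 0%N) + n.+1%:R * tau * D ^+ 2).
Proof.
move=> nN; set t := n.+1%:R * tau; set W := sq h2 (th 0%N) + t * D ^+ 2.
have t0 : 0 <= t by rewrite mulr_ge0// ltW.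
have tT : t <= T by apply: le_trans tauN; rewrite ler_pM2r// ler_nat.
have T0 : 0 <= T := le_trans t0 tT.
have ritz0 : ritz b B (th 0%N) (tht 0%N) by split; [exact: tht_B|exact: tht0].
have [p rp] := choice (fun k => ritz_ex (th k)).
have t1 : sq b (th 0%N) <= K * sq h2 (th 0%N) by exact: b_hi.
have KpH c x : 0 <= x -> 0 <= c -> x <= Kritz * H * c ->
    x ^+ 2 <= Kp ^+ 2 * H ^+ 2 * c ^+ 2.
  move=> x0 c0 xc; rewrite -!exprMn lerXn2r ?nnegrE//.
    by rewrite !mulr_ge0//; exact: le_trans Kp_ge1.
  by apply: le_trans xc _; rewrite !ler_wpM2r.
have h : t * sq b (th n.+1 - tht n.+1) <= Cpar Kp T * H ^+ 2 * Y b D' tau th n.+1.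
  apply: (@parabolic_error R X2 M b B Kp H T D' tau N psd_M pb sB Kp_ge1 H_gt0
    (le_trans D_ge0 D_D') tau_gt0 tauN _ _ _ th tht l r th_eqM tht_B tht_eqM ritz0
    l_le dl_le r_le _ p rp n nN).
  - move=> q; apply: le_trans (M_b q) _; rewrite ler_wpM2r ?(psd_ge0 pb)//.
    by rewrite /Kp; move: p1 p2 p3 Kritz_ge0; lra.
  - move=> v p' k rv bv; rewrite -(fnorm2 pb) -(real_normK (num_real k)).
    apply: KpH; rewrite ?fnorm_ge0//; apply: ritz_error_b => // q.
    apply: le_trans (bv q) _; rewrite ler_wpM2r ?ler_norm//; exact: fnorm_ge0.
  - move=> v p' rv; rewrite -(fnorm2 psd_M) -(fnorm2 pb).
    by apply: KpH; rewrite ?fnorm_ge0//; exact: ritz_error_M.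
  - move=> k kN.
    have DD : k%:R * tau * D ^+ 2 <= k%:R * tau * D' ^+ 2.
      rewrite ler_wpM2l ?mulr_ge0// ?(ltW tau_gt0)// lerXn2r ?nnegrE//.
      exact: le_trans D_D'.
    apply: (@le_trans _ _ (L * \sum_(j < k) tau * sq m (dt tht j.+1))).
      rewrite mulr_sumr; apply: ler_sum => j _; rewrite mulrCA ler_wpM2l ?(ltW tau_gt0)//.
    have st := localized_stability kN; have b0 := psd_ge0 pb (tht k).
    have b00 := psd_ge0 pb (th 0%N).
    have Y0 : 0 <= Y b D' tau th k.
      by rewrite /Y addr_ge0// mulr_ge0 ?sqr_ge0// mulr_ge0// ltW.
    apply: (@le_trans _ _ (L * ((K + 2) * Y b D' tau th k))).
      rewrite ler_wpM2l// /Y.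
      have := ler_wpM2l K_ge0 DD; have := mulr_ge0 K_ge0 b00; lra.
    rewrite mulrA ler_wpM2r// /Kp; move: p1 p2 p3 Kritz_ge0; lra.
have W0 : 0 <= W by rewrite /W addr_ge0 ?(psd_ge0 ph2)// mulr_ge0 ?sqr_ge0.
have tD0 : 0 <= t * D ^+ 2 by rewrite mulr_ge0 ?sqr_ge0.
have h20 := psd_ge0 ph2 (th 0%N).
have YW : Y b D' tau th n.+1 <= K5 ^+ 2 * K * W.
  have K52 : 1 <= K5 ^+ 2 by rewrite expr_ge1// (le_trans ler01).
  have K1 : K * sq h2 (th 0%N) <= K5 ^+ 2 * (K * sq h2 (th 0%N)).
    by rewrite ler_peMl// mulr_ge0.
  have K2 : K5 ^+ 2 * (t * D ^+ 2) <= K * (K5 ^+ 2 * (t * D ^+ 2)).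
    by rewrite ler_peMl// mulr_ge0// sqr_ge0.
  rewrite /Y /D' -/t /W exprMn; lra.
have Cp0 : 0 <= Cpar Kp T * H ^+ 2.
  have Kp0 : 0 <= Kp := le_trans ler01 Kp_ge1.
  by rewrite mulr_ge0 ?sqr_ge0// Cpar_ge0.
have hh : t * sq h2 (th n.+1 - tht n.+1) <= K * (Cpar Kp T * H ^+ 2 * (K5 ^+ 2 * K * W)).
  apply: (@le_trans _ _ (K * (t * sq b (th n.+1 - tht n.+1)))).
    by rewrite mulrCA ler_wpM2l.
  by rewrite ler_wpM2l// (le_trans h)// ler_wpM2l.
(* [U] is the full elastic response to the multiscale temperature: [u - U] is controlled by the
   temperature error, and [U - ut] by [elliptic_consistency]. *)
pose U := S (tht n.+1) + w n.+1.
have hU1 : sq h1 (u n.+1 - U) <= K ^+ 4 * sq h2 (th n.+1 - tht n.+1).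
  have : fnorm h1 (u n.+1 - U) <= K * (K * fnorm m (th n.+1 - tht n.+1)).
    apply: elliptic_le; first by rewrite mulr_ge0// fnorm_ge0.
    set v := u n.+1 - U; have -> : a v v = d (th n.+1 - tht n.+1) v.
      rewrite {1}/v (psdBl pa) /U (psdDl pa) S_eq w_eq// -(u_eq nN) (lfunB (dl v)); ring.
    exact: le_trans (ler_norm _) (d_le _ _).
  rewrite mulrA -expr2 -ler_sqr ?nnegrE ?mulr_ge0 ?fnorm_ge0 ?exprn_ge0//.
  rewrite exprMn -exprM (fnorm2 ph1) (fnorm2 pm) => h'; apply: le_trans h' _.
  by rewrite ler_wpM2l ?exprn_ge0.
have hU2 : sq h1 (U - ut n.+1) <= 2 * (Kc * H) ^+ 2 * (sq m (tht n.+1) + D ^+ 2).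
  have : fnorm h1 (ut n.+1 - U) <= Kc * H * (fnorm m (tht n.+1) + D).
    apply: (elliptic_consistency (l := f n.+1)) => //; [exact: f_le|exact: tht_B|
      exact: uA_A|exact: uF_fc|exact: ut_eq|].
    by move=> x; rewrite /U (psdDl pa) S_eq w_eq// addrC addKr.
  rewrite -(fnormN ph1) opprB => le1.
  have := ler_pM (fnorm_ge0 _ _) (fnorm_ge0 _ _) le1 le1.
  rewrite -!expr2 exprMn (fnorm2 ph1) -(fnorm2 pm (tht n.+1)); set z := fnorm m _ => h'.
  apply: le_trans h' _; rewrite [leRHS](_ : _ = (Kc * H) ^+ 2 * (2 * (z ^+ 2 + D ^+ 2))); last by ring.
  by rewrite ler_wpM2l ?sqr_ge0//; have := sqr_ge0 (z - D); lra.
have hU3 : sq h1 (u n.+1 - ut n.+1) <=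
    2 * sq h1 (u n.+1 - U) + 2 * sq h1 (U - ut n.+1).
  have := psd_sub_le ph1 (u n.+1 - U) (ut n.+1 - U).
  rewrite -(fnorm2 ph1 (ut _ - U)) -(fnormN ph1) (fnorm2 ph1) opprB.
  by rewrite addrA subrK.
have tm : t * sq m (tht n.+1) <= T * (K * ((K + 2) * (K * W))).
  apply: ler_pM => //; first exact: psd_ge0.
  apply: le_trans (m_le _) (le_trans (b_lo _) _); rewrite ler_wpM2l//.
  have st := localized_stability nN; rewrite -/t in st.
  have s0 : 0 <= \sum_(j < n.+1) tau * sq m (dt tht j.+1).
    by apply: sumr_ge0 => j _; rewrite mulr_ge0 ?(psd_ge0 pm)// ltW.
  have k1 : (K + 2) * (t * D ^+ 2) <= (K + 2) * (K * (t * D ^+ 2)).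
    by rewrite ler_wpM2l ?addr_ge0// ler_peMl.
  have k2 : 0 <= (K + 1) * (K * sq h2 (th 0%N)) by rewrite !mulr_ge0// addr_ge0.
  rewrite /W; lra.
have DW : t * D ^+ 2 <= W by rewrite /W lerDr.
have tU : t * (sq m (tht n.+1) + D ^+ 2) <= (T * K * (K + 2) * K + 1) * W by lra.
have KH2 : 0 <= 4 * (Kc * H) ^+ 2 by rewrite mulr_ge0 ?sqr_ge0.
have f1 := ler_wpM2l KH2 tU.
have f2 := ler_wpM2l t0 hU2; have f3 := ler_wpM2l t0 hU1; have f4 := ler_wpM2l t0 hU3.
have K4 : 0 <= 1 + 2 * K ^+ 4 by rewrite addr_ge0// mulr_ge0 ?exprn_ge0.
have f5 := ler_wpM2l K4 hh.
rewrite /Ccoupled; lra.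
Qed.
End reduction.

Lemma coupled_error n : (1 <= n <= N)%N ->
  n%:R * tau * (sq h1 (u n - ut n) + sq h2 (th n - tht n))
  <= Ccoupled * H ^+ 2 * (sq h2 (th 0%N) + n%:R * tau * D ^+ 2).
Proof.
case: n => // n /andP[_ nN].
have [S S_eq] := choice S_ex.
have wex k : exists v, (k <= N)%N -> forall x, a v x = f k x.
  have [kN|kN] := boolP (k <= N)%N; last by exists 0.
  by have [v hv] := w_ex kN; exists v.
have [w w_eq] := choice wex.
exact: (coupled_error_aux S_eq w_eq).
Qed.
End coupled.

(** * Lebesgue measure and simplices *)

Section rV_measure.
Variables (R : realType) (n : nat).
Local Notation pt := 'rV[R]_n.

Lemma measurable_coord_box (I : 'I_n -> set R) : (forall i, measurable (I i)) ->
  measurable [set y : pt | forall i, I i (y ord0 i)].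
Proof.
move=> mI; rewrite (_ : [set y | _] = \bigcap_(i in [set: 'I_n]) [set y : pt | I i (y ord0 i)]).
  rewrite (_ : [set: 'I_n] = [set` index_enum 'I_n]); last first.
    by apply/seteqP; split => i //= _; rewrite mem_index_enum.
  rewrite bigcap_seq; apply: bigsetI_measurable => i _.
  rewrite -[X in measurable X]setTI.
  exact: (measurable_coord (R := R) i).
by apply/seteqP; split => y /= h i *; exact: h.
Qed.

Lemma rV_ballP (x : pt) e y :
  ball x e y <-> 0 < e /\ forall i, ball (x ord0 i) e (y ord0 i).
Proof.
split=> [xy|[e0 h]].
  have [e0 h] : @mx_ball 1 n R R x e y := xy; split=> // i; exact: h.
by suff : @mx_ball 1 n R R x e y by []; split => // i j; rewrite ord1.
Qed.

Lemma measurable_rV_ball (x : pt) e : measurable (ball x e).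
Proof.
have [e0|e0] := ltP 0 e; last first.
  rewrite (_ : ball x e = set0)//; apply/seteqP; split => y // /rV_ballP[].
  by rewrite ltNge e0.
rewrite (_ : ball x e = [set y : pt | forall i, ball (x ord0 i) e (y ord0 i)]).
  by apply: (measurable_coord_box (I := fun i => ball (x ord0 i) e)) => i;
    exact: measurable_ball.
by apply/seteqP; split => y; [move/rV_ballP => [] | move=> ?; apply/rV_ballP].
Qed.

(** Measurability is generated by the coordinates. An open set is a countable union of balls with
    rational centres and radii [k.+1%:R^-1], and in the sup norm balls are boxes. *)
Lemma open_measurable_rV (U : set pt) : open U -> measurable U.
Proof.
move=> oU.
pose q (r : 'rV[rat]_n) : pt := map_mx ratr r.
pose good := [set p : 'rV[rat]_n * nat | ball (q p.1) p.2.+1%:R^-1 `<=` U].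
rewrite (_ : U = \bigcup_(p in good) ball (q p.1) p.2.+1%:R^-1).
  rewrite (_ : \bigcup_(p in good) _ =
    \bigcup_p (if p \in good then ball (q p.1) p.2.+1%:R^-1 else set0)).
    apply: countable_bigcupT_measurable => // p.
    by case: ifP => _ //; exact: measurable_rV_ball.
  apply/seteqP; split => x [p pg xp].
    by exists p => //; rewrite mem_set.
  by move: xp; case: ifPn => // /set_mem pg' xp; exists p.
apply/seteqP; split; last by move=> x [p pg] /pg.
move=> x Ux; have /nbhs_ballP[e /= e0 eU] : nbhs x U by rewrite nbhsE /=; exists U.
(* Below [e / 2], so that the ball about a nearby rational centre stays within [e] of [x]. *)
have [k ke] : exists k, (k.+1%:R^-1 : R) < e / 2.
  have e20 : 0 < e / 2 by rewrite divr_gt0.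
  have [N _ hN] := near_infty_natSinv_lt (PosNum e20).
  by exists N; exact: (hN N (leqnn N)).
have /choice[r hr] : forall i, exists r : rat, ball (x ord0 i) k.+1%:R^-1 (ratr r : R).
  move=> i; have [|r] := @rat_in_itvoo R (x ord0 i) (x ord0 i + k.+1%:R^-1).
    by rewrite ltrDl invr_gt0.
  rewrite in_itv /= => /andP[r1 r2]; exists r.
  have k0 : 0 < k.+1%:R^-1 :> R by rewrite invr_gt0.
  move: k0 r1 r2; rewrite /ball /= ltr_distlC; set kk := k.+1%:R^-1 => k0 r1 r2.
  by rewrite r2 andbT; apply: lt_trans r1; rewrite gtrBl.
have bx : ball (q (\row_i r i)) k.+1%:R^-1 x.
  apply/rV_ballP; split; first by rewrite invr_gt0.
  by move=> i; rewrite !mxE; apply: ball_sym; exact: hr.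
exists (\row_i r i, k) => //= y bqy; apply: eU.
apply: (@le_ball _ _ _ (k.+1%:R^-1 + k.+1%:R^-1)).
  by rewrite [leRHS]splitr lerD// ltW.
exact: ball_triangle (ball_sym bx) bqy.
Qed.

Lemma closed_measurable_rV (U : set pt) : closed U -> measurable U.
Proof.
move=> cU; rewrite -[U]setCK; apply: measurableC; apply: open_measurable_rV.
exact: closed_openC.
Qed.

End rV_measure.

(** * Null sets *)

Section hyperplanes.
Variable (R : realType).

Lemma measurable_affine n (a : 'I_n -> R) c :
  measurable [set x : 'rV[R]_n | \sum_i a i * x ord0 i = c].
Proof.
have m : measurable_fun setT (fun x : 'rV[R]_n => \sum_i a i * x ord0 i).
  apply: measurable_sum => i; apply: measurable_funM => //; exact: measurable_coord.
by rewrite -[X in measurable X]setTI; exact: (m measurableT [set c] (measurable_set1 c)).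
Qed.

(** Fubini in the first coordinate: if its coefficient is zero, the sections are hyperplanes of
    lower dimension; otherwise the sections in the other direction are single points. *)
Lemma hyperplane_null n (a : 'I_n -> R) c : (exists i, a i != 0) ->
  lebesgue_rV R n [set x | \sum_i a i * x ord0 i = c] = 0%E.
Proof.
elim: n a c => [|n IH] a c [i ai0]; first by case: i ai0.
rewrite /= /lebesgue_rV_step /pushforward.
set B := _ @^-1` _.
have BE : B = [set p : measurableTypeR R * 'rV[R]_n |
    a ord0 * p.1 + \sum_j a (lift ord0 j) * p.2 ord0 j = c].
  have sE p : \sum_i a i * rV_cons p ord0 i =
      a ord0 * p.1 + \sum_j a (lift ord0 j) * p.2 ord0 j.
    by rewrite big_ord_recl rV_cons0; under eq_bigr do rewrite rV_consS.
  by apply/seteqP; split => p; rewrite /B /= sE.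
have mB : measurable B.
  rewrite -[B]setTI; apply: measurable_rV_cons => //; exact: measurable_affine.
transitivity (\int[@lebesgue_measure R]_x ((lebesgue_rV R n) \o xsection B) x)%E => //.
have [a0|a0] := eqVneq (a ord0) 0.
  apply: integral0_eq => x _ /=.
  rewrite (_ : xsection B x =
      [set y | \sum_j a (lift ord0 j) * y ord0 j = c]).
    apply: IH; move: ai0; have [j ->|->] := unliftP ord0 i; last by rewrite a0 eqxx.
    by exists j.
  by apply/seteqP; split => y; rewrite xsectionE BE /= a0 mul0r add0r.
rewrite -(indic_fubini_tonelli_FE (lebesgue_rV R n) mB).
rewrite (indic_fubini_tonelli (@lebesgue_measure R) (lebesgue_rV R n) mB).
rewrite indic_fubini_tonelli_GE//; apply: integral0_eq => y _ /=.
rewrite (_ : ysection B y =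
    [set (c - \sum_j a (lift ord0 j) * y ord0 j) / a ord0]).
  exact: lebesgue_measure_set1.
apply/seteqP; split => x; rewrite ysectionE BE /=.
  by move=> <-; rewrite addrK mulrC mulKf.
by move=> ->; rewrite mulrC divfK// subrK.
Qed.
End hyperplanes.

(** * Integrals up to null sets *)

Section ae_Rintegral.
Context {dd : measure_display} {T : measurableType dd} {R : realType}.
Variables (mu : {measure set T -> \bar R}) (D : set T).
Hypothesis mD : measurable D.
Implicit Types f g : T -> R.
Local Notation rint f := (mu.-integrable D (EFin \o f)).

Lemma measurable_rint f : rint f -> measurable_fun D f.
Proof. by move/measurable_int => /measurable_EFinP. Qed.

Lemma ae_le_integrable f g : measurable_fun D f -> rint g ->
  {ae mu, forall x, D x -> `|f x| <= g x} -> rint f.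
Proof.
move=> mf ig fg; apply/integrableP; split; first exact/measurable_EFinP.
have /integrableP[mg] := ig; apply: le_lt_trans.
apply: ae_ge0_le_integral => //.
- by apply: measurableT_comp => //; exact/measurable_EFinP.
- by apply: measurableT_comp.
- move: fg; apply: filterS => x h Dx; rewrite /= lee_fin.
  exact: le_trans (h Dx) (ler_norm _).
Qed.

Lemma ae_eq_Rintegral f g : measurable_fun D f -> measurable_fun D g ->
  {ae mu, forall x, D x -> f x = g x} ->
  \int[mu]_(x in D) f x = \int[mu]_(x in D) g x.
Proof.
move=> mf mg fg; rewrite /Rintegral; congr fine; apply: ae_eq_integral => //.
- exact/measurable_EFinP.
- exact/measurable_EFinP.
- by move: fg; apply: filterS => x h Dx; rewrite h.
Qed.

Lemma ae_Rintegral_ge0 f : measurable_fun D f ->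
  {ae mu, forall x, D x -> 0 <= f x} -> 0 <= \int[mu]_(x in D) f x.
Proof.
move=> mf f0; rewrite (@ae_eq_Rintegral f (fun x => `|f x|))//.
- by apply: Rintegral_ge0 => x _.
- exact: measurableT_comp.
- by move: f0; apply: filterS => x h Dx; rewrite ger0_norm// h.
Qed.

Lemma ae_le_Rintegral f g : rint f -> rint g ->
  {ae mu, forall x, D x -> f x <= g x} ->
  \int[mu]_(x in D) f x <= \int[mu]_(x in D) g x.
Proof.
move=> fi gi fg; rewrite -subr_ge0 -RintegralB//; apply: ae_Rintegral_ge0.
  by apply: measurable_funB; exact: measurable_rint.
by move: fg; apply: filterS => x h Dx; rewrite subr_ge0 h.
Qed.

Lemma rintD f g : rint f -> rint g -> rint (fun x => f x + g x).
Proof. by move=> fi gi; exact: (integrableD mD fi gi). Qed.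

Lemma rintZ k f : rint f -> rint (fun x => k * f x).
Proof. by move=> fi; exact: (integrableZl mD k fi). Qed.

Lemma rint_sum (I : finType) (h : I -> T -> R) : (forall i, rint (h i)) ->
  rint (fun x => \sum_i h i x).
Proof.
move=> hi; rewrite (_ : EFin \o _ = fun x => (\sum_i (h i x)%:E)%E).
  by apply: integrable_sum => // i _; exact: hi.
by apply/funext => x /=; rewrite sumEFin.
Qed.

Lemma Rintegral_sum (I : finType) (h : I -> T -> R) : (forall i, rint (h i)) ->
  \int[mu]_(x in D) (\sum_i h i x) = \sum_i \int[mu]_(x in D) h i x.
Proof.
move=> hi.
suff : forall s : seq I, rint (fun x => \sum_(i <- s) h i x) /\
    \int[mu]_(x in D) (\sum_(i <- s) h i x) = \sum_(i <- s) \int[mu]_(x in D) h i x.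
  by move=> /(_ (index_enum I))[].
elim=> [|i s [IH1 IH2]].
  rewrite (_ : (fun x => \sum_(i <- [::]) h i x) = cst 0); last first.
    by apply/funext => x; rewrite big_nil.
  by rewrite big_nil Rintegral_cst// mul0r; split => //; exact: integrable0.
rewrite (_ : (fun x => \sum_(i <- _) h i x) =
    (fun x => h i x + \sum_(i <- s) h i x)); last first.
  by apply/funext => x; rewrite big_cons.
by rewrite big_cons RintegralD// IH2; split => //; exact: rintD.
Qed.

Lemma rintM f g : measurable_fun D f -> measurable_fun D g ->
  rint (fun x => f x ^+ 2) -> rint (fun x => g x ^+ 2) -> rint (fun x => f x * g x).
Proof.
move=> mf mg fi gi; apply: (ae_le_integrable (g := fun x => f x ^+ 2 + g x ^+ 2)).
- exact: measurable_funM.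
- exact: rintD.
- apply: aeW => x _; rewrite normrM -(real_normK (num_real (f x))) -(real_normK (num_real (g x))).
  have := sqr_ge0 (`|f x| - `|g x|); have := sqr_ge0 (`|f x| + `|g x|); lra.
Qed.

End ae_Rintegral.

(** * Forms given by pointwise densities *)

Section field_forms.
Variables (R : realType) (n : nat) (w : set 'rV[R]_n).
Local Notation pt := 'rV[R]_n.
Local Notation leb := (lebesgue_rV R n).
Hypothesis mw : measurable w.
Local Notation rint f := (leb.-integrable w (EFin \o f)).

Definition measurable_field p q (F : pt -> 'M[R]_(p, q)) : Prop :=
  forall i j, measurable_fun w (fun x => F x i j).

Lemma L2_measurable p q (F : pt -> 'M[R]_(p, q)) : L2 w F -> measurable_field F.
Proof. by move=> h i j; have [] := h i j. Qed.

Lemma rint_frob p q (F G : pt -> 'M[R]_(p, q)) : L2 w F -> L2 w G ->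
  rint (fun x => frob (F x) (G x)).
Proof.
move=> hF hG; rewrite /frob; apply: rint_sum => // i; apply: rint_sum => // j.
have [mF iF] := hF i j; have [mG iG] := hG i j; exact: rintM.
Qed.

Lemma frob_sq_ge0 p q (A : 'M[R]_(p, q)) : 0 <= frob A A.
Proof. by apply: sumr_ge0 => i _; apply: sumr_ge0 => j _; rewrite -expr2 sqr_ge0. Qed.

Lemma frobC p q (A B : 'M[R]_(p, q)) : frob A B = frob B A.
Proof. by apply: eq_bigr => i _; apply: eq_bigr => j _; rewrite mulrC. Qed.

Lemma frob_linear p q k (A B C : 'M[R]_(p, q)) :
  frob (k *: A + B) C = k * frob A C + frob B C.
Proof.
rewrite /frob mulr_sumr -big_split; apply: eq_bigr => i _ /=.
rewrite mulr_sumr -big_split; apply: eq_bigr => j _ /=.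
by rewrite !mxE mulrDl mulrA.
Qed.

Lemma psd_frob p q : psd_form (@frob R p q).
Proof.
by split; [exact: frob_linear|exact: frobC|exact: frob_sq_ge0].
Qed.

Lemma frob_entry p q (A : 'M[R]_(p, q)) i j : A i j ^+ 2 <= frob A A.
Proof.
rewrite /frob (bigD1 i)//= (bigD1 j)//= -expr2 -!addrA lerDl addr_ge0//.
  by apply: sumr_ge0 => k _; rewrite -expr2 sqr_ge0.
by apply: sumr_ge0 => k _; apply: sumr_ge0 => l _; rewrite -expr2 sqr_ge0.
Qed.

Section bilinear_density.
Variables (p1 q1 p2 q2 : nat) (beta : pt -> 'M[R]_(p1, q1) -> 'M[R]_(p2, q2) -> R).
Hypothesis beta_l : forall x k A B C, beta x (k *: A + B) C = k * beta x A C + beta x B C.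
Hypothesis beta_r : forall x k A B C, beta x C (k *: A + B) = k * beta x C A + beta x C B.
Hypothesis beta_m : forall F G, measurable_field F -> measurable_field G ->
  measurable_fun w (fun x => beta x (F x) (G x)).
Variable C : R.
Hypothesis beta_b : {ae leb, forall x, w x -> forall A B,
  `|beta x A B| <= C * (frob A A + frob B B)}.

Lemma rint_density F G : L2 w F -> L2 w G -> rint (fun x => beta x (F x) (G x)).
Proof.
move=> hF hG.
apply: (@ae_le_integrable _ _ _ _ _ mw _
  (fun x => C * (frob (F x) (F x) + frob (G x) (G x)))).
- by apply: beta_m; exact: L2_measurable.
- by apply: rintZ => //; apply: rintD => //; exact: rint_frob.
- by move: beta_b; apply: filterS => x h wx; exact: h.
Qed.

Variables (X1 X2 : lmodType R) (Phi1 : X1 -> pt -> 'M[R]_(p1, q1))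
  (Phi2 : X2 -> pt -> 'M[R]_(p2, q2)).
Hypothesis Phi1_L2 : forall u, L2 w (Phi1 u).
Hypothesis Phi2_L2 : forall u, L2 w (Phi2 u).
Hypothesis Phi1_lin : forall k u v, {ae leb, forall x, w x ->
  Phi1 (k *: u + v) x = k *: Phi1 u x + Phi1 v x}.
Hypothesis Phi2_lin : forall k u v, {ae leb, forall x, w x ->
  Phi2 (k *: u + v) x = k *: Phi2 u x + Phi2 v x}.

(** [Phi1] and [Phi2] are linear only almost everywhere: the classical gradient is not additive on
    element faces. *)
Definition density_form (u : X1) (v : X2) : R :=
  \int[leb]_(x in w) beta x (Phi1 u x) (Phi2 v x).

Lemma density_linl v : linear_functional (density_form^~ v).
Proof.
move=> k x y; rewrite /density_form -RintegralZl//; last exact: rint_density.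
rewrite -RintegralD//; [|by apply: rintZ => //; exact: rint_density|exact: rint_density].
apply: ae_eq_Rintegral => //.
- by apply: (@measurable_rint _ _ _ leb); exact: rint_density.
- apply: (@measurable_rint _ _ _ leb); apply: rintD => //; last exact: rint_density.
  by apply: rintZ => //; exact: rint_density.
- by move: (Phi1_lin k x y); apply: filterS => z h wz; rewrite h// beta_l.
Qed.

Lemma density_linr u : linear_functional (density_form u).
Proof.
move=> k x y; rewrite /density_form -RintegralZl//; last exact: rint_density.
rewrite -RintegralD//; [|by apply: rintZ => //; exact: rint_density|exact: rint_density].
apply: ae_eq_Rintegral => //.
- by apply: (@measurable_rint _ _ _ leb); exact: rint_density.
- apply: (@measurable_rint _ _ _ leb); apply: rintD => //; last exact: rint_density.
  by apply: rintZ => //; exact: rint_density.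
- by move: (Phi2_lin k x y); apply: filterS => z h wz; rewrite h// beta_r.
Qed.

End bilinear_density.

Lemma psd_density p q (beta : pt -> 'M[R]_(p, q) -> 'M[R]_(p, q) -> R) C
    (X : lmodType R) (Phi : X -> pt -> 'M[R]_(p, q)) :
  (forall x k A B D, beta x (k *: A + B) D = k * beta x A D + beta x B D) ->
  (forall F G, measurable_field F -> measurable_field G ->
    measurable_fun w (fun x => beta x (F x) (G x))) ->
  {ae leb, forall x, w x -> forall A B, `|beta x A B| <= C * (frob A A + frob B B)} ->
  {ae leb, forall x, w x -> forall A B, beta x A B = beta x B A} ->
  {ae leb, forall x, w x -> forall A, 0 <= beta x A A} ->
  (forall u, L2 w (Phi u)) ->
  (forall k u v, {ae leb, forall x, w x ->
     Phi (k *: u + v) x = k *: Phi u x + Phi v x}) ->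
  psd_form (density_form beta Phi Phi).
Proof.
move=> b_l b_m b_b b_s b_p P2 Pl; split.
- by move=> k x y z; exact: (density_linl b_l b_m b_b P2 P2 Pl).
- move=> u v; apply: ae_eq_Rintegral => //.
  + by apply: b_m; exact: L2_measurable.
  + by apply: b_m; exact: L2_measurable.
  + by move: b_s; apply: filterS => z h wz; exact: h.
- move=> u; apply: ae_Rintegral_ge0 => //.
  + by apply: b_m; exact: L2_measurable.
  + by move: b_p; apply: filterS => z h wz; exact: h.
Qed.

End field_forms.

(** * Barycentric coordinates *)

Section barycentric.
Variables (R : realType) (d : nat) (A : 'M[R]_(d.+1, d)).
Hypothesis ndA : Defs.nondegenerate A.
Local Notation pt := 'rV[R]_d.

(** The two dimensions are [d + 1] and [d.+1], so the matrix is not literally square; its one-sided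
    inverses are shown to coincide. *)
Lemma bary_ex : exists Q : 'M[R]_(d + 1, d.+1),
  row_mx A (const_mx 1 : 'cV[R]_d.+1) *m Q = 1%:M /\ Q *m row_mx A (const_mx 1 : 'cV[R]_d.+1) = 1%:M.
Proof.
set P := row_mx A (const_mx 1 : 'cV[R]_d.+1); have /row_freeP[Q PQ] : row_free P := ndA.
have /row_fullP[Q' Q'P] : row_full P.
  have /eqP rk : row_free P := ndA; by rewrite /row_full rk addn1.
exists Q; split=> //.
by rewrite -[Q]mul1mx -Q'P -(mulmxA Q') PQ mulmx1 Q'P.
Qed.

Definition bary_mx : 'M[R]_(d + 1, d.+1) := xget 0 [set Q : 'M[R]_(d + 1, d.+1) |
  row_mx A (const_mx 1 : 'cV[R]_d.+1) *m Q = 1%:M /\ Q *m row_mx A (const_mx 1 : 'cV[R]_d.+1) = 1%:M].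

Definition bary (x : pt) : 'rV[R]_d.+1 := row_mx x (const_mx 1 : 'M[R]_1) *m bary_mx.

Let QP : row_mx A (const_mx 1 : 'cV[R]_d.+1) *m bary_mx = 1%:M /\
  bary_mx *m row_mx A (const_mx 1 : 'cV[R]_d.+1) = 1%:M.
Proof.
rewrite /bary_mx; case: xgetP => [y -> //|h].
by have [z zP] := bary_ex; have := h z zP.
Qed.

Lemma bary_mul x : bary x *m row_mx A (const_mx 1 : 'cV[R]_d.+1) = row_mx x (const_mx 1 : 'M[R]_1).
Proof. by rewrite /bary -mulmxA QP.2 mulmx1. Qed.

Lemma baryA x : bary x *m A = x.
Proof. by have := bary_mul x; rewrite mul_mx_row => /eq_row_mx[]. Qed.

Let mul_const1 (l : 'rV[R]_d.+1) :
  (l *m (const_mx 1 : 'cV[R]_d.+1)) ord0 ord0 = \sum_i l ord0 i.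
Proof. by rewrite mxE; apply: eq_bigr => i _; rewrite [const_mx _ _ _]mxE mulr1. Qed.

Lemma bary_sum x : \sum_i bary x ord0 i = 1.
Proof.
have := bary_mul x; rewrite mul_mx_row => /eq_row_mx[_ /matrixP/(_ ord0 ord0)].
by rewrite mul_const1 mxE.
Qed.

Lemma bary_uniq x (l : 'rV[R]_d.+1) : \sum_i l ord0 i = 1 -> x = l *m A -> bary x = l.
Proof.
move=> l1 ->; rewrite /bary.
have -> : row_mx (l *m A) (const_mx 1 : 'M[R]_1) = l *m row_mx A (const_mx 1 : 'cV[R]_d.+1) :> 'rV_(d + 1).
  by rewrite mul_mx_row; congr row_mx; apply/rowP => i; rewrite ord1 mul_const1 l1 mxE.
by rewrite -mulmxA QP.1 mulmx1.
Qed.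

Lemma simplexE : simplex A = [set x | forall i, 0 <= bary x ord0 i].
Proof.
apply/seteqP; split=> x /=.
  by move=> [l [l0 _ l1 xl]] i; rewrite (bary_uniq l1 xl).
by move=> h; exists (bary x); split => //; [exact: bary_sum|rewrite baryA].
Qed.

Lemma face_bary (S : pred 'I_d.+1) x i : face A S x -> ~~ S i -> bary x ord0 i = 0.
Proof. by move=> [l [_ lS l1 xl]] Si; rewrite (bary_uniq l1 xl) lS. Qed.

Lemma bary_row i j : bary (row i A) ord0 j = (i == j)%:R.
Proof.
rewrite (@bary_uniq _ (delta_mx ord0 i)); [by rewrite mxE eqxx eq_sym| |by rewrite rowE].
rewrite (bigD1 i)//= mxE !eqxx big1 ?addr0// => k ki.
by rewrite mxE (negbTE ki) andbF.
Qed.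

Lemma row_in_simplex i : simplex A (row i A).
Proof. by rewrite simplexE /= => j; rewrite bary_row; case: eqP. Qed.

Lemma bary_comb s x y i :
  bary (s *: (y - x) + x) ord0 i = s * (bary y ord0 i - bary x ord0 i) + bary x ord0 i.
Proof.
move: (baryA x) (bary_sum x) (baryA y) (bary_sum y).
move: (bary x) (bary y) => lx ly xA x1 yA y1.
rewrite (@bary_uniq _ (s *: (ly - lx) + lx)); first by rewrite !mxE.
  under eq_bigr do rewrite !mxE.
  by rewrite big_split /= -mulr_sumr sumrB x1 y1 subrr mulr0 add0r.
by rewrite mulmxDl -scalemxAl mulmxBl xA yA.
Qed.

Lemma bary_affine i : exists (a : 'I_d -> R) c,
  forall x, bary x ord0 i = c + \sum_j a j * x ord0 j.
Proof.
exists (fun j => bary_mx (lshift 1 j) i), (bary_mx (rshift d ord0) i) => x.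
rewrite /bary mxE big_split_ord /= big_ord1 row_mxEr mxE mul1r addrC; congr (_ + _).
by apply: eq_bigr => j _; rewrite row_mxEl mulrC.
Qed.

Lemma continuous_bary i : continuous (fun x : pt => bary x ord0 i).
Proof.
have [a [c h]] := bary_affine i; rewrite (_ : (fun x => _) = (fun x : pt => c + \sum_j a j * x ord0 j)).
  have cs : continuous (fun y : pt => \sum_j a j * y ord0 j).
    apply: (@continuous_big R 'I_d +%R 0 predT) => [|j _ y]; first exact: add_continuous.
    exact: (@cvgMl_tmp R pt (nbhs y) _ _ (a j) _ (@coord_continuous R 1 d ord0 j y)).
  move=> x; apply: (@continuousD _ _ _ (cst c) (fun y : pt => \sum_j a j * y ord0 j) x).
    exact: cst_continuous.
  exact: cs.
by apply/funext.
Qed.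

Lemma closed_simplex : closed (simplex A).
Proof.
rewrite simplexE (_ : [set x | _] = \bigcap_i ((fun x : pt => bary x ord0 i) @^-1` [set r | 0 <= r])).
  apply: closed_bigI => i _; apply: preimage_closed; last exact: closed_ge.
  by move=> x _; exact: continuous_bary.
by apply/seteqP; split => x h i *; exact: h.
Qed.

Lemma segment_simplex x y s : simplex A x -> simplex A y -> 0 <= s <= 1 ->
  simplex A (s *: (y - x) + x).
Proof.
rewrite simplexE /= => hx hy /andP[s0 s1] i; rewrite bary_comb.
have := mulr_ge0 s0 (hy i); have : 0 <= (1 - s) * bary x ord0 i.
  by rewrite mulr_ge0 ?subr_ge0.
lra.
Qed.

(** If coordinate [i] vanished at an interior point, a small move away from vertex [i] would make it
    negative. The converse is continuity of finitely many coordinates. *)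
Lemma interior_simplex : (simplex A)° = [set x | forall i, 0 < bary x ord0 i].
Proof.
apply/seteqP; split=> x.
  move=> xA i; have := interior_subset xA; rewrite simplexE => /(_ i).
  rewrite le_eqVlt => /predU1P[b0|//]; exfalso.
  have ct : (fun t : R => t *: (row i A - x) + x) @ (0 : R) --> x.
    suff : (fun t : R => t *: (row i A - x) + x) @ (0 : R) --> 0 *: (row i A - x) + x.
      by rewrite scale0r add0r.
    apply: (@cvgD _ _ _ (nbhs (0 : R)) _ (fun t : R => t *: (row i A - x)) (cst x)).
      by apply: cvgZr_tmp; exact: cvg_id.
    exact: cvg_cst.
  have : \forall t \near (0 : R), simplex A (t *: (row i A - x) + x) by exact: ct.
  (* A negative parameter: the segment is prolonged beyond [x], away from the vertex. *)
  move=> /nbhs_ballP[e /= e0 /(_ (- (e / 2)))].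
  rewrite /ball /= sub0r opprK ger0_norm ?divr_ge0 ?(ltW e0)// ltr_pdivrMr// ltr_pMr// ltr1n.
  move=> /(_ erefl); rewrite simplexE => /(_ i); rewrite bary_comb -b0 bary_row eqxx.
  rewrite addr0 subr0 mulr1 oppr_ge0 leNgt divr_gt0//.
move=> h.
have H i : nbhs x [set y : pt | 0 < bary y ord0 i].
  exact: (continuous_bary (x := x) (lt_nbhsr (h i))).
have := @filter_forall _ _ (fun i (y : pt) => 0 < bary y ord0 i) (nbhs x) (nbhs_filter x) H.
move=> Hx; rewrite /interior /=.
by apply: filterS Hx => y hy; rewrite simplexE => i; exact: ltW.
Qed.

(** The coordinate is not constant, being 1 at vertex [i] and 0 at another vertex, which exists as
    [d] is positive; its zero set is thus a hyperplane. *)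
Lemma null_bary i : (0 < d)%N -> lebesgue_rV R d [set x | bary x ord0 i = 0] = 0%E.
Proof.
move=> d0; have [a [c h]] := bary_affine i.
rewrite (_ : [set x | _] = [set x : pt | \sum_j a j * x ord0 j = - c]); last first.
  by apply/seteqP; split => x /=; rewrite h; lra.
apply: hyperplane_null.
have [//|/forallNP a0] := pselect (exists j, a j != 0); exfalso.
have bc x : bary x ord0 i = c.
  by rewrite h big1 ?addr0// => j _; have /negP := a0 j; rewrite negbK => /eqP ->; rewrite mul0r.
have := bary_row i i; rewrite bc eqxx => c1.
have [j ji] : exists j : 'I_d.+1, j != i.
  exists (lift i (Ordinal d0)); by rewrite eq_sym neq_lift.
by have := bary_row j i; rewrite bc (negbTE ji) c1 => /eqP; rewrite oner_eq0.
Qed.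

Lemma boundary_simplex_ae : (0 < d)%N ->
  {ae lebesgue_rV R d, forall x, simplex A x -> (simplex A)° x}.
Proof.
move=> d0; have : {ae lebesgue_rV R d, forall x, forall i, bary x ord0 i != 0}.
  apply: (filter_forall (f := fun i (y : pt) => bary y ord0 i != 0)) => i; exists [set x | bary x ord0 i = 0]; split.
  - have [a [c h]] := bary_affine i.
    rewrite (_ : [set x | _] = [set x : pt | \sum_j a j * x ord0 j = - c]); last first.
      by apply/seteqP; split => x /=; rewrite h; lra.
    exact: measurable_affine.
  - exact: null_bary.
  - by move=> x /= /negP; rewrite negbK => /eqP.
apply: filterS => x h; rewrite interior_simplex simplexE => hx i.
by rewrite lt_def h hx.
Qed.

End barycentric.

Section indicator_integral.
Context {dd : measure_display} {T : measurableType dd} {R : realType}.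
Variables (mu : {measure set T -> \bar R}) (D K : set T) (f : T -> R).
Hypotheses (mD : measurable D) (mK : measurable K) (KD : K `<=` D).
Local Notation rint D f := (mu.-integrable D (EFin \o f)).

Lemma Rintegral_indic_sub : \int[mu]_(x in K) f x = \int[mu]_(x in D) (f x * \1_K x).
Proof.
rewrite -{1}(setIidr KD) Rintegral_mkcondr; apply: eq_Rintegral => x _.
by rewrite patchE indicE; case: ifP; rewrite ?mulr1 ?mulr0.
Qed.

Lemma rint_indic : rint D f -> rint D (fun x => f x * \1_K x).
Proof.
move=> fi; apply: (ae_le_integrable mD (g := fun x => `|f x|)).
- by apply: measurable_funM; [exact: measurable_rint fi|exact: measurable_indic].
- exact: integrable_norm.
- apply: aeW => x _; rewrite normrM indicE.
  by case: (x \in K); rewrite ?normr1 ?mulr1// normr0 mulr0 normr_ge0.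
Qed.

Lemma rint_sub : rint D f -> rint K f.
Proof. by apply: integrableS. Qed.
End indicator_integral.

Lemma row_simplex_inj (R : realType) d (A : 'M[R]_(d.+1, d)) :
  Defs.nondegenerate A -> injective (fun i => row i A).
Proof.
move=> ndA i j /= ij; have := bary_row ndA i j; rewrite ij bary_row// eqxx.
by case: eqP => // _ /eqP; rewrite oner_eq0.
Qed.

(** * Integration over a triangulation *)

Section triangulations.
Variables (R : realType) (d : nat) (Om : set 'rV[R]_d) (M : nat) (T : mesh R d M).
Local Notation pt := 'rV[R]_d.
Local Notation leb := (lebesgue_rV R d).
Hypotheses (d_gt0 : (0 < d)%N) (oOm : open Om) (rOm : (closure Om)° = Om).
Hypothesis triT : triangulation Om T.

Let nd i : Defs.nondegenerate (T i). Proof. by case: triT. Qed.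

Lemma simplex_closure i : simplex (T i) `<=` closure Om.
Proof. by case: triT => _ -> _ _ x xi; exists i. Qed.

Lemma interior_simplex_sub i : (simplex (T i))° `<=` Om.
Proof. by rewrite -rOm; apply: interiorS; exact: simplex_closure. Qed.

Lemma measurable_interior_simplex i : measurable (simplex (T i))°.
Proof. by apply: open_measurable_rV; exact: open_interior. Qed.

Lemma measurable_domain : measurable Om.
Proof. exact: open_measurable_rV. Qed.

(** A common point lies on the face spanned by the common vertices. All its barycentric coordinates
    are positive, so every vertex is common; counting vertices, the two simplices coincide. *)
Lemma interior_simplex_disj i j x : i != j ->
  (simplex (T i))° x -> ~ simplex (T j) x.
Proof.
move=> ij xi xj; have [_ _ dif fac] := triT.
have : face (T i) (fun a => [exists b, row a (T i) == row b (T j)]) x.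
  by rewrite -fac; split => //; exact: interior_subset.
move=> xf; have [a na|all_a] := pickP (fun a => ~~ [exists b, row a (T i) == row b (T j)]).
  move: xi; rewrite interior_simplex// => /(_ a).
  by rewrite (face_bary (nd i) xf na) ltxx.
have /choice[b hb] : forall a, exists b, row a (T i) = row b (T j).
  by move=> a; have /negbFE/existsP[b /eqP] := all_a a; exists b.
have binj : injective b.
  by move=> a a' bb; apply: (row_simplex_inj (nd i)); rewrite /= !hb bb.
have face_all (k l : 'I_M) : (forall a, [exists b, row a (T k) == row b (T l)]) ->
    simplex (T k) `<=` simplex (T l).
  move=> h y yk.
  suff : (simplex (T k) `&` simplex (T l)) y by case.
  rewrite fac; move: yk => [lam [l0 _ l1 yl]]; exists lam; split => // c.
  by rewrite h.
case: (dif i j ij); apply/seteqP; split; apply: face_all => c.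
  by apply/existsP; exists (b c); rewrite hb.
have [b' b'K Kb'] := injF_bij binj.
by apply/existsP; exists (b' c); rewrite hb Kb'.
Qed.

Lemma ae_in_interior : {ae leb, forall x, Om x -> exists i, (simplex (T i))° x}.
Proof.
have : {ae leb, forall x, forall i, simplex (T i) x -> (simplex (T i))° x}.
  apply: (filter_forall (f := fun i (x : pt) => simplex (T i) x -> (simplex (T i))° x)) => i.
  exact: (boundary_simplex_ae (nd i) d_gt0).
apply: filterS => x h Ox; have : closure Om x by exact: subset_closure.
have [_ -> _ _] := triT; move=> [i _ xi]; exists i; exact: h.
Qed.

Lemma Rintegral_elements f : leb.-integrable Om (EFin \o f) ->
  \sum_i \int[leb]_(x in (simplex (T i))°) f x = \int[leb]_(x in Om) f x.
Proof.
move=> fi; have mO := measurable_domain.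
have ri i : leb.-integrable Om (EFin \o (fun x => f x * \1_((simplex (T i))°) x)).
  by apply: rint_indic => //; exact: measurable_interior_simplex.
under eq_bigr => i _ do rewrite (Rintegral_indic_sub _ _ (@interior_simplex_sub i)).
rewrite -Rintegral_sum//; apply: ae_eq_Rintegral => //.
- by apply: (@measurable_rint _ _ _ leb); exact: rint_sum.
- exact: measurable_rint fi.
- move: ae_in_interior; apply: filterS => x /[apply] -[i xi].
  rewrite (bigD1 i)//= big1 ?addr0.
    by rewrite indicE mem_set// mulr1.
  move=> j ji; rewrite indicE memNset ?mulr0//.
  by move=> /interior_subset; apply: (interior_simplex_disj _ xi); rewrite eq_sym.
Qed.

End triangulations.

(** * Finite element functions *)

Lemma continuous_mulmxr (R : realType) d m (L : 'M[R]_(d, m)) :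
  continuous (fun y : 'rV[R]_d => y *m L).
Proof.
rewrite (_ : (fun y => _) = (fun y : 'rV[R]_d => \sum_i y ord0 i *: row i L)); last first.
  by apply/funext => y; rewrite mulmx_sum_row.
apply: (@continuous_big 'rV[R]_m 'I_d +%R 0 predT) => [|j _ y]; first exact: add_continuous.
exact: (@cvgZr_tmp R 'rV[R]_m 'rV[R]_d (nbhs y) _ _ _ _ (@coord_continuous R 1 d ord0 j y)).
Qed.

Lemma diff_locally_affine (R : realType) d m (v : 'rV[R]_d -> 'rV[R]_m) x (L : 'M[R]_(d, m)) :
  (\forall y \near x, v y = v x + (y - x) *m L) ->
  'd v x = (fun y => y *m L) :> ('rV[R]_d -> 'rV[R]_m).
Proof.
move=> vL; apply: (@diff_unique R _ _ v (mulmxr L)).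
  exact: (@continuous_mulmxr R d m L).
apply/eqaddoP => e e0 /=.
have : \forall y \near (0 : 'rV[R]_d), v (y + x) = v x + y *m L.
  have := vL; rewrite (near_shift 0) subr0.
  by apply: filterS => y /=; rewrite addrK.
apply: filterS => y /= vy.
rewrite [X in `|X|](_ : _ = 0) ?normr0 ?mulr_ge0 ?(ltW e0)//.
by apply/eqP; rewrite subr_eq0; apply/eqP.
Qed.

(** Where no differential exists, the choice operator returns its default, the same at all such
    points. This makes the gradient measurable on faces too. *)
Lemma diff_nondifferentiable (R : realType) d m (v w : 'rV[R]_d -> 'rV[R]_m) x y :
  ~ differentiable v x -> ~ differentiable w y ->
  'd v x = 'd w y :> ('rV[R]_d -> 'rV[R]_m).
Proof.
have H (f : 'rV[R]_d -> 'rV[R]_m) z : ~ differentiable f z ->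
    'd f z = (point : {linear 'rV[R]_d -> 'rV[R]_m}).
  move=> nd; rewrite /diff; set P := (X in xget _ X).
  rewrite xgetPN// => df Pdf; apply: nd; apply/diffP.
  by have : exists g, P g by [exists df]; move/getPex.
by move=> /H -> /H ->.
Qed.

(** A one-sided segment suffices, as is needed at a boundary point of an element. *)
Lemma diff_segment (R : realType) d m (v : 'rV[R]_d -> 'rV[R]_m) x h k :
  differentiable v x -> (forall t : R, 0 <= t <= 1 -> v (t *: h + x) = v x + t *: k) ->
  'd v x h = k.
Proof.
move=> dv vk; rewrite -deriveE//.
have dvh : derivable v x h by exact: diff_derivable.
pose quot := fun t : R => t^-1 *: ((v \o shift x) (t *: h) - v x).
have H1 : quot t @[t --> 0^'+] --> 'D_h v x by exact: cvg_dnbhs_at_right dvh.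
suff H2 : quot t @[t --> 0^'+] --> k by exact: norm_cvg_unique H1 H2.
apply: cvg_near_cst; near=> t.
have t01 : 0 <= t <= 1.
  apply/andP; split; near: t; first exact: nbhs_right_ge.
  exact: nbhs_right_le.
have t0 : t != 0 by rewrite gt_eqF//; near: t; exact: nbhs_right_gt.
by rewrite /quot /= vk// addrAC subrr add0r scalerA mulVf// scale1r.
Unshelve. all: by end_near. Qed.

(** * Gradients of piecewise affine functions *)

Section piecewise_affine.
Variables (R : realType) (d m : nat) (Om : set 'rV[R]_d) (M : nat) (T : mesh R d M).
Local Notation pt := 'rV[R]_d.
Hypotheses (oOm : open Om).
Hypothesis triT : triangulation Om T.
Variable v : pt -> 'rV[R]_m.
Hypothesis affv : forall i, exists (A : 'M[R]_(d, m)) (b : 'rV[R]_m),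
  forall x, simplex (T i) x -> v x = x *m A + b.

Let nd i : Defs.nondegenerate (T i). Proof. by case: triT. Qed.

(** Finitely many values are possible, and by [diff_elements_at] the gradient at a point of the
    domain depends on this set alone. *)
Definition elements_at (x : pt) : {set 'I_M} := [set i | `[< simplex (T i) x >]].

Lemma elements_atP x i : reflect (simplex (T i) x) (i \in elements_at x).
Proof. by rewrite inE; apply: asboolP. Qed.

(** The finitely many elements that do not contain [x] are closed, hence stay away from it. *)
Lemma elements_at_near x : Om x ->
  \forall y \near x, exists2 i, i \in elements_at x & simplex (T i) y.
Proof.
move=> Ox.
have h1 : nbhs x Om by rewrite nbhsE; exists Om.
have h2 : nbhs x [set y | forall i, i \notin elements_at x -> ~ simplex (T i) y].
  apply: (@filter_forall _ _ (fun i (y : pt) => i \notin elements_at x -> ~ simplex (T i) y)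
    (nbhs x) (nbhs_filter x)) => i.
  have [xi|xi] := boolP (i \in elements_at x).
    by apply: filterE.
  have : nbhs x (~` simplex (T i)).
    rewrite nbhsE; exists (~` simplex (T i)) => //; split.
      by rewrite openC; exact: closed_simplex.
    by apply/elements_atP.
  by apply: filterS.
apply: filterS2 h1 h2 => y Oy hy.
have : closure Om y by exact: subset_closure.
have [_ -> _ _] := triT; move=> [i _ yi]; exists i => //.
by apply: contraT => /hy.
Qed.

Lemma diff_common_gradient x (L : 'M[R]_(d, m)) : Om x ->
  (forall i, simplex (T i) x -> forall y, simplex (T i) y -> v y = v x + (y - x) *m L) ->
  'd v x = (fun y => y *m L) :> (pt -> 'rV[R]_m).
Proof.
move=> Ox hL; apply: diff_locally_affine.
have := elements_at_near Ox; apply: filterS => y [i /elements_atP xi yi].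
exact: hL yi.
Qed.

Lemma diff_on_element x i (A : 'M[R]_(d, m)) b :
  (forall y, simplex (T i) y -> v y = y *m A + b) -> simplex (T i) x ->
  differentiable v x -> 'd v x = (fun y => y *m A) :> (pt -> 'rV[R]_m).
Proof.
move=> hA xi dv.
have row_dir a : 'd v x (row a (T i) - x) = (row a (T i) - x) *m A.
  apply: diff_segment => // t t01.
  rewrite hA; last exact: (segment_simplex (nd i) xi (row_in_simplex (nd i) a) t01).
  by rewrite (hA x)// mulmxDl -scalemxAl addrC addrA addrAC [b + _]addrC.
apply/funext => h.
(* The directions from [x] to the vertices span the space; the barycentric coordinates of [h + x],
   of sum 1, give the coefficients. *)
have hE : h = \sum_a bary (T i) (h + x) ord0 a *: (row a (T i) - x).
  under eq_bigr do rewrite scalerBr.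
  rewrite sumrB -scaler_suml (bary_sum (nd i)) scale1r -mulmx_sum_row (baryA (nd i)).
  by rewrite addrK.
rewrite hE linear_sum mulmx_suml; apply: eq_bigr => a _.
by rewrite linearZ /= row_dir scalemxAl.
Qed.

(** Differentiability at one point forces the affine pieces of all its elements to have the same
    linear part, so the function is affine near the other point as well. If both points fail, both
    differentials are the default. *)
Lemma diff_elements_at x y : Om x -> Om y -> elements_at x = elements_at y ->
  'd v x = 'd v y :> (pt -> 'rV[R]_m).
Proof.
suff H z z' : Om z -> Om z' -> elements_at z = elements_at z' ->
    differentiable v z -> 'd v z = 'd v z' :> (pt -> 'rV[R]_m).
  move=> Ox Oy xy; have [dx|dx] := pselect (differentiable v x); first exact: H.
  have [dy|dy] := pselect (differentiable v y); last exact: diff_nondifferentiable.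
  by apply/esym; apply: H.
move=> Oz Oz' zz' dz.
have : closure Om z by exact: subset_closure.
have [_ -> _ _] := triT; move=> [i _ zi].
have [A [b hA]] := affv i; have dE := diff_on_element hA zi dz.
apply: (etrans dE); apply: esym; apply: (@diff_common_gradient z' A Oz') => j z'j u uj.
have zj : simplex (T j) z by apply/elements_atP; rewrite zz'; apply/elements_atP.
have [A' [b' hA']] := affv j; have dE' := diff_on_element hA' zj dz.
rewrite !hA'// mulmxBl.
have e (w : pt) : w *m A = w *m A'.
  have ev := congr1 (fun F : pt -> 'rV[R]_m => F w).
  exact: etrans (esym (ev _ _ dE)) (ev _ _ dE').
by rewrite !e [RHS]addrAC [z' *m A' + _]addrC subrK.
Qed.

Lemma grad_interior x i (A : 'M[R]_(d, m)) b :
  (forall y, simplex (T i) y -> v y = y *m A + b) -> (simplex (T i))° x ->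
  grad v x = A.
Proof.
move=> hA xi.
have dE : 'd v x = (fun y => y *m A) :> (pt -> 'rV[R]_m).
  apply: diff_locally_affine; have : nbhs x (simplex (T i)) by [].
  apply: filterS => y yi; rewrite !hA//; last exact: interior_subset.
  by rewrite mulmxBl [RHS]addrAC [x *m A + _]addrC subrK.
rewrite /grad /jacobian.
apply/row_matrixP => k; rewrite !rowE.
by rewrite mul_rV_lin1 dE.
Qed.

(** The gradient is constant on each of the finitely many sets cut out by [elements_at], which are
    Boolean combinations of closed simplices. *)
Lemma measurable_grad : measurable_field Om (grad v).
Proof.
move=> i j.
(* The value at a sample point; the default 0 is chosen only for sets that no point of [Om]
   realizes. *)
pose Hs (S : {set 'I_M}) := grad v (xget 0 [set x | Om x /\ elements_at x = S]) i j.
pose P (S : {set 'I_M}) := [set x : pt | elements_at x = S].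
have mP S : measurable (P S).
  rewrite (_ : P S = \bigcap_(i in [set: 'I_M])
      (if i \in S then simplex (T i) else ~` simplex (T i))).
    rewrite (_ : [set: 'I_M] = [set` index_enum 'I_M]); last first.
      by apply/seteqP; split => k //= _; rewrite mem_index_enum.
    rewrite bigcap_seq; apply: bigsetI_measurable => k _.
    have mk : measurable (simplex (T k)).
      by apply: closed_measurable_rV; exact: closed_simplex.
    by case: ifP => _ //; exact: measurableC.
  apply/seteqP; split => x.
    move=> <- k _; case: ifPn => [/elements_atP//|/elements_atP].
    by [].
  move=> h; apply/setP => k; have := h k I; case: ifPn => kS.
    by move=> xk; apply/elements_atP.
  by move=> xk; apply/negbTE/elements_atP.
apply: (@eq_measurable_fun _ _ _ _ _ (fun x => \sum_(S : {set 'I_M}) Hs S * \1_(P S) x)).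
  move=> x /set_mem Ox; rewrite (bigD1 (elements_at x))//= big1 ?addr0.
    rewrite indicE mem_set// mulr1 /Hs.
    set y := xget _ _; have [Oy yx] : Om y /\ elements_at y = elements_at x.
      by apply: (@xgetPex _ 0 [set y | Om y /\ elements_at y = elements_at x]); exists x.
    have gE : grad v x = grad v y := congr1 (@lin1_mx R d m) (diff_elements_at Ox Oy (esym yx)).
    by rewrite gE.
  move=> S Sx; rewrite indicE memNset ?mulr0// => xS.
  by rewrite -xS eqxx in Sx.
apply: measurable_sum => S; apply: measurable_funM => //.
Qed.

End piecewise_affine.

(** * Square integrable fields *)

Section L2_space.
Variables (R : realType) (d : nat) (w : set 'rV[R]_d).
Local Notation pt := 'rV[R]_d.
Local Notation leb := (lebesgue_rV R d).
Hypothesis mw : measurable w.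

Lemma subspace_L2 p q : subspace (@L2 R d w p q).
Proof.
split.
  move=> i j; split.
    by apply: (@eq_measurable_fun _ _ _ _ _ (fun _ : pt => 0 : R)) => [x _|]; rewrite ?mxE.
  apply: (eq_integrable mw (fun=> 0%E)); last exact: integrable0.
  by move=> x _; rewrite mxE expr0n.
move=> k F G hF hG i j; have [mF iF] := hF i j; have [mG iG] := hG i j.
have m : measurable_fun w (fun x => (k *: F + G) x i j).
  apply: (@eq_measurable_fun _ _ _ _ _ (fun x => k * F x i j + G x i j)).
    by move=> x _; rewrite !mxE.
  by apply: measurable_funD => //; exact: measurable_funM.
split=> //.
apply: (ae_le_integrable mw (g := fun x => (2 * k ^+ 2) * (F x i j) ^+ 2 + 2 * (G x i j) ^+ 2)).
- by apply: measurable_funX.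
- by apply: (rintD mw); apply: (rintZ mw).
- apply: aeW => x _; rewrite !mxE ger0_norm ?sqr_ge0//.
  have := sqr_ge0 (k * F x i j - G x i j); lra.
Qed.

Lemma L2_ae_eq p q (F G : pt -> 'M[R]_(p, q)) : L2 w F -> measurable_field w G ->
  {ae leb, forall x, w x -> F x = G x} -> L2 w G.
Proof.
move=> hF mG FG i j; have [mF iF] := hF i j; split; first exact: mG.
apply: (ae_le_integrable mw (g := fun x => F x i j ^+ 2)) => //.
  by apply: measurable_funX; exact: mG.
by move: FG; apply: filterS => x h wx; rewrite h// ger0_norm// sqr_ge0.
Qed.

Lemma L2_sub (w' : set pt) p q (F : pt -> 'M[R]_(p, q)) : measurable w' -> w' `<=` w ->
  L2 w F -> L2 w' F.
Proof.
move=> mw' ww' hF i j; have [mF iF] := hF i j; split; last exact: rint_sub iF.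
exact: measurable_funS mF.
Qed.

Lemma psd_ip_gen p q (X : lmodType R) (Phi : X -> pt -> 'M[R]_(p, q)) :
  (forall u, L2 w (Phi u)) ->
  (forall k u v, {ae leb, forall x, w x -> Phi (k *: u + v) x = k *: Phi u x + Phi v x}) ->
  psd_form (fun u v => ip w (Phi u) (Phi v)).
Proof.
move=> P2 Pl; apply: (psd_density (beta := fun _ => @frob R p q) (C := 1) mw) => //.
- by move=> _ k A B D; exact: frob_linear.
- move=> F G mF mG; apply: measurable_sum => i; apply: measurable_sum => j.
  exact: measurable_funM.
- apply: aeW => x _ A B; have := psd_CS (psd_frob R p q) A B.
  move/le_trans; apply; rewrite mul1r -!(fnorm2 (psd_frob R p q)).
  set a := fnorm _ A; set b := fnorm _ B.
  have := sqr_ge0 (a - b); have := sqr_ge0 (a + b); lra.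
- by apply: aeW => x _ A B; exact: frobC.
- by apply: aeW => x _ A; exact: frob_sq_ge0.
Qed.

Lemma ip_ae_eq p q (F G F' G' : pt -> 'M[R]_(p, q)) : L2 w F -> L2 w G ->
  L2 w F' -> L2 w G' -> {ae leb, forall x, w x -> F x = F' x} ->
  {ae leb, forall x, w x -> G x = G' x} -> ip w F G = ip w F' G'.
Proof.
move=> hF hG hF' hG' FF GG; apply: ae_eq_Rintegral => //.
- by apply: (@measurable_rint _ _ _ leb); exact: rint_frob.
- by apply: (@measurable_rint _ _ _ leb); exact: rint_frob.
- by move: FF GG; apply: filterS2 => x h h' wx; rewrite h// h'.
Qed.

Lemma ip_ge0 p q (F : pt -> 'M[R]_(p, q)) : 0 <= ip w F F.
Proof. by apply: Rintegral_ge0 => x _; exact: frob_sq_ge0. Qed.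

End L2_space.

(** * Weakly differentiable functions *)

Section H1_pairs.
Variables (R : realType) (d m : nat) (Om : set 'rV[R]_d).
Local Notation pt := 'rV[R]_d.
Hypothesis mO : measurable Om.

(** The gradient is a separate argument of [H1norm], which is therefore a seminorm on pairs, and the
    triangle inequality is proved there. *)
Let pairs : lmodType R := ((pt -> 'rV[R]_m) * (pt -> 'M[R]_(d, m)))%type.
Let L2p (p : pairs) : Prop := L2 Om p.1 /\ L2 Om p.2.
Let sL2p : subspace L2p.
Proof.
split; first by split; exact: (subspace0 (subspace_L2 _ _ _)).
move=> k x y [x1 x2] [y1 y2].
by split; apply: (proj2 (subspace_L2 mO _ _)).
Qed.

Let h1 (u v : sub_space sL2p) : R :=
  ip Om (val u).1 (val v).1 + ip Om (val u).2 (val v).2.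

Let psd_h1 : psd_form h1.
Proof.
have p1 : psd_form (fun u v : sub_space sL2p => ip Om (val u).1 (val v).1).
  apply: psd_ip_gen => //; first by move=> u; case: (sub_spaceP u).
  by move=> k u v; apply: aeW => x _.
have p2 : psd_form (fun u v : sub_space sL2p => ip Om (val u).2 (val v).2).
  apply: psd_ip_gen => //; first by move=> u; case: (sub_spaceP u).
  by move=> k u v; apply: aeW => x _.
split.
- by move=> k x y z; rewrite /h1 (psd_linear p1) (psd_linear p2); ring.
- by move=> x y; rewrite /h1 (psdC p1) (psdC p2).
- by move=> x; rewrite /h1 addr_ge0 ?(psd_ge0 p1) ?(psd_ge0 p2).
Qed.

Let H1norm_fnorm v G (h : L2p (v, G)) : H1norm Om v G = fnorm h1 (to_sub_space sL2p h).
Proof. by rewrite /H1norm /fnorm /l2norm !sqr_sqrtr ?ip_ge0. Qed.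

Lemma H1norm_le_lin k (v w : pt -> 'rV[R]_m) (G F : pt -> 'M[R]_(d, m)) : L2 Om v -> L2 Om G -> L2 Om w -> L2 Om F ->
  H1norm Om (k *: v + w) (k *: G + F) <= `|k| * H1norm Om v G + H1norm Om w F.
Proof.
move=> hv hG hw hF; have hvG : L2p (v, G) by split.
have hwF : L2p (w, F) by split.
have hk : L2p (k *: v + w, k *: G + F).
  exact: (proj2 sL2p k (v, G) (w, F) hvG hwF).
rewrite (H1norm_fnorm hvG) (H1norm_fnorm hwF) (H1norm_fnorm hk).
rewrite -(fnormZ psd_h1); apply: le_trans (fnormD psd_h1 _ _).
by rewrite le_eqVlt; apply/orP; left; apply/eqP; congr fnorm; exact: val_inj.
Qed.
End H1_pairs.

Section bounded_domain.
Variable R : realType.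

Lemma lebesgue_box_lty n (r : R) :
  (lebesgue_rV R n [set x : 'rV[R]_n | forall i, `|x ord0 i| <= r]%R < +oo)%E.
Proof.
elim: n => [|n IH] /=; first by rewrite diracE ltry.
rewrite /lebesgue_rV_step /pushforward.
have mn : measurable [set x : 'rV[R]_n | forall i, `|x ord0 i| <= r].
  apply: (measurable_coord_box (I := fun=> [set t | `|t| <= r])) => i.
  rewrite (_ : [set t | _] = `[(- r), r]%classic); first exact: measurable_itv.
  by apply/seteqP; split => t /=; rewrite in_itv /= ler_norml.
rewrite (_ : _ @^-1` _ = (`[(- r), r]%classic : set (measurableTypeR R)) `*`
    [set x : 'rV[R]_n | forall i, `|x ord0 i| <= r]).
  have itvf : @lebesgue_measure R `[(- r), r]%classic \is a fin_num.
    by rewrite lebesgue_measure_itv /=; case: ifP.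
  by rewrite product_measure1E//; apply: lte_mul_pinfty.
apply/seteqP; split => -[t x] /=.
  move=> h; split; first by have := h ord0; rewrite rV_cons0 in_itv /= ler_norml.
  by move=> i; have := h (lift ord0 i); rewrite rV_consS.
rewrite in_itv /= -ler_norml => -[h1 h2] i.
by have [j ->|->] := unliftP ord0 i; [rewrite rV_consS|rewrite rV_cons0].
Qed.

Variables (d : nat) (Om : set 'rV[R]_d) (M : nat) (T : mesh R d M).
Local Notation pt := 'rV[R]_d.
Local Notation leb := (lebesgue_rV R d).
Hypotheses (oOm : open Om) (triT : triangulation Om T).
Let mO : measurable Om. Proof. exact: open_measurable_rV. Qed.

Lemma domain_lty : (leb Om < +oo)%E.
Proof.
(* Every coordinate of a convex combination of vertices is bounded by the sum of the absolute values
   of all vertex coordinates. *)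
pose r := \sum_i \sum_a \sum_b `|T i a b|.
apply: (le_lt_trans _ (lebesgue_box_lty d r)); apply: le_measure; rewrite ?inE//.
  apply: (measurable_coord_box (I := fun=> [set t | `|t| <= r])) => i.
  rewrite (_ : [set t | _] = `[(- r), r]%classic); first exact: measurable_itv.
  by apply/seteqP; split => t /=; rewrite in_itv /= ler_norml.
move=> x Ox; have : closure Om x by exact: subset_closure.
have [_ -> _ _] := triT; move=> [i _ [l [l0 _ l1 ->]]] b /=.
rewrite mxE; apply: le_trans (ler_norm_sum _ _ _) _.
have le1 a : l ord0 a <= 1.
  by rewrite -l1 (bigD1 a)//= lerDl; apply: sumr_ge0 => c _; exact: l0.
apply: (@le_trans _ _ (\sum_a \sum_b `|T i a b|)).
  apply: ler_sum => a _; rewrite normrM (ger0_norm (l0 a)).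
  apply: (@le_trans _ _ `|T i a b|); first by rewrite ler_piMl.
  by rewrite (bigD1 b)//= lerDl; apply: sumr_ge0.
rewrite /r (bigD1 i)//= lerDl; apply: sumr_ge0 => c _.
by apply: sumr_ge0 => a _; apply: sumr_ge0.
Qed.

Lemma continuous_measurable_rV (g : pt -> R) : continuous g -> measurable_fun setT g.
Proof.
move=> cg; apply: (measurability _ (RGenOpens.measurableE R)).
move=> _ [_ [a [b ->] <-]]; rewrite setTI; apply: open_measurable_rV.
by apply: open_comp; [move=> x _; exact: cg|exact: interval_open].
Qed.

Lemma compact_support_bounded (g : pt -> R) K : continuous g -> compact K ->
  (forall x, ~ K x -> g x = 0) -> exists C, forall x, `|g x| <= C.
Proof.
move=> cg cK g0.
have : compact (g @` K) by apply: continuous_compact => //; exact: continuous_subspaceT.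
move=> /compact_bounded[C [_ hC]]; exists (`|C| + 1) => x.
have [xK|xK] := pselect (K x); last by rewrite g0// normr0 addr_ge0.
by apply: hC; [rewrite ltr_pwDr// ler_norm|exists x].
Qed.

Lemma test_partial_support (phi : pt -> R) K i : compact K ->
  (forall x, ~ K x -> phi x = 0) -> forall x, ~ K x -> partial i phi x = 0.
Proof.
move=> cK p0 x xK; rewrite /partial.
rewrite (@near_eq_derive _ _ _ _ (cst 0)) ?derive_cst//.
have : nbhs x (~` K).
  rewrite nbhsE; exists (~` K) => //; split => //.
  rewrite openC; apply: compact_closed => //; exact: norm_hausdorff.
by apply: filterS => y yK; rewrite p0.
Qed.

(** A continuous function of compact support is bounded, hence square integrable on a domain of
    finite measure. Linearity of weak gradients rests on this integrability. *)
Lemma rint_test (f g : pt -> R) K : measurable_fun Om f ->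
  leb.-integrable Om (EFin \o (fun x => f x ^+ 2)) -> continuous g -> compact K ->
  (forall x, ~ K x -> g x = 0) -> leb.-integrable Om (EFin \o (fun x => f x * g x)).
Proof.
move=> mf fi cg cK g0; have [C hC] := compact_support_bounded cg cK g0.
have mg : measurable_fun Om g by apply: measurable_funTS; exact: continuous_measurable_rV.
apply: rintM => //; apply: measurable_bounded_integrable => //.
- exact: domain_lty.
- exact: measurable_funX.
- exists (C ^+ 2); split; first exact: num_real.
  move=> y Cy x /= _; apply: le_trans (ltW Cy).
  by rewrite normrX lerXn2r ?nnegrE// (le_trans _ (hC x)).
Qed.

Lemma test_function_continuous phi : test_function Om phi -> continuous phi.
Proof. by move=> [sm _] x; exact: (differentiable_continuous (sm [::] x)). Qed.

Lemma test_partial_continuous phi i : test_function Om phi -> continuous (partial i phi).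
Proof. by move=> [sm _] x; exact: (differentiable_continuous (sm [:: i] x)). Qed.

Lemma weak_gradient_lin m k (v w : pt -> 'rV[R]_m) (G F : pt -> 'M[R]_(d, m)) :
  H1 Om v G -> H1 Om w F -> weak_gradient Om (k *: v + w) (k *: G + F).
Proof.
move=> [v2 G2 vG] [w2 F2 wF] phi tphi i j.
have [_ [K [cK _ p0]]] := tphi.
have iv u : L2 Om u -> leb.-integrable Om (EFin \o (fun x => u x ord0 j * partial i phi x)).
  move=> u2; have [mu iu] := u2 ord0 j; apply: (rint_test mu iu _ cK).
    exact: test_partial_continuous.
  exact: test_partial_support.
have iG (u : pt -> 'M[R]_(d, m)) : L2 Om u ->
    leb.-integrable Om (EFin \o (fun x => u x i j * phi x)).
  move=> u2; have [mu iu] := u2 i j; apply: (rint_test mu iu _ cK) => //.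
  exact: test_function_continuous.
have e1 : \int[leb]_(x in Om) ((k *: v + w) x ord0 j * partial i phi x) =
    k * \int[leb]_(x in Om) (v x ord0 j * partial i phi x)
    + \int[leb]_(x in Om) (w x ord0 j * partial i phi x).
  rewrite -RintegralZl// -?RintegralD//; try exact: iv; last by apply: (rintZ mO); exact: iv.
  by apply: eq_Rintegral => x _; rewrite !mxE; ring.
have e2 : \int[leb]_(x in Om) ((k *: G + F) x i j * phi x) =
    k * \int[leb]_(x in Om) (G x i j * phi x)
    + \int[leb]_(x in Om) (F x i j * phi x).
  rewrite -RintegralZl// -?RintegralD//; try exact: iG; last by apply: (rintZ mO); exact: iG.
  by apply: eq_Rintegral => x _; rewrite !mxE; ring.
by rewrite e1 e2 vG// wF//; ring.
Qed.

Lemma H1_lin m k (v w : pt -> 'rV[R]_m) (G F : pt -> 'M[R]_(d, m)) :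
  H1 Om v G -> H1 Om w F -> H1 Om (k *: v + w) (k *: G + F).
Proof.
move=> hv hw; split; last exact: weak_gradient_lin.
  by case: hv hw => [v2 _ _] [w2 _ _]; exact: (proj2 (subspace_L2 mO _ _)).
by case: hv hw => [_ v2 _] [_ w2 _]; exact: (proj2 (subspace_L2 mO _ _)).
Qed.

Lemma H1_0 m : H1 Om (0 : pt -> 'rV[R]_m) (0 : pt -> 'M[R]_(d, m)).
Proof.
split; [exact: (subspace0 (subspace_L2 mO _ _))|exact: (subspace0 (subspace_L2 mO _ _))|].
move=> phi _ i j.
under eq_Rintegral do rewrite mxE mul0r.
under [in RHS]eq_Rintegral do rewrite mxE mul0r.
by rewrite !Rintegral_cst// mul0r oppr0.
Qed.

Lemma H1D_lin (GD : set pt) m k (v w : pt -> 'rV[R]_m) (G F : pt -> 'M[R]_(d, m)) :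
  H1D Om GD v G -> H1D Om GD w F -> H1D Om GD (k *: v + w) (k *: G + F).
Proof.
move=> [hv av] [hw aw]; split; first exact: H1_lin.
move=> e e0.
(* The added 1 keeps the tolerance defined for [k = 0]. *)
have k0 : 0 < 2 * (`|k| + 1) by rewrite mulr_gt0// ltr_wpDl.
have [v' [G' [hv' cv' zv' nv']]] := av (e / (2 * (`|k| + 1))) (divr_gt0 e0 k0).
have [w' [F' [hw' cw' zw' nw']]] := aw (e / 2) (divr_gt0 e0 (ltr0Sn _ _)).
exists (k *: v' + w'), (k *: G' + F'); split.
- exact: H1_lin.
- move=> x; apply: (@cvgD _ _ _ _ _ (fun y => k *: v' y) w'); last exact: cw'.
  by apply: (@cvgZl_tmp _ _ _ _ _ k v'); exact: cv'.
- move=> x gx; rewrite (_ : (k *: v' + w') x = k *: v' x + w' x)//.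
  by rewrite zv'// zw'// scaler0 addr0.
- have := @H1norm_le_lin R d m Om mO k (fun x => v x - v' x) (fun x => w x - w' x)
    (fun x => G x - G' x) (fun x => F x - F' x).
  have sub p q (A A' : pt -> 'M[R]_(p, q)) : L2 Om A -> L2 Om A' -> L2 Om (fun x => A x - A' x).
    by move=> hA hA'; exact: (subspaceB (subspace_L2 mO p q) hA hA').
  case: hv hv' => [a1 a2 _] [a3 a4 _]; case: hw hw' => [b1 b2 _] [b3 b4 _].
  move=> /(_ (sub _ _ _ _ a1 a3) (sub _ _ _ _ a2 a4) (sub _ _ _ _ b1 b3) (sub _ _ _ _ b2 b4)).
  have fE p q (A A' B B' : pt -> 'M[R]_(p, q)) :
      (fun x => (k *: A + B) x - (k *: A' + B') x) =
      k *: (fun x => A x - A' x) + (fun x => B x - B' x).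
    apply/funext => x; rewrite /= !fctE.
    by rewrite scalerBr opprD addrACA.
  rewrite !fE => h; apply: (le_lt_trans h).
  have : `|k| * H1norm Om (fun x => v x - v' x) (fun x => G x - G' x) <= e / 2.
    apply: (@le_trans _ _ ((`|k| + 1) * (e / (2 * (`|k| + 1))))).
      apply: ler_pM => //; first exact: sqrtr_ge0.
        by rewrite lerDl.
      exact: ltW.
    rewrite le_eqVlt; apply/orP; left; apply/eqP; field.
    by rewrite gt_eqF// ltr_wpDl.
  move=> h'; rewrite [ltRHS]splitr; exact: ler_ltD.
Qed.

End bounded_domain.

(** * Finite element spaces and their degrees of freedom *)

Section finite_elements.
Variables (R : realType) (d m : nat) (Om GD : set 'rV[R]_d).
Local Notation pt := 'rV[R]_d.
Local Notation fct := (pt -> 'rV[R]_m).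
Local Notation leb := (lebesgue_rV R d).
Hypotheses (d_gt0 : (0 < d)%N) (oOm : open Om) (rOm : (closure Om)° = Om).
Let mO : measurable Om. Proof. exact: open_measurable_rV. Qed.

(** Serves to replace a linear combination of gradients by the gradient of the combination, which
    equals it only almost everywhere. *)
Lemma H1D_ae_eq M (T : mesh R d M) (v : fct) (G G' : pt -> 'M[R]_(d, m)) :
  triangulation Om T -> H1D Om GD v G -> measurable_field Om G' ->
  {ae leb, forall x, Om x -> G x = G' x} -> H1D Om GD v G'.
Proof.
move=> triT [[v2 G2 vG] av] mG' GG'; have G'2 := L2_ae_eq mO G2 mG' GG'.
split.
  split=> // phi tphi i j; rewrite vG//; congr (- _).
  have mphi : measurable_fun Om phi.
    by apply: measurable_funTS; apply: continuous_measurable_rV; exact: test_function_continuous tphi.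
  apply: ae_eq_Rintegral => //.
  - by apply: measurable_funM => //; exact: L2_measurable G2 i j.
  - exact: measurable_funM.
  - by move: GG'; apply: filterS => x h Ox; rewrite h.
move=> e e0; have [w [Gw [hw cw zw nw]]] := av e e0; exists w, Gw; split => //.
rewrite /H1norm /l2norm (@ip_ae_eq _ _ _ _ _ _ (fun x => G' x - Gw x) (fun x => G' x - Gw x)
  (fun x => G x - Gw x) (fun x => G x - Gw x))//.
- by case: hw => _ Gw2 _; exact: (subspaceB (subspace_L2 mO _ _) G'2 Gw2).
- by case: hw => _ Gw2 _; exact: (subspaceB (subspace_L2 mO _ _) G'2 Gw2).
- by case: hw => _ Gw2 _; exact: (subspaceB (subspace_L2 mO _ _) G2 Gw2).
- by case: hw => _ Gw2 _; exact: (subspaceB (subspace_L2 mO _ _) G2 Gw2).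
- by move: GG'; apply: filterS => x h Ox; rewrite h.
- by move: GG'; apply: filterS => x h Ox; rewrite h.
Qed.

Lemma H1norm0 : H1norm Om (0 : fct) (0 : pt -> 'M[R]_(d, m)) = 0.
Proof.
have z p q : ip Om (0 : pt -> 'M[R]_(p, q)) 0 = 0.
  rewrite /ip; under eq_Rintegral do rewrite (psd0l (psd_frob R p q)).
  by rewrite Rintegral_cst// mul0r.
by rewrite /H1norm /l2norm !z sqrtr0 expr0n addr0 sqrtr0.
Qed.

Section one_mesh.
Variables (M : nat) (T : mesh R d M).
Hypothesis triT : triangulation Om T.
Local Notation V := (fe_space Om GD T).

Lemma fe_grad_lin k (v w : fct) : V v -> V w ->
  {ae leb, forall x, Om x -> grad (k *: v + w) x = k *: grad v x + grad w x}.
Proof.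
move=> [_ av _ _ _] [_ aw _ _ _].
have := ae_in_interior d_gt0 triT; apply: filterS => x /[apply] -[i xi].
have [A [b hA]] := av i; have [A' [b' hA']] := aw i.
have hk y : simplex (T i) y -> (k *: v + w) y = y *m (k *: A + A') + (k *: b + b').
  move=> yi; rewrite (_ : (k *: v + w) y = k *: v y + w y)// hA// hA'//.
  by rewrite mulmxDr -scalemxAr scalerDr addrACA.
by rewrite (grad_interior hk xi) (grad_interior hA xi) (grad_interior hA' xi).
Qed.

Lemma fe_L2 (v : fct) : V v -> L2 Om v.
Proof. by case=> _ _ _ _ [[]]. Qed.

Lemma fe_grad_L2 (v : fct) : V v -> L2 Om (grad v).
Proof. by case=> _ _ _ _ [[]]. Qed.

Lemma grad0 : grad (0 : fct) = 0.
Proof.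
apply/funext => x; have dE : 'd (0 : fct) x = (fun y => y *m (0 : 'M[R]_(d, m))) :> (pt -> 'rV[R]_m).
  by apply: diff_locally_affine; apply: (@filterE _ (nbhs x) (nbhs_filter x)) => y;
    rewrite mulmx0 addr0.
have -> : grad (0 : fct) x = lin1_mx (fun y => y *m (0 : 'M[R]_(d, m))).
  exact: (congr1 (@lin1_mx R d m) dE).
by apply/row_matrixP => k; rewrite !rowE (mul_rV_lin1 (mulmxr (0 : 'M[R]_(d, m)))) /= !mulmx0.
Qed.

Lemma subspace_fe : subspace (V : fct -> Prop).
Proof.
split.
  split => //.
  - by move=> x; exact: cvg_cst.
  - by move=> i; exists 0, 0 => x _; rewrite mulmx0 addr0.
  - split; first by rewrite grad0; exact: H1_0.
    move=> e e0; exists 0, 0; split => //; first exact: H1_0.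
      by move=> x; exact: cvg_cst.
    rewrite grad0 [X in H1norm _ X _](_ : _ = 0); last by apply/funext => x; rewrite subr0.
    rewrite [X in H1norm _ _ X](_ : _ = 0); last by apply/funext => x; rewrite subr0.
    by rewrite H1norm0.
move=> k v w hv hw; have [cv av gv ov Hv] := hv; have [cw aw gw ow Hw] := hw.
have aff i : exists (A : 'M[R]_(d, m)) (b : 'rV[R]_m),
    forall x, simplex (T i) x -> (k *: v + w) x = x *m A + b.
  have [A [b hA]] := av i; have [A' [b' hA']] := aw i.
  exists (k *: A + A'), (k *: b + b') => y yi.
  rewrite (_ : (k *: v + w) y = k *: v y + w y)// hA// hA'//.
  by rewrite mulmxDr -scalemxAr scalerDr addrACA.
split.
- move=> x; apply: (@cvgD _ _ _ _ _ (fun y => k *: v y) w); last exact: cw.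
  by apply: (@cvgZl_tmp _ _ _ _ _ k v); exact: cv.
- exact: aff.
- move=> x gx; rewrite (_ : (k *: v + w) x = k *: v x + w x)//.
  by rewrite gv// gw// scaler0 addr0.
- move=> x gx; rewrite (_ : (k *: v + w) x = k *: v x + w x)//.
  by rewrite ov// ow// scaler0 addr0.
- apply: (H1D_ae_eq triT (H1D_lin oOm triT k Hv Hw)).
    exact: (measurable_grad oOm triT aff).
  by have := fe_grad_lin k hv hw; apply: filterS => x h Ox; rewrite h.
Qed.

Let idx := ('I_M * 'I_d.+1 * 'I_m)%type.

(** Degrees of freedom numbered by natural numbers, as [riesz_exists] wants them, and 0 out of
    range. A vertex is listed once for every element that has it. *)
Definition vertex_value (n : nat) (v : fct) : R :=
  if insub n is Some k then
    let p := @enum_val idx predT k in v (row p.1.2 (T p.1.1)) ord0 p.2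
  else 0.

Definition vertex_count : nat := #|{: 'I_M * 'I_d.+1 * 'I_m}|.

Lemma vertex_value_linear n : linear_functional (vertex_value n).
Proof.
move=> k v w; rewrite /vertex_value; case: insubP => [q _ _|_]; last by rewrite mulr0 addr0.
set p := enum_val q; rewrite (_ : (k *: v + w) _ = k *: v (row p.1.2 (T p.1.1)) + w (row p.1.2 (T p.1.1)))//.
by rewrite !mxE.
Qed.

(** On an element the function is the combination of its vertex values with barycentric weights. *)
Lemma vertex_value_inj (v : fct) : V v ->
  (forall n, (n < vertex_count)%N -> vertex_value n v = 0) -> v = 0.
Proof.
move=> [_ av _ ov _] h; apply/funext => x; have [xO|xO] := pselect (closure Om x); last exact: ov.
have [_ ] := triT; move: xO => /[swap] -> [i _ xi] _ _.
have vz a : v (row a (T i)) = 0.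
  apply/rowP => j; have := h (@enum_rank idx (i, a, j)).
  rewrite /vertex_value insubT// => ltn /(_ (ltn_ord _)).
  rewrite (_ : Sub _ _ = @enum_rank idx (i, a, j)); last exact: val_inj.
  by rewrite enum_rankK /= mxE.
have nd : Defs.nondegenerate (T i) by case: triT.
have [A [b hA]] := av i; rewrite hA//.
have -> : x *m A + b = \sum_a bary (T i) x ord0 a *: v (row a (T i)).
  have e a : v (row a (T i)) = row a (T i) *m A + b by rewrite hA//; exact: row_in_simplex.
  under eq_bigr => a _ do rewrite e scalerDr.
  rewrite big_split /= -scaler_suml (bary_sum nd) scale1r; congr (_ + _).
  rewrite -[x in LHS](baryA nd) [X in X *m A]mulmx_sum_row mulmx_suml.
  by apply: eq_bigr => a _; rewrite scalemxAl.
by apply: big1 => a _; rewrite vz scaler0.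
Qed.

End one_mesh.

Lemma fe_refine Mh MH (Th : mesh R d Mh) (TH : mesh R d MH) (v : fct) : refines Th TH ->
  fe_space Om GD TH v -> fe_space Om GD Th v.
Proof.
move=> rf [cv av gv ov Hv]; split => // i; have [j ij] := rf i.
by have [A [b hA]] := av j; exists A, b => x /ij; exact: hA.
Qed.

End finite_elements.

(** * Patches and interpolation *)

Section diameters.
Variables (R : realType) (d : nat).
Local Notation pt := 'rV[R]_d.
Implicit Type A : 'M[R]_(d.+1, d).

Lemma enorm_fnorm p q (B : 'M[R]_(p, q)) : enorm B = fnorm (@frob R p q) B.
Proof. by []. Qed.

Lemma enorm_distD p q (C B D : 'M[R]_(p, q)) : enorm (B - D) <= enorm (B - C) + enorm (C - D).
Proof.
by have := fnormD (psd_frob R p q) (B - C) (C - D); rewrite addrA subrK.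
Qed.

Lemma enorm_rV_le (x : pt) s : 0 <= s -> (forall l, `|x ord0 l| <= s) ->
  enorm x <= d%:R * s.
Proof.
move=> s0 h; rewrite -[leRHS]ger0_norm ?mulr_ge0// -sqrtr_sqr ler_wsqrtr//.
rewrite /frob big_ord1 exprMn.
apply: (@le_trans _ _ (\sum_(l < d) s ^+ 2)).
  by apply: ler_sum => l _; rewrite -expr2 -(real_normK (num_real _)) lerXn2r ?nnegrE.
rewrite sumr_const card_ord -[leLHS]mulr_natl ler_wpM2r ?sqr_ge0//.
by rewrite -natrX ler_nat -mulnn; case: (d) => // n; rewrite leq_pmulr.
Qed.

Lemma coord_le_enorm (x : pt) l : `|x ord0 l| <= enorm x.
Proof.
by rewrite -sqrtr_sqr ler_wsqrtr// frob_entry.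
Qed.

Lemma simplex_enorm_bounded A : exists C, forall x y, simplex A x -> simplex A y ->
  enorm (x - y) <= C.
Proof.
pose r := \sum_a \sum_b `|A a b|.
have r0 : 0 <= r by apply: sumr_ge0 => a _; apply: sumr_ge0.
have xr x l : simplex A x -> `|x ord0 l| <= r.
  move=> [lam [l0 _ l1 ->]]; rewrite mxE; apply: le_trans (ler_norm_sum _ _ _) _.
  apply: ler_sum => a _; rewrite normrM (ger0_norm (l0 a)).
  have le1 : lam ord0 a <= 1.
    by rewrite -l1 (bigD1 a)//= lerDl; apply: sumr_ge0 => c _; exact: l0.
  apply: (@le_trans _ _ `|A a l|); first by rewrite ler_piMl.
  by rewrite (bigD1 l)//= lerDl; apply: sumr_ge0.
exists (d%:R * (r + r)) => x y hx hy; apply: enorm_rV_le; first exact: addr_ge0.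
by move=> l; rewrite !mxE (le_trans (ler_normB _ _))// lerD// xr.
Qed.

Lemma le_diam A x y : simplex A x -> simplex A y -> enorm (x - y) <= diam (simplex A).
Proof.
move=> hx hy; apply: ub_le_sup; last by exists x, y.
have [C hC] := simplex_enorm_bounded A; exists C => _ [x' [y' [hx' hy' ->]]].
exact: hC.
Qed.

Lemma diam_gt0 A : (0 < d)%N -> Defs.nondegenerate A -> 0 < diam (simplex A).
Proof.
move=> d0 ndA.
pose i : 'I_d.+1 := ord0; pose j : 'I_d.+1 := lift ord0 (Ordinal d0).
apply: lt_le_trans (le_diam (row_in_simplex ndA i) (row_in_simplex ndA j)).
have [k hk] : exists k, row i A ord0 k != row j A ord0 k.
  apply/existsP; apply: contraT => /existsPn h.
  have : row i A = row j A by apply/rowP => k; have := h k; rewrite negbK => /eqP.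
  by move=> /(row_simplex_inj ndA) ij; have := neq_lift i (Ordinal d0); rewrite -/j -ij eqxx.
apply: lt_le_trans (coord_le_enorm _ k).
by move: hk; rewrite !mxE normr_gt0 subr_eq0.
Qed.

Lemma diam_le_mesh_size M (T : mesh R d M) i : diam (simplex (T i)) <= mesh_size T.
Proof. exact: (le_bigmax _ (fun i => diam (simplex (T i)))). Qed.

End diameters.

(** * Finite overlap of patches *)

Section patches.
Variables (R : realType) (d : nat) (Om : set 'rV[R]_d) (M : nat) (T : mesh R d M).
Local Notation pt := 'rV[R]_d.
Local Notation leb := (lebesgue_rV R d).
Hypotheses (d_gt0 : (0 < d)%N) (oOm : open Om) (rOm : (closure Om)° = Om).
Hypothesis triT : triangulation Om T.
Variables (gam q : R).
Hypotheses (gam_gt0 : 0 < gam) (q_gt0 : 0 < q).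
Hypotheses (srT : shape_regular gam T) (quT : quasi_uniform q T).
Let H := mesh_size T.
Hypothesis H_gt0 : 0 < H.
Let nd i : Defs.nondegenerate (T i). Proof. by case: triT. Qed.

(** The number of points, in a cube of side [4 * H], of a grid of width [H / (2 * d * q * gam)]. *)
Definition patch_bound : nat := (Num.truncn (8 * d%:R * q * gam)).+1 ^ d.

Lemma patch_dist x i : omega T 1 i x ->
  forall z, simplex (T i) z -> enorm (x - z) <= 2 * H.
Proof.
move=> xi z zi; have := interior_subset xi => -[j /= [y [yj yi]] xj].
have yi' : simplex (T i) y.
  have : closure (simplex (T i)) y.
    by apply: closureS yi; exact: interior_subset.
  by rewrite -(closure_id _).1//; exact: closed_simplex.
apply: le_trans (enorm_distD y x z) _.
rewrite [2 * H]mulr_natl mulr2n lerD//.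
  exact: le_trans (le_diam xj yj) (diam_le_mesh_size T j).
exact: le_trans (le_diam yi' zi) (diam_le_mesh_size T i).
Qed.

(* Every element contains a point of a fixed grid of mesh width [s] in its interior,
   and at most [patch_bound] of those points are close to [x]. *)
Lemma patch_overlap x : (#|[set i | `[< omega T 1 i x >]]%SET| <= patch_bound)%N.
Proof.
(* Then [d * (2 * s)] is [H / (q * gam)], a radius for which every element contains a ball, by shape
   regularity and quasi-uniformity. *)
pose s := H / (q * gam) / (2 * d%:R).
have dR : 0 < d%:R :> R by rewrite ltr0n.
have s0 : 0 < s by rewrite !divr_gt0// mulr_gt0.
have /choice[c hc] : forall i, exists c, forall y, enorm (y - c) <= H / (q * gam) ->
    simplex (T i) y.
  move=> i; have [c h] := srT i; exists c => y yc; apply: h; apply: le_trans yc _.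
  by rewrite invfM mulrA ler_wpM2r ?invr_ge0 ?(ltW gam_gt0)// ler_pdivrMr// mulrC.
have cT i : simplex (T i) (c i).
  apply: hc; rewrite subrr enorm_fnorm /fnorm (psd0l (psd_frob R 1 d)) sqrtr0.
  by rewrite divr_ge0 ?(ltW H_gt0)// mulr_ge0 ?ltW.
(* Index of the grid point just below the centre [c i]; the shift by [2 * H] makes it
   nonnegative. *)
pose nl i l := Num.truncn ((c i ord0 l - x ord0 l + 2 * H) / s).
pose z i : pt := \row_l (x ord0 l - 2 * H + s * (nl i l)%:R).
have in_range i l : omega T 1 i x -> 0 <= c i ord0 l - x ord0 l + 2 * H <= 4 * H.
  move=> xi; have := le_trans (coord_le_enorm _ l) (patch_dist xi (cT i)).
  rewrite !mxE distrC ler_norml => /andP[]; lra.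
have zc i l : omega T 1 i x -> 0 <= c i ord0 l - z i ord0 l < s.
  move=> xi; have /andP[a0 a1] := in_range i l xi.
  have := @truncn_itv R ((c i ord0 l - x ord0 l + 2 * H) / s) (divr_ge0 a0 (ltW s0)).
  rewrite -/(nl i l) ler_pdivlMr// ltr_pdivrMr// mxE -natr1 => /andP[].
  by rewrite mulrDl mul1r; move: (s) => s' h1 h2; apply/andP; split; lra.
have zint i : omega T 1 i x -> (simplex (T i))° (z i).
  move=> xi; rewrite /interior /=; apply/nbhs_ballP; exists s => //= y /rV_ballP[_ yz].
  apply: hc; apply: (@le_trans _ _ (d%:R * (2 * s))).
    apply: enorm_rV_le; first by rewrite mulr_ge0// ltW.
    move=> l; have := yz l; rewrite /ball /= => h1; have /andP[h2 h3] := zc i l xi.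
    move: h1; rewrite ltr_norml => /andP[h4 h5].
    by rewrite 2!mxE ler_norml; apply/andP; split; lra.
  rewrite /s le_eqVlt; apply/orP; left; apply/eqP; field.
  by rewrite !gt_eqF.
set Sx := [set i | _]%SET; pose B := Num.truncn (8 * d%:R * q * gam).
have nB i l : omega T 1 i x -> (nl i l <= B)%N.
  move=> xi; have /andP[_ a1] := in_range i l xi; apply: le_truncn.
  rewrite ler_pdivrMr//; apply: le_trans a1 _; rewrite /s le_eqVlt; apply/orP; left.
  by apply/eqP; field; rewrite !gt_eqF.
pose f i : {ffun 'I_d -> 'I_B.+1} := [ffun l => inord (nl i l)].
(* Equal indices mean a common interior point, which distinct elements cannot have. *)
have finj : {in Sx &, injective f}.
  move=> i j; rewrite !inE => /asboolP/asboolP xi /asboolP/asboolP xj fij.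
  have zE : z i = z j.
    apply/rowP => l; rewrite !mxE; have := congr1 (fun g : {ffun 'I_d -> 'I_B.+1} => nat_of_ord (g l)) fij.
    have ni : (nl i l < B.+1)%N := nB i l xi; have nj : (nl j l < B.+1)%N := nB j l xj.
    by rewrite !ffunE (inordK ni) (inordK nj) => ->.
  apply/eqP; apply: contraT => ij; exfalso.
  apply: (interior_simplex_disj triT ij (zint i xi)).
  by rewrite zE; apply: interior_subset; exact: zint.
rewrite -(card_in_imset finj); apply: leq_trans (max_card _) _.
by rewrite card_ffun !card_ord.
Qed.

Lemma omega1_sub i : omega T 1 i `<=` Om.
Proof.
rewrite -rOm; apply: interiorS => x [j _ xj]; exact: (simplex_closure triT xj).
Qed.

Lemma measurable_omega k i : measurable (omega T k i).
Proof. by apply: open_measurable_rV; case: k => [|k]; exact: open_interior. Qed.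

Lemma sum_patches f : leb.-integrable Om (EFin \o f) -> (forall x, 0 <= f x) ->
  \sum_i \int[leb]_(x in omega T 1 i) f x <= patch_bound%:R * \int[leb]_(x in Om) f x.
Proof.
move=> fi f0; have mO := open_measurable_rV oOm.
have ri i : leb.-integrable Om (EFin \o (fun x => f x * \1_(omega T 1 i) x)).
  by apply: rint_indic => //; exact: measurable_omega.
under eq_bigr => i _ do rewrite (Rintegral_indic_sub _ _ (@omega1_sub i)).
rewrite -Rintegral_sum// -RintegralZl//; apply: le_Rintegral => //.
- exact: rint_sum.
- exact: rintZ.
- move=> x _; rewrite -mulr_sumr mulrC ler_wpM2r//.
  under eq_bigr do rewrite indicE.
  rewrite -natr_sum ler_nat; apply: leq_trans (patch_overlap x).
  rewrite -sum1dep_card leq_eqVlt; apply/orP; left; apply/eqP.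
  rewrite [RHS]big_mkcond; apply: eq_bigr => i _.
  have -> : (x \in omega T 1 i) = `[< omega T 1 i x >].
    by apply/idP/asboolP; [move/set_mem|move/mem_set].
  by case: asboolP.
Qed.

End patches.

Section L2_inequalities.
Variables (R : realType) (d : nat) (w : set 'rV[R]_d).
Local Notation pt := 'rV[R]_d.
Hypothesis mw : measurable w.

Lemma ip_CS p q (F G : pt -> 'M[R]_(p, q)) : L2 w F -> L2 w G ->
  `|ip w F G| <= l2norm w F * l2norm w G.
Proof.
move=> hF hG; pose X := sub_space (subspace_L2 mw p q).
have ps : psd_form (fun u v : X => ip w (val u) (val v)).
  apply: psd_ip_gen => //; first exact: sub_spaceP.
  by move=> k u v; apply: aeW => x _; rewrite val_sub_lin.
exact: (psd_CS ps (to_sub_space _ hF) (to_sub_space _ hG)).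
Qed.

Lemma l2norm_sq p q (F : pt -> 'M[R]_(p, q)) : l2norm w F ^+ 2 = ip w F F.
Proof. by rewrite sqr_sqrtr// ip_ge0. Qed.

End L2_inequalities.

(** * Global interpolation estimates *)

Section interpolation.
Variables (R : realType) (d m : nat) (Om GD : set 'rV[R]_d).
Local Notation pt := 'rV[R]_d.
Hypotheses (d_gt0 : (0 < d)%N) (oOm : open Om) (rOm : (closure Om)° = Om).
Variables (Mh MH : nat) (Th : mesh R d Mh) (TH : mesh R d MH).
Hypotheses (triTh : triangulation Om Th) (triTH : triangulation Om TH).
Hypothesis rf : refines Th TH.
Variables (gam q CI : R).
Hypotheses (gam_gt0 : 0 < gam) (q_gt0 : 0 < q).
Hypotheses (srT : shape_regular gam TH) (quT : quasi_uniform q TH).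
Let H := mesh_size TH.
Hypothesis H_gt0 : 0 < H.
Local Notation Vh := (@fe_space R d m Om GD Mh Th).
Local Notation VH := (@fe_space R d m Om GD MH TH).
Variable I : (pt -> 'rV[R]_m) -> pt -> 'rV[R]_m.
Hypothesis qI : quasi_interpolation CI Vh VH TH I.
Let N : R := (patch_bound d gam q)%:R.
Let mO : measurable Om. Proof. exact: open_measurable_rV. Qed.

Let local_arith (dm h x y z : R) : 0 < dm -> dm <= h -> 0 <= x -> 0 <= y -> 0 <= z ->
  dm^-1 * x + y <= CI * z -> x ^+ 2 <= (CI * h) ^+ 2 * z ^+ 2 /\ y ^+ 2 <= CI ^+ 2 * z ^+ 2.
Proof.
move=> dm0 dh x0 y0 z0 est; have dx0 : 0 <= dm^-1 * x by rewrite mulr_ge0// invr_ge0 ltW.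
have sq (a b : R) : 0 <= a -> a <= b -> a ^+ 2 <= b ^+ 2.
  by move=> a0 ab; rewrite !expr2; exact: ler_pM.
split; rewrite -exprMn; apply: sq => //; last by lra.
have le1 : dm^-1 * x <= CI * z by lra.
rewrite -[leLHS](mulVKf (negbT (gt_eqF dm0))) [CI * h]mulrC -mulrA.
by apply: ler_pM => //; exact: ltW.
Qed.

Let local_est i v : Vh v ->
  ip (omega TH 0 i) (v - I v) (v - I v) <= (CI * H) ^+ 2 * ip (omega TH 1 i) (grad v) (grad v)
  /\ ip (omega TH 0 i) (grad (I v)) (grad (I v)) <= CI ^+ 2 * ip (omega TH 1 i) (grad v) (grad v).
Proof.
move=> hv; have [_ _ _ _ /(_ i v hv)] := qI.
rewrite -!l2norm_sq; apply: local_arith; try exact: sqrtr_ge0.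
  by apply: diam_gt0 => //; case: triTH.
exact: diam_le_mesh_size.
Qed.

Lemma interp_fe v : Vh v -> Vh (I v).
Proof. by move=> hv; have [h _ _ _ _] := qI; apply: (fe_refine rf); exact: h. Qed.

Lemma sub_interp_fe v : Vh v -> Vh (v - I v).
Proof.
move=> hv; have sV : subspace Vh := subspace_fe m GD d_gt0 oOm triTh.
exact: (subspaceB sV hv (interp_fe hv)).
Qed.

Let sum_grad v : Vh v ->
  \sum_i ip (omega TH 1 i) (grad v) (grad v) <= N * ip Om (grad v) (grad v).
Proof.
move=> hv; apply: (sum_patches d_gt0 oOm rOm triTH gam_gt0 q_gt0 srT quT H_gt0).
  by apply: rint_frob => //; exact: fe_grad_L2 hv.
by move=> x; exact: frob_sq_ge0.
Qed.

(** The element estimates are summed; finite overlap bounds the sum of the patch integrals by [N]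
    times the integral over the domain. *)
Lemma interp_error v : Vh v ->
  ip Om (v - I v) (v - I v) <= (CI * H) ^+ 2 * (N * ip Om (grad v) (grad v)).
Proof.
move=> hv; have h := fe_L2 (sub_interp_fe hv).
rewrite -[leLHS](Rintegral_elements d_gt0 oOm rOm triTH (rint_frob mO h h)).
apply: (@le_trans _ _ (\sum_i (CI * H) ^+ 2 * ip (omega TH 1 i) (grad v) (grad v))).
  by apply: ler_sum => i _; exact: (proj1 (local_est i hv)).
rewrite -mulr_sumr; apply: ler_wpM2l; [exact: sqr_ge0|exact: sum_grad].
Qed.

Lemma interp_grad v : Vh v ->
  ip Om (grad (I v)) (grad (I v)) <= CI ^+ 2 * (N * ip Om (grad v) (grad v)).
Proof.
move=> hv; have h := fe_grad_L2 (interp_fe hv).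
rewrite -[leLHS](Rintegral_elements d_gt0 oOm rOm triTH (rint_frob mO h h)).
apply: (@le_trans _ _ (\sum_i CI ^+ 2 * ip (omega TH 1 i) (grad v) (grad v))).
  by apply: ler_sum => i _; exact: (proj2 (local_est i hv)).
rewrite -mulr_sumr; apply: ler_wpM2l; [exact: sqr_ge0|exact: sum_grad].
Qed.

End interpolation.

(** * Energy forms *)

Lemma psd_form_add (R : realType) (X : lmodType R) (a b : X -> X -> R) :
  psd_form a -> psd_form b -> psd_form (fun x y => a x y + b x y).
Proof.
move=> pa pb; split.
- by move=> k x y z; rewrite (psd_linear pa) (psd_linear pb); ring.
- by move=> x y; rewrite (psdC pa) (psdC pb).
- by move=> x; apply: addr_ge0; [exact: psd_ge0 pa x|exact: psd_ge0 pb x].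
Qed.

(** What elasticity and heat conduction have in common, so that correctors are treated once.
    Symmetry and bounds hold almost everywhere, as the coefficients permit no more. *)
Record energy_density (R : realType) d (w : set 'rV[R]_d) p q (C : R)
    (beta : 'rV[R]_d -> 'M[R]_(p, q) -> 'M[R]_(p, q) -> R) : Prop := EnergyDensity {
  density_linear : forall x k A B D, beta x (k *: A + B) D = k * beta x A D + beta x B D;
  density_measurable : forall w', measurable w' -> w' `<=` w -> forall F G,
    measurable_field w' F -> measurable_field w' G ->
    measurable_fun w' (fun x => beta x (F x) (G x));
  density_sym : {ae lebesgue_rV R d, forall x, w x -> forall A B, beta x A B = beta x B A};
  density_ge0 : {ae lebesgue_rV R d, forall x, w x -> forall A, 0 <= beta x A A};
  density_le : {ae lebesgue_rV R d, forall x, w x -> forall A, beta x A A <= C * frob A A} }.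

Section coefficient_forms.
Variables (R : realType) (d : nat) (Om : set 'rV[R]_d) (c : coefficients R d).
Local Notation pt := 'rV[R]_d.
Hypothesis oOm : open Om.
Variables (ka1 ka2 mu1 mu2 la1 la2 al1 al2 : R).
Hypotheses (ka1_gt0 : 0 < ka1) (mu1_gt0 : 0 < mu1) (la1_gt0 : 0 < la1).
Hypothesis cb : coefficient_bounds Om c ka1 ka2 mu1 mu2 la1 la2 al1 al2.
Let mO : measurable Om. Proof. exact: open_measurable_rV. Qed.

Lemma frob_strain_trace (A : 'M[R]_d) a : frob a%:M (strain A) = a * \tr A.
Proof.
rewrite /frob /mxtrace mulr_sumr; apply: eq_bigr => i _.
rewrite (bigD1 i)//= !mxE eqxx mulr1n big1 ?addr0.
  by field.
by move=> j ji; rewrite !mxE eq_sym (negbTE ji) mulr0n mul0r.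
Qed.

Lemma frob_stress x (A B : 'M[R]_d) : frob (stress c x A) (strain B) =
  2 * lame_mu c x * frob (strain A) (strain B) + lame_la c x * \tr A * \tr B.
Proof. by rewrite /stress frob_linear frob_strain_trace. Qed.

Lemma strain_linear k (A B : 'M[R]_d) : strain (k *: A + B) = k *: strain A + strain B.
Proof.
rewrite /strain; apply/matrixP => i j; rewrite !mxE; ring.
Qed.

Lemma frob_trmx p q (A : 'M[R]_(p, q)) : frob A^T A^T = frob A A.
Proof.
rewrite /frob exchange_big; apply: eq_bigr => i _; apply: eq_bigr => j _.
by rewrite !mxE.
Qed.

Lemma frob_strain_le (A : 'M[R]_d) : frob (strain A) (strain A) <= frob A A.
Proof.
have pf := psd_frob R d d.
rewrite /strain !(psdE pf) frob_trmx.
have := psd_ge0 pf (A - A^T); rewrite !(psdE pf) frob_trmx (psdC pf A^T A); lra.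
Qed.

(** Cauchy-Schwarz against the identity matrix, whose squared norm is [d]. *)
Lemma mxtrace_sq_le (A : 'M[R]_d) : \tr A ^+ 2 <= d%:R * frob A A.
Proof.
have trE (B : 'M[R]_d) : \tr B = frob (1%:M) B.
  rewrite /frob /mxtrace; apply: eq_bigr => i _; rewrite (bigD1 i)//= mxE eqxx mul1r.
  by rewrite big1 ?addr0// => j ji; rewrite mxE eq_sym (negbTE ji) mul0r.
rewrite trE; apply: le_trans (psd_CS2 (psd_frob R d d) _ _) _.
by rewrite -trE mxtrace1.
Qed.

Lemma frob_mulmx p (M : 'M[R]_p) q (A B : 'M[R]_(p, q)) : frob (M *m A) B = frob A (M^T *m B).
Proof.
rewrite /frob.
transitivity (\sum_i \sum_j \sum_l M i l * A l j * B i j).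
  by apply: eq_bigr => i _; apply: eq_bigr => j _; rewrite mxE mulr_suml.
transitivity (\sum_l \sum_j \sum_i M i l * A l j * B i j).
  rewrite exchange_big/= [RHS]exchange_big/=; apply: eq_bigr => j _.
  by rewrite exchange_big.
apply: eq_bigr => l _; apply: eq_bigr => j _; rewrite mxE mulr_sumr.
by apply: eq_bigr => i _; rewrite mxE; ring.
Qed.

Let Ce := 2 * mu2 + la2 * d%:R.

Lemma elastic_density :
  energy_density Om Ce (fun x (A B : 'M[R]_d) => frob (stress c x A) (strain B)).
Proof.
have [mka mmu mla mal hae] := cb; split.
- move=> x k A B D.
  rewrite !frob_stress strain_linear frob_linear linearD linearZ /=; ring.
- move=> w mw wO F G mF mG.
  have {}mmu : measurable_fun w (lame_mu c) by exact: measurable_funS mmu.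
  have {}mla : measurable_fun w (lame_la c) by exact: measurable_funS mla.
  apply: (@eq_measurable_fun _ _ _ _ _ (fun x : pt =>
    2 * lame_mu c x * frob (strain (F x)) (strain (G x))
    + lame_la c x * \tr (F x) * \tr (G x))).
    by move=> x _; rewrite frob_stress.
  have mtr (K : pt -> 'M[R]_d) : measurable_field w K -> measurable_fun w (fun x => \tr (K x)).
    by move=> mK; rewrite /mxtrace; apply: measurable_sum => i; exact: mK.
  have mst (K : pt -> 'M[R]_d) : measurable_field w K -> measurable_field w (fun x => strain (K x)).
    move=> mK i j; apply: (@eq_measurable_fun _ _ _ _ _ (fun x : pt => 2^-1 * (K x i j + K x j i))).
      by move=> x _; rewrite !mxE.
    by apply: measurable_funM => //; apply: measurable_funD; exact: mK.
  apply: measurable_funD; apply: measurable_funM.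
  + exact: measurable_funM.
  + apply: measurable_sum => i; apply: measurable_sum => j.
    by apply: measurable_funM; exact: mst.
  + by apply: measurable_funM => //; exact: mtr.
  + exact: mtr.
- by apply: aeW => x _ A B; rewrite !frob_stress (frobC (strain A)); ring.
- apply: filterS hae => x /[apply] -[_ _ /andP[m1 _] /andP[l1 _] _] A.
  have m0 : 0 <= lame_mu c x by move: mu1_gt0; lra.
  have l0 : 0 <= lame_la c x by move: la1_gt0; lra.
  rewrite frob_stress -(mulrA (lame_la c x)) -expr2; apply: addr_ge0.
    by apply: mulr_ge0; [exact: mulr_ge0|exact: frob_sq_ge0].
  by apply: mulr_ge0 => //; exact: sqr_ge0.
- apply: filterS hae => x /[apply] -[_ _ /andP[m1 m2] /andP[l1 l2] _] A.
  have m0 : 0 <= lame_mu c x by move: mu1_gt0; lra.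
  have l0 : 0 <= lame_la c x by move: la1_gt0; lra.
  rewrite frob_stress -(mulrA (lame_la c x)) -expr2 /Ce (mulrDl (2 * mu2) (la2 * d%:R)); apply: lerD.
    apply: ler_pM; [exact: mulr_ge0|exact: frob_sq_ge0| |exact: frob_strain_le].
    by rewrite ler_pM2l.
  rewrite -mulrA; apply: ler_pM => //; [exact: sqr_ge0|exact: mxtrace_sq_le].
Qed.

Lemma heat_density :
  energy_density Om ka2 (fun x (A B : 'M[R]_(d, 1)) => frob (kappa c x *m A) B).
Proof.
have [mka mmu mla mal hae] := cb; split.
- by move=> x k A B D; rewrite mulmxDr -scalemxAr frob_linear.
- move=> w mw wO F G mF mG; rewrite /frob; apply: measurable_sum => i; apply: measurable_sum => j.
  apply: measurable_funM; last exact: mG.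
  apply: (@eq_measurable_fun _ _ _ _ _ (fun x : pt => \sum_l kappa c x i l * F x l j)).
    by move=> x _; rewrite mxE.
  by apply: measurable_sum => l; apply: measurable_funM; [exact: measurable_funS (mka i l)|exact: mF].
- apply: filterS hae => x /[apply] -[sk _ _ _ _] A B.
  by rewrite frob_mulmx sk frobC.
- apply: filterS hae => x /[apply] -[_ hk _ _ _] A.
  have /andP[h _] := hk A; apply: le_trans h.
  by apply: mulr_ge0; [exact: ltW|exact: sqr_ge0].
- apply: filterS hae => x /[apply] -[_ hk _ _ _] A.
  by have /andP[_] := hk A; rewrite sqr_sqrtr// frob_sq_ge0.
Qed.

End coefficient_forms.

(** * Energies on patches *)

Section energy_forms.
Variables (R : realType) (d m : nat) (Om GD : set 'rV[R]_d).
Local Notation pt := 'rV[R]_d.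
Local Notation fct := (pt -> 'rV[R]_m).
Local Notation leb := (lebesgue_rV R d).
Hypotheses (d_gt0 : (0 < d)%N) (oOm : open Om) (rOm : (closure Om)° = Om).
Variables (Mh : nat) (Th : mesh R d Mh).
Hypothesis triTh : triangulation Om Th.
Variables (C : R) (beta : pt -> 'M[R]_(d, m) -> 'M[R]_(d, m) -> R).
Hypothesis eb : energy_density Om C beta.
Local Notation V := (@fe_space R d m Om GD Mh Th).
Let mO : measurable Om. Proof. exact: open_measurable_rV. Qed.

Definition energy_form (w : set pt) (u v : fct) : R :=
  \int[leb]_(x in w) beta x (grad u x) (grad v x).

(** Positivity at [A + B] and [A - B] reduces the mixed bound to the diagonal one. *)
Lemma density_abs_le : {ae leb, forall x, Om x -> forall A B,
  `|beta x A B| <= C * (frob A A + frob B B)}.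
Proof.
move: (density_sym eb) (density_ge0 eb) (density_le eb).
apply: filterS3 => x s0 p0 u0 Ox A B; move: (s0 Ox) (p0 Ox) (u0 Ox) => s p0' u.
have ps : psd_form (beta x) by split => //; exact: density_linear eb x.
have := p0' (A - B); have := p0' (A + B); have := u A; have := u B.
have := p0' A; have := p0' B.
rewrite !(psdE ps) (s B A) ler_norml; lra.
Qed.

Lemma fe_grad_L2_sub w v : measurable w -> w `<=` Om -> V v -> L2 w (grad v).
Proof. by move=> mw wO hv; exact: (L2_sub mO mw wO (fe_grad_L2 hv)). Qed.

Lemma rint_energy w u v : measurable w -> w `<=` Om -> V u -> V v ->
  leb.-integrable w (EFin \o (fun x => beta x (grad u x) (grad v x))).
Proof.
move=> mw wO hu hv; apply: (@rint_density _ _ w mw _ _ _ _ beta _ C).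
- by move=> F G mF mG; exact: (density_measurable eb).
- by apply: filterS density_abs_le => x h wx; apply: h; exact: wO.
- exact: fe_grad_L2_sub.
- exact: fe_grad_L2_sub.
Qed.

Lemma psd_energy_form w : measurable w -> w `<=` Om ->
  psd_form (fun u v : sub_space (subspace_fe m GD d_gt0 oOm triTh) =>
    energy_form w (val u) (val v)).
Proof.
move=> mw wO.
apply: (@psd_density _ _ w mw _ _ beta C _ (fun u => grad (val u))).
- exact: density_linear eb.
- by move=> F G mF mG; exact: (density_measurable eb).
- by apply: filterS density_abs_le => x h wx; apply: h; exact: wO.
- by apply: filterS (density_sym eb) => x h wx; apply: h; exact: wO.
- by apply: filterS (density_ge0 eb) => x h wx; apply: h; exact: wO.
- by move=> u; apply: fe_grad_L2_sub => //; exact: sub_spaceP.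
- move=> k u v; have := fe_grad_lin d_gt0 triTh k (sub_spaceP u) (sub_spaceP v).
  by apply: filterS => x h wx; rewrite val_sub_lin; apply: h; exact: wO.
Qed.

Lemma psd_h1_form : psd_form (fun u v : sub_space (subspace_fe m GD d_gt0 oOm triTh) =>
  ip Om (val u) (val v) + ip Om (grad (val u)) (grad (val v))).
Proof.
have p1 : psd_form (fun u v : sub_space (subspace_fe m GD d_gt0 oOm triTh) =>
    ip Om (val u) (val v)).
  apply: psd_ip_gen => //.
  - by move=> u; apply: fe_L2; exact: sub_spaceP.
  - by move=> k u v; apply: aeW => x _; rewrite val_sub_lin.
have p2 : psd_form (fun u v : sub_space (subspace_fe m GD d_gt0 oOm triTh) =>
    ip Om (grad (val u)) (grad (val v))).
  apply: psd_ip_gen => //.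
  - by move=> u; apply: fe_grad_L2; exact: sub_spaceP.
  - move=> k u v; have := fe_grad_lin d_gt0 triTh k (sub_spaceP u) (sub_spaceP v).
    by apply: filterS => x h wx; rewrite val_sub_lin; exact: h.
exact: psd_form_add p1 p2.
Qed.

Lemma h1norm_sq (v : fct) : h1norm Om v ^+ 2 = ip Om v v + ip Om (grad v) (grad v).
Proof.
rewrite /h1norm /H1norm sqr_sqrtr; last by apply: addr_ge0; exact: sqr_ge0.
by rewrite !l2norm_sq.
Qed.

Lemma energy_form_le_sub w u : measurable w -> w `<=` Om -> V u ->
  energy_form w u u <= energy_form Om u u.
Proof.
move=> mw wO hu; have ri := rint_energy mO (@subset_refl _ Om) hu hu.
rewrite /energy_form (Rintegral_indic_sub _ _ wO).
apply: ae_le_Rintegral => //; first exact: rint_indic.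
apply: filterS (density_ge0 eb) => x h Ox; rewrite indicE.
by case: (x \in w); rewrite ?mulr1// mulr0 h.
Qed.

Variables (MH : nat) (TH : mesh R d MH).
Hypothesis triTH : triangulation Om TH.

Lemma energy_form_elements u v : V u -> V v ->
  \sum_i energy_form (omega TH 0 i) u v = energy_form Om u v.
Proof.
by move=> hu hv; apply: (Rintegral_elements d_gt0 oOm rOm triTH); exact: rint_energy.
Qed.

(** Up to faces a patch is a union of elements: membership of interior points depends on the element
    only. *)
Lemma omega_interior k i j x y : (simplex (TH j))° x -> (simplex (TH j))° y ->
  omega TH k i x -> omega TH k i y.
Proof.
case: k => [|k] jx jy /=.
  have [->//|ij] := eqVneq i j.
  move=> /interior_subset ix; case: (interior_simplex_disj triTH _ jx ix).
  by rewrite eq_sym.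
set U := bigcup _ _ => /interior_subset[l Sl lx].
have lj : l = j.
  apply/eqP/contraT => lj; case: (interior_simplex_disj triTH _ jx lx).
  by rewrite eq_sym.
have : (simplex (TH j))° `<=` U° .
  by apply: interiorS => z jz; exists j => //; rewrite -lj.
exact.
Qed.

Lemma omega_sub k i : omega TH k i `<=` Om.
Proof.
rewrite -rOm; case: k => [|k] /=; apply: interiorS; first exact: simplex_closure.
by move=> x [j _]; exact: simplex_closure.
Qed.

(** By [omega_interior], almost every point off the patch lies in an open element on which [z]
    vanishes identically. *)
Lemma grad_outside k i (z : fct) : (forall x, Om x -> ~ omega TH k i x -> z x = 0) ->
  {ae leb, forall x, Om x -> ~ omega TH k i x -> grad z x = 0}.
Proof.
move=> z0; have := ae_in_interior d_gt0 triTH; apply: filterS => x /[apply] -[j jx] nx.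
have zn y : (simplex (TH j))° y -> z y = 0.
  move=> jy; apply: z0; first exact: (interior_simplex_sub rOm triTH jy).
  by move=> oy; apply: nx; exact: (omega_interior jy jx oy).
have dE : 'd z x = (fun y => y *m (0 : 'M[R]_(d, m))) :> (pt -> 'rV[R]_m).
  apply: diff_locally_affine; rewrite (zn _ jx); near=> y.
  rewrite mulmx0 addr0; apply: zn; near: y.
  by apply: open_nbhs_nbhs; split => //; exact: open_interior.
have -> : grad z x = lin1_mx (fun y => y *m (0 : 'M[R]_(d, m))).
  exact: (congr1 (@lin1_mx R d m) dE).
by apply/row_matrixP => l; rewrite !rowE (mul_rV_lin1 (mulmxr (0 : 'M[R]_(d, m)))) /= !mulmx0.
Unshelve. all: end_near. Qed.

(** Turns the local problem into one on the whole domain, where coercivity is available. *)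
Lemma energy_form_patch k i u z : V u -> V z ->
  (forall x, Om x -> ~ omega TH k i x -> z x = 0) ->
  energy_form (omega TH k i) u z = energy_form Om u z.
Proof.
move=> hu hz z0; have mk := measurable_omega TH k i.
rewrite /energy_form (Rintegral_indic_sub _ _ (@omega_sub k i)).
have ri := rint_energy mO (@subset_refl _ Om) hu hz.
apply: ae_eq_Rintegral => //.
- by apply: (@measurable_rint _ _ _ leb); exact: rint_indic.
- by apply: (@measurable_rint _ _ _ leb).
have := grad_outside z0; have := density_sym eb; apply: filterS2 => x sx h Ox.
rewrite indicE; have [_|/negP] := boolP (x \in omega TH k i); first by rewrite mulr1.
rewrite inE => nx.
rewrite h// mulr0 sx//; have := density_linear eb x 1 0 0 (grad u x).
rewrite scale1r addr0; lra.
Qed.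

End energy_forms.

(** * Definiteness on finite element functions *)

Section positive_measure.
Variable R : realType.

Lemma lebesgue_box_gt0 n (c : 'rV[R]_n) (r : R) : 0 < r ->
  (0 < lebesgue_rV R n [set x : 'rV[R]_n | forall i, `|c ord0 i - x ord0 i| <= r]%R)%E.
Proof.
move=> r0; elim: n => [|n IH] in c *.
  rewrite /= diracE mem_set ?lte01// => i; by case: i.
rewrite /= /lebesgue_rV_step /pushforward.
pose c' : 'rV[R]_n := \row_j c ord0 (lift ord0 j).
have itvE (a : R) : [set t | `|a - t| <= r] = `[a - r, a + r]%classic.
  by apply/seteqP; split => t /=; rewrite in_itv /= ler_distlC.
have mn : measurable [set x : 'rV[R]_n | forall i, `|c' ord0 i - x ord0 i| <= r].
  apply: (measurable_coord_box (I := fun i => [set t | `|c' ord0 i - t| <= r])) => i.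
  by rewrite itvE; exact: measurable_itv.
rewrite (_ : _ @^-1` _ = (`[c ord0 ord0 - r, c ord0 ord0 + r]%classic : set (measurableTypeR R)) `*`
    [set x : 'rV[R]_n | forall i, `|c' ord0 i - x ord0 i| <= r]).
  have itv0 : (0 < @lebesgue_measure R `[(c ord0 ord0 - r)%R, (c ord0 ord0 + r)%R]%classic)%E.
    rewrite lebesgue_measure_itv /= ifT; last by rewrite lte_fin; lra.
    by rewrite -EFinD lte_fin; lra.
  by rewrite product_measure1E//; exact: mule_gt0.
rewrite -itvE; apply/seteqP; split => -[t x] /=.
  move=> h; split; first by have := h ord0; rewrite rV_cons0.
  by move=> i; have := h (lift ord0 i); rewrite rV_consS mxE.
move=> -[h1 h2] i.
by have [j ->|->] := unliftP ord0 i; [have := h2 j; rewrite rV_consS mxE|rewrite rV_cons0].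
Qed.

Lemma open_lebesgue_gt0 n (U : set 'rV[R]_n) : open U -> U !=set0 ->
  (0 < lebesgue_rV R n U)%E.
Proof.
move=> oU [x Ux]; have /nbhs_ballP[e /= e0 eU] : nbhs x U by apply: open_nbhs_nbhs.
apply: (lt_le_trans (lebesgue_box_gt0 x (divr_gt0 e0 (ltr0n R 2)))).
apply: le_measure; rewrite ?inE.
- apply: (measurable_coord_box (I := fun i => [set t | `|x ord0 i - t| <= e / 2])) => i.
  rewrite (_ : [set t | _] = `[x ord0 i - e / 2, x ord0 i + e / 2]%classic); first exact: measurable_itv.
  by apply/seteqP; split => t /=; rewrite in_itv /= ler_distlC.
- exact: open_measurable_rV.
- move=> y h; apply: eU; apply/rV_ballP; split => // i.
  by have := h i; rewrite /ball /=; move: e0; lra.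
Qed.

End positive_measure.

Section definiteness.
Variables (R : realType) (d m : nat) (Om GD : set 'rV[R]_d).
Local Notation pt := 'rV[R]_d.
Local Notation leb := (lebesgue_rV R d).
Hypotheses (oOm : open Om).
Variables (M : nat) (T : mesh R d M).
Let mO : measurable Om. Proof. exact: open_measurable_rV. Qed.

Lemma ip_eq0_ae p q (F : pt -> 'M[R]_(p, q)) : L2 Om F -> ip Om F F = 0 ->
  {ae leb, forall x, Om x -> F x = 0}.
Proof.
move=> hF; have ri := rint_frob mO hF hF.
rewrite /ip /Rintegral => /eqP; rewrite fine_eq0 ?integrable_fin_num// => /eqP h.
have : ae_eq leb Om (fun x => (frob (F x) (F x))%:E) (cst 0%E).
  apply/(ae_eq_integral_abs leb mO); first by case/integrableP: ri.
  by rewrite -[RHS]h; apply: eq_integral => x _ /=; rewrite ger0_norm ?frob_sq_ge0.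
apply: filterS => x + Ox => /(_ Ox) [f0].
apply/matrixP => i j; apply/eqP; rewrite mxE -sqrf_eq0 eq_le sqr_ge0 andbT -f0.
exact: frob_entry.
Qed.

(** By continuity a nonzero value at a point of the closure persists on a nonempty open part of
    [Om], which has positive measure. *)
Lemma fe_definite (v : pt -> 'rV[R]_m) : fe_space Om GD T v -> ip Om v v = 0 -> v = 0.
Proof.
move=> hv /(ip_eq0_ae (fe_L2 hv)) v0; have [cv _ _ ov _] := hv.
apply/funext => x; apply/eqP/contraT => vx.
have clx : closure Om x by apply: contrapT => nx; move: vx; rewrite ov// eqxx.
have /subspace_continuousP/(_ x clx) cvx := cv.
have : nbhs (v x) (~` [set 0]).
  have /existsP[j vj] : [exists j, v x ord0 j != 0].
    apply: contraR vx; rewrite negb_exists => /forallP h.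
    by apply/eqP/rowP => j; rewrite mxE; apply/eqP; have := h j; rewrite negbK.
  apply/nbhs_ballP; exists `|v x ord0 j|; first by rewrite /= normr_gt0.
  move=> w /rV_ballP[_ /(_ j)] + /= w0.
  by rewrite w0 mxE /ball /= subr0 ltxx.
move=> /cvx; rewrite /= nbhs_simpl /= /within /= nbhsE => -[U [oU Ux] hU].
have UO : (Om `&` U) !=set0 by apply: clx; exact: open_nbhs_nbhs.
have oUO : open (Om `&` U) by exact: openI.
have := open_lebesgue_gt0 oUO UO.
have [N [mN N0 hN]] := v0.
suff -> : leb (Om `&` U) = 0%E by rewrite ltxx.
apply/eqP; rewrite eq_le measure_ge0 andbT -N0; apply: le_measure; rewrite ?inE//.
  exact: open_measurable_rV.
move=> y [Oy Uy]; apply: hN => /= /(_ Oy) vy.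
by apply: (hU y Uy) => //; exact: subset_closure.
Qed.

End definiteness.

(** * Correctors and multiscale spaces *)

Lemma decay_sq (R : realType) d (xi : R) k :
  decay d xi k ^+ 2 = k%:R ^+ d * xi ^+ (2 * k).
Proof.
rewrite /decay exprMn -exprM mulnC; congr (_ * _).
by rewrite -[LHS]powR_mulrn ?powR_ge0// -powRrM divfK// powR_mulrn.
Qed.

Lemma le_of_sqr_le (R : realType) (r s v : R) : 0 <= r -> 0 <= v -> r ^+ 2 <= v * s ->
  s <= r -> r <= v.
Proof.
move=> r0 v0 h1 h2; have : r ^+ 2 <= v * r by apply: le_trans h1 _; exact: ler_wpM2l.
have [->//|rn0] := eqVneq r 0; rewrite expr2 ler_pM2r// lt_neqAle eq_sym rn0.
exact: r0.
Qed.

(** * Forms that are bilinear on a subspace only *)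

Section restricted_form.
Variables (R : realType) (E : lmodType R) (P : E -> Prop) (sP : subspace P).
Variable a : E -> E -> R.
Hypothesis pa : psd_form (fun u v : sub_space sP => a (val u) (val v)).

Lemma rform_lin k u v w : P u -> P v -> P w -> a (k *: u + v) w = k * a u w + a v w.
Proof.
move=> hu hv hw.
have := psd_linear pa k (to_sub_space sP hu) (to_sub_space sP hv) (to_sub_space sP hw).
by rewrite val_sub_lin.
Qed.

Lemma rformC u v : P u -> P v -> a u v = a v u.
Proof. by move=> hu hv; exact: (psdC pa (to_sub_space sP hu) (to_sub_space sP hv)). Qed.

Lemma rform_ge0 u : P u -> 0 <= a u u.
Proof. by move=> hu; exact: (psd_ge0 pa (to_sub_space sP hu)). Qed.

Lemma rform_CS2 u v : P u -> P v -> a u v ^+ 2 <= a u u * a v v.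
Proof. by move=> hu hv; exact: (psd_CS2 pa (to_sub_space sP hu) (to_sub_space sP hv)). Qed.

Lemma rform0 w : P w -> a 0 w = 0.
Proof.
by move=> hw; have := rform_lin 1 (subspace0 sP) (subspace0 sP) hw; rewrite scale1r addr0; lra.
Qed.

Lemma rformD u v w : P u -> P v -> P w -> a (u + v) w = a u w + a v w.
Proof. by move=> hu hv hw; have := rform_lin 1 hu hv hw; rewrite scale1r mul1r. Qed.

Lemma rformB u v w : P u -> P v -> P w -> a (u - v) w = a u w - a v w.
Proof.
by move=> hu hv hw; rewrite -scaleN1r addrC rform_lin// mulN1r addrC.
Qed.

Lemma rform_sum (I : finType) (F : I -> E) w : (forall i, P (F i)) -> P w ->
  a (\sum_i F i) w = \sum_i a (F i) w.
Proof.
move=> hF hw; suff [] : P (\sum_i F i) /\ a (\sum_i F i) w = \sum_i a (F i) w by [].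
apply: (big_ind2 (fun u r => P u /\ a u w = r)).
- by split; [exact: subspace0|exact: rform0].
- move=> u r v s [hu <-] [hv <-]; split; [exact: subspaceD|exact: rformD].
- by [].
Qed.

Lemma rform_sqD u v : P u -> P v -> a (u + v) (u + v) <= 2 * a u u + 2 * a v v.
Proof.
move=> hu hv.
have hD : P (u + v) by exact: subspaceD.
have hB : P (u - v) by exact: subspaceB.
have := rform_ge0 hB; rewrite rformB// (rformC hu hB) (rformC hv hB) !rformB//.
rewrite rformD// (rformC hu hD) (rformC hv hD) !rformD// (rformC hv hu); lra.
Qed.

Lemma rform_sqB u v : P u -> P v -> a (u - v) (u - v) <= 2 * a u u + 2 * a v v.
Proof.
move=> hu hv.
have hD : P (u + v) by exact: subspaceD.
have hB : P (u - v) by exact: subspaceB.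
have := rform_ge0 hD.
rewrite (rformD hu hv hD) (rformC hu hD) (rformC hv hD) (rformD hu hv hu) (rformD hu hv hv).
rewrite (rformB hu hv hB) (rformC hu hB) (rformC hv hB) (rformB hu hv hu) (rformB hu hv hv).
rewrite (rformC hv hu); lra.
Qed.

Lemma rform_proj_le u v : P u -> P v -> a u u = a v u -> a u u <= a v v.
Proof.
move=> hu hv e; have hB : P (v - u) by exact: subspaceB.
have := rform_ge0 hB; rewrite rformB// (rformC hu hB) (rformC hv hB) !rformB// (rformC hu hv) e.
lra.
Qed.

End restricted_form.

(** * Almost orthogonality and stability of the multiscale splitting *)

Section correctors.
Variables (R : realType) (d m : nat) (Om GD GN : set 'rV[R]_d).
Local Notation pt := 'rV[R]_d.
Local Notation fct := (pt -> 'rV[R]_m).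
Hypotheses (d_gt0 : (0 < d)%N) (oOm : open Om) (rOm : (closure Om)° = Om).
Hypothesis GNO : forall x, Om x -> ~ GN x.
Variables (Mh MH : nat) (Th : mesh R d Mh) (TH : mesh R d MH).
Hypotheses (triTh : triangulation Om Th) (triTH : triangulation Om TH).
Hypothesis rf : refines Th TH.
Variables (gam q CI : R).
Hypotheses (gam_gt0 : 0 < gam) (q_gt0 : 0 < q) (CI_gt0 : 0 < CI).
Hypotheses (srT : shape_regular gam TH) (quT : quasi_uniform q TH).
Let H := mesh_size TH.
Hypothesis H_gt0 : 0 < H.
Local Notation Vh := (@fe_space R d m Om GD Mh Th).
Local Notation VH := (@fe_space R d m Om GD MH TH).
Variable I : fct -> fct.
Hypothesis qI : quasi_interpolation CI Vh VH TH I.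
Variables (C : R) (beta : pt -> 'M[R]_(d, m) -> 'M[R]_(d, m) -> R).
Hypothesis eb : energy_density Om C beta.
Local Notation E := (energy_form beta).
Variables (c0 C0 : R).
Hypothesis c0_gt0 : 0 < c0.
Hypothesis C0_gt0 : 0 < C0.
Hypothesis coer : forall v, Vh v -> c0 * h1norm Om v ^+ 2 <= E Om v v <= C0 * h1norm Om v ^+ 2.
Variable k : nat.
Let Vf := fine_space Vh I.
Let W i := local_fine_space Om GN Vh I (omega TH k i).
Variables RK RkK : 'I_MH -> fct -> fct.
Hypothesis hRK : element_correctors E Vh TH (fun=> Om) (fun=> Vf) RK.
Hypothesis hRkK : element_correctors E Vh TH (omega TH k) W RkK.
Variables Cloc xi : R.
Hypotheses (Cloc_gt0 : 0 < Cloc) (xi_ge0 : 0 <= xi).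
Hypothesis loc : corrector_localization Om Cloc xi k Vh RkK RK.
Let dec := decay d xi k.
Let N : R := (patch_bound d gam q)%:R.
Let mO : measurable Om. Proof. exact: open_measurable_rV. Qed.
Let sV : subspace Vh := subspace_fe m GD d_gt0 oOm triTh.
Let sVH : subspace VH := subspace_fe m GD d_gt0 oOm triTH.

Let le2_subst (x y z a b c : R) : x = a -> y = b -> z = c -> a <= 2 * b + 2 * c ->
  x <= 2 * y + 2 * z.
Proof. by move=> -> -> ->. Qed.

Let h1norm_sqD u v : Vh u -> Vh v ->
  h1norm Om (u + v) ^+ 2 <= 2 * h1norm Om u ^+ 2 + 2 * h1norm Om v ^+ 2.
Proof.
move=> hu hv; exact: (le2_subst (h1norm_sq Om (u + v)) (h1norm_sq Om u) (h1norm_sq Om v)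
  (@rform_sqD _ _ _ sV (fun u v => ip Om u v + ip Om (grad u) (grad v))
    (psd_h1_form m GD d_gt0 oOm triTh) _ _ hu hv)).
Qed.

Let h1norm_sqB u v : Vh u -> Vh v ->
  h1norm Om (u - v) ^+ 2 <= 2 * h1norm Om u ^+ 2 + 2 * h1norm Om v ^+ 2.
Proof.
move=> hu hv; exact: (le2_subst (h1norm_sq Om (u - v)) (h1norm_sq Om u) (h1norm_sq Om v)
  (@rform_sqB _ _ _ sV (fun u v => ip Om u v + ip Om (grad u) (grad v))
    (psd_h1_form m GD d_gt0 oOm triTh) _ _ hu hv)).
Qed.

Let pE w (mw : measurable w) (wO : w `<=` Om) := psd_energy_form GD d_gt0 oOm triTh eb mw wO.
Let pO := pE mO (@subset_refl _ Om).
Let oS l i : omega TH l i `<=` Om.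
Proof. exact: (omega_sub rOm triTH). Qed.
Let pk i := pE (measurable_omega TH k i) (@oS k i).
Let p0 i := pE (measurable_omega TH 0 i) (@oS 0 i).

Let Ilin a v w : Vh v -> Vh w -> I (a *: v + w) = a *: I v + I w.
Proof. by case: qI => _ h _ _ _; exact: h. Qed.

Let I0 : I 0 = 0.
Proof.
have := Ilin 1 (subspace0 sV) (subspace0 sV); rewrite !scale1r addr0 => h.
by apply: (@addrI _ (I 0)); rewrite -h addr0.
Qed.

Lemma subspace_fine : subspace (fine_space Vh I).
Proof.
split; first by split; [exact: (subspace0 sV)|exact: I0].
move=> a v w [hv iv] [hw iw]; split; first exact: (proj2 sV).
by rewrite Ilin// iv iw scaler0 addr0.
Qed.

Lemma subspace_local_fine i : subspace (W i).
Proof.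
split; first by split; [exact: (subspace0 subspace_fine)|].
move=> a v w [hv zv] [hw zw]; split; first exact: (proj2 subspace_fine).
move=> x Gx ox; rewrite (_ : (a *: v + w) x = a *: v x + w x)//.
by rewrite zv// zw// scaler0 addr0.
Qed.

Let W_V i z : W i z -> Vh z. Proof. by case=> -[]. Qed.
Let W_f i z : W i z -> Vf z. Proof. by case. Qed.
Let W_out i z : W i z -> forall x, Om x -> ~ omega TH k i x -> z x = 0.
Proof.
move=> [_ h] x Ox; apply: h; split; first exact: subset_closure.
exact: GNO.
Qed.

(** Tested with itself, [z] has zero energy on the patch, hence on the whole domain, and coercivity
    with [fe_definite] concludes. *)
Lemma local_fine_definite i z : W i z ->
  (forall z', W i z' -> E (omega TH k i) z z' = 0) -> z = 0.
Proof.
move=> hz /(_ z hz); rewrite (energy_form_patch d_gt0 oOm rOm eb triTH (W_V hz) (W_V hz) (W_out hz)).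
move=> e0; apply: (fe_definite oOm (W_V hz)).
have /andP[h _] := coer (W_V hz).
have : h1norm Om z ^+ 2 <= 0 by rewrite -(pmulr_rle0 _ c0_gt0) -e0.
rewrite h1norm_sq; have := ip_ge0 Om z; have := ip_ge0 Om (grad z); lra.
Qed.

(** The correctors are given only as solutions; both sides solve the same local problem, whose
    solution is unique. *)
Lemma local_corrector_lin i a v w : Vh v -> Vh w ->
  RkK i (a *: v + w) = a *: RkK i v + RkK i w.
Proof.
move=> hv hw; have hvw : Vh (a *: v + w) by exact: (proj2 sV).
have [w1 e1] := hRkK i hvw; have [w2 e2] := hRkK i hv; have [w3 e3] := hRkK i hw.
have sW := subspace_local_fine i.
have w4 : W i (a *: RkK i v + RkK i w) by exact: (proj2 sW).
apply/eqP; rewrite -subr_eq0; apply/eqP; apply: local_fine_definite.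
  exact: (subspaceB sW).
move=> z hz; have hz' := W_V hz.
rewrite (rformB (pk i) (W_V w1) (W_V w4) hz').
rewrite (rform_lin (pk i) a (W_V w2) (W_V w3) hz') e1// e2// e3//.
by rewrite (rform_lin (p0 i) a hv hw hz') subrr.
Qed.

Lemma corrector_lin a v w : Vh v -> Vh w ->
  corrector RkK (a *: v + w) = a *: corrector RkK v + corrector RkK w.
Proof.
move=> hv hw; rewrite /corrector scaler_sumr -big_split /=.
by apply: eq_bigr => i _; exact: local_corrector_lin.
Qed.

Lemma coarse_fe v : VH v -> Vh v. Proof. exact: fe_refine. Qed.

Lemma subspace_ms : subspace (ms_space VH (corrector RkK)).
Proof.
have V0 := subspace0 sV.
split.
  exists 0; first exact: (subspace0 sVH).
  have := corrector_lin 1 V0 V0; rewrite !scale1r addr0 => h.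
  have -> : corrector RkK 0 = 0 by apply: (@addrI _ (corrector RkK 0)); rewrite -h addr0.
  by rewrite subr0.
move=> a u v [u' hu' ->] [v' hv' ->]; exists (a *: u' + v'); first exact: (proj2 sVH).
rewrite corrector_lin; try exact: coarse_fe.
by rewrite scalerBr opprD addrACA.
Qed.

Lemma local_corrector_fine v : Vh v -> Vf (corrector RkK v).
Proof.
move=> hv; apply: (subspace_sum subspace_fine) => i.
by apply: (@W_f i); case: (hRkK i hv).
Qed.

Lemma corrector_fine v : Vh v -> Vf (corrector RK v).
Proof. by move=> hv; apply: (subspace_sum subspace_fine) => i; case: (hRK i hv). Qed.

Let Vf_V z : Vf z -> Vh z. Proof. by case. Qed.

Lemma ms_fe v : ms_space VH (corrector RkK) v -> Vh v.
Proof.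
move=> [w hw ->]; apply: (subspaceB sV); first exact: coarse_fe.
by apply: Vf_V; apply: local_corrector_fine; exact: coarse_fe.
Qed.

(** [I] annihilates the second part because it is a projection and the corrector takes fine values.
    The explicit formulas are kept for the norm bounds. *)
Lemma ms_decomposition v : Vh v -> exists vB vG,
  [/\ ms_space VH (corrector RkK) vB, Vf vG, v = vB + vG,
      vB = I v - corrector RkK (I v) & vG = v - I v + corrector RkK (I v)].
Proof.
move=> hv; have hI : VH (I v) by case: qI => h _ _ _ _; exact: h.
have hIV := coarse_fe hI.
exists (I v - corrector RkK (I v)), (v - I v + corrector RkK (I v)); split.
- by exists (I v).
- apply: (subspaceD subspace_fine); last exact: local_corrector_fine hIV.
  split; first exact: (subspaceB sV hv hIV).
  rewrite -scaleN1r addrC (Ilin _ hIV hv).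
  by case: qI => _ _ /(_ v hv) -> _ _; rewrite scaleN1r addNr.
- by rewrite addrACA addNr addr0 addrC subrK.
- exact: erefl.
- exact: erefl.
Qed.

(** Testing the problem of an element with its solution and Cauchy-Schwarz on that element bound the
    energy of the solution by that of [v] on the element; these add up. *)
Lemma element_corrector_energy v : Vh v ->
  \sum_i E Om (RK i v) (RK i v) <= E Om v v.
Proof.
move=> hv; rewrite -(energy_form_elements d_gt0 oOm rOm eb triTH hv hv).
apply: ler_sum => i _; have [hr /(_ _ hr) e] := hRK i hv; have hr' := Vf_V hr.
apply: (@le_of_sqr_le _ _ (E (omega TH 0 i) (RK i v) (RK i v))).
- exact: (rform_ge0 pO hr').
- exact: (rform_ge0 (p0 i) hv).
- by rewrite e; exact: (rform_CS2 (p0 i) hv hr').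
- exact: (energy_form_le_sub oOm eb (measurable_omega TH 0 i) (@oS 0%N i) hr').
Qed.

(** Summing the element problems recovers the global form: without localization the corrector is the
    energy projection onto the fine space. *)
Lemma corrector_energy v z : Vh v -> Vf z -> E Om (corrector RK v) z = E Om v z.
Proof.
move=> hv hz; rewrite (rform_sum pO) => [||]; last exact: Vf_V.
  rewrite -(energy_form_elements d_gt0 oOm rOm eb triTH hv (Vf_V hz)).
  by apply: eq_bigr => i _; have [_ ->] := hRK i hv.
by move=> i; apply: Vf_V; case: (hRK i hv).
Qed.

Let CL := Cloc * (C0 / c0).

Lemma corrector_error v : Vh v ->
  h1norm Om (corrector RkK v - corrector RK v) ^+ 2 <= CL * dec ^+ 2 * h1norm Om v ^+ 2.
Proof.
move=> hv; apply: le_trans (loc hv) _; rewrite -(mulrA Cloc) -decay_sq -/dec.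
have le : c0 * \sum_i h1norm Om (RK i v) ^+ 2 <= C0 * h1norm Om v ^+ 2.
  have /andP[_ h] := coer hv; apply: le_trans h.
  apply: le_trans (element_corrector_energy hv).
  rewrite mulr_sumr; apply: ler_sum => i _.
  have [hr _] := hRK i hv; by have /andP[] := coer (Vf_V hr).
have -> : CL * dec ^+ 2 * h1norm Om v ^+ 2 =
    Cloc * dec ^+ 2 * (C0 * h1norm Om v ^+ 2 / c0) by rewrite /CL; ring.
apply: ler_wpM2l; first by apply: mulr_ge0; [exact: ltW|exact: sqr_ge0].
by rewrite ler_pdivlMr// mulrC.
Qed.

Lemma corrector_stable v : Vh v ->
  h1norm Om (corrector RK v) ^+ 2 <= C0 / c0 * h1norm Om v ^+ 2.
Proof.
move=> hv; have hr := corrector_fine hv; have hr' := Vf_V hr.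
have h1 : E Om (corrector RK v) (corrector RK v) <= E Om v v.
  exact: (rform_proj_le pO hr' hv (corrector_energy hv hr)).
have /andP[l1 _] := coer hr'; have /andP[_ l2] := coer hv.
rewrite mulrAC ler_pdivlMr// mulrC; exact: le_trans l1 (le_trans h1 l2).
Qed.

Variable Hb : R.
Hypotheses (H_Hb : H <= Hb) (dec_H : dec <= H).
(** Stability constant of [I] in squared norm. An upper bound [Hb] takes the place of [H], so that
    the constant does not depend on the mesh. *)
Definition interp_const : R := 2 + (2 * (CI * Hb) ^+ 2 + CI ^+ 2) * N.

Let dec_ge0 : 0 <= dec.
Proof. by apply: mulr_ge0; [exact: powR_ge0|exact: exprn_ge0]. Qed.

Let CIs := interp_const.

Let sqr_le (x y : R) : 0 <= x -> x <= y -> x ^+ 2 <= y ^+ 2.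
Proof. by move=> x0 xy; rewrite !expr2; exact: ler_pM. Qed.

Let interp_const_ge0 : 0 <= CIs.
Proof.
have N0 : 0 <= N by exact: ler0n.
by apply: addr_ge0 => //; apply: mulr_ge0 => //; apply: addr_ge0; rewrite ?sqr_ge0// mulr_ge0// sqr_ge0.
Qed.

Lemma fine_L2_le w : Vf w ->
  ip Om w w <= CI ^+ 2 * N * H ^+ 2 * ip Om (grad w) (grad w).
Proof.
move=> [hw iw].
have := interp_error d_gt0 oOm rOm triTh triTH rf gam_gt0 q_gt0 srT quT H_gt0 qI hw.
by rewrite iw subr0 exprMn => /le_trans; apply; rewrite le_eqVlt; apply/orP; left;
  apply/eqP; rewrite -/H -/N; ring.
Qed.

Let interp_arith (ni nv x y z a b : R) : 0 <= x -> 0 <= y ->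
  ni = a + b -> nv = x + y ->
  z <= (CI * H) ^+ 2 * (N * y) -> b <= CI ^+ 2 * (N * y) -> a <= 2 * x + 2 * z ->
  ni <= CIs * nv.
Proof.
move=> x0 y0 -> -> e g h; have N0 : 0 <= N by exact: ler0n.
have Ny : 0 <= N * y by exact: mulr_ge0.
have e1 : (CI * H) ^+ 2 * (N * y) <= (CI * Hb) ^+ 2 * (N * y).
  apply: ler_wpM2r => //; apply: sqr_le; last by rewrite ler_pM2l.
  by apply: mulr_ge0; exact: ltW.
have P0 : 0 <= (2 * (CI * Hb) ^+ 2 + CI ^+ 2) * N * x.
  apply: mulr_ge0 => //; apply: mulr_ge0 => //.
  by apply: addr_ge0; rewrite ?sqr_ge0// mulr_ge0// sqr_ge0.
have -> : CIs * (x + y) = 2 * x + 2 * y + (2 * (CI * Hb) ^+ 2 + CI ^+ 2) * N * x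
   + (2 * ((CI * Hb) ^+ 2 * (N * y)) + CI ^+ 2 * (N * y)).
  by rewrite /CIs /interp_const -/N; ring.
move: e g h e1 P0 y0; lra.
Qed.

Lemma interp_stable v : Vh v -> h1norm Om (I v) ^+ 2 <= CIs * h1norm Om v ^+ 2.
Proof.
move=> hv; have hI : Vh (I v) by apply: coarse_fe; case: qI => h _ _ _ _; exact: h.
have hB := subspaceB sV hv hI.
have p1 : psd_form (fun u v : sub_space (subspace_L2 mO 1 m) => ip Om (val u) (val v)).
  apply: psd_ip_gen => //; first exact: sub_spaceP.
  by move=> a u w; apply: aeW => x _; rewrite val_sub_lin.
have sq := rform_sqB p1 (fe_L2 hv) (fe_L2 hB); rewrite subKr in sq.
exact: (interp_arith (ip_ge0 Om v) (ip_ge0 Om (grad v)) (h1norm_sq Om (I v)) (h1norm_sq Om v)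
  (interp_error d_gt0 oOm rOm triTh triTH rf gam_gt0 q_gt0 srT quT H_gt0 qI hv)
  (interp_grad d_gt0 oOm rOm triTH rf gam_gt0 q_gt0 srT quT H_gt0 qI hv) sq).
Qed.

Let ms_interp v w : VH w -> v = w - corrector RkK w -> I v = w.
Proof.
move=> hw ->; have hw' := coarse_fe hw; have hr := local_corrector_fine hw'.
rewrite -scaleN1r addrC (Ilin _ (Vf_V hr) hw') (proj2 hr) scaler0 add0r.
by case: qI => _ _ h1 /(_ w hw)[w' hw2 <-] _; exact: h1.
Qed.

Definition orth_const : R := C0 ^+ 2 * CL * CIs.

Let orth_arith (e xx yy nb2 nw2 nv ng : R) : 0 <= xx -> 0 <= yy -> e ^+ 2 <= xx * yy ->
  xx <= C0 * nb2 -> yy <= C0 * ng ^+ 2 -> nb2 <= CL * dec ^+ 2 * nw2 ->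
  nw2 <= CIs * nv ^+ 2 -> e ^+ 2 <= orth_const * (dec * nv * ng) ^+ 2.
Proof.
move=> x0 y0 e0 u1 u2 h1 h2; apply: le_trans e0 _.
have -> : orth_const * (dec * nv * ng) ^+ 2 =
   (C0 * (CL * dec ^+ 2 * (CIs * nv ^+ 2))) * (C0 * ng ^+ 2).
  by rewrite /orth_const; ring.
apply: ler_pM => //; apply: le_trans u1 _; apply: ler_wpM2l; first exact: ltW.
apply: le_trans h1 _; apply: ler_wpM2l h2; apply: mulr_ge0; last exact: sqr_ge0.
by apply: mulr_ge0; [exact: ltW|apply: divr_ge0; exact: ltW].
Qed.

(** With the global corrector the product would vanish; what remains is the localization error of
    the coarse part, which is [I v] and so bounded by [v]. *)
Lemma ms_fine_orth v g : ms_space VH (corrector RkK) v -> Vf g ->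
  E Om v g ^+ 2 <= orth_const * (dec * h1norm Om v * h1norm Om g) ^+ 2.
Proof.
move=> hms hg; have hv := ms_fe hms; have hg' := Vf_V hg.
have [w hw ev] := hms; have hw' := coarse_fe hw.
have hR := corrector_fine hw'; have hRk := local_corrector_fine hw'.
have hB := subspaceB sV (Vf_V hRk) (Vf_V hR).
have eE : E Om v g = - E Om (corrector RkK w - corrector RK w) g.
  rewrite ev (rformB pO hw' (Vf_V hRk) hg') (rformB pO (Vf_V hRk) (Vf_V hR) hg').
  by rewrite (corrector_energy hw' hg) opprB.
have ist := interp_stable hv; rewrite (ms_interp hw ev) in ist.
rewrite eE sqrrN.
have /andP[_ u1] := coer hB; have /andP[_ u2] := coer hg'.
exact: (orth_arith (rform_ge0 pO hB) (rform_ge0 pO hg') (rform_CS2 pO hB hg') u1 u2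
  (corrector_error hw') ist).
Qed.

(** The 4 comes from two successive splittings of a squared norm; the terms stand for [v], [I v],
    the localization error and the global corrector. *)
Definition fine_const : R := 4 * (1 + CIs + (CL * Hb ^+ 2 + C0 / c0) * CIs).

Let fine_arith (r e rk vi s x y : R) : 0 <= x -> 0 <= y ->
  y <= CIs * x -> e <= CL * dec ^+ 2 * y -> r <= C0 / c0 * y ->
  s <= 2 * vi + 2 * rk -> vi <= 2 * x + 2 * y -> rk <= 2 * e + 2 * r ->
  s <= fine_const * x.
Proof.
move=> x0 y0 h1 h2 h3 h4 h5 h6.
have d2 : dec ^+ 2 <= Hb ^+ 2 by apply: sqr_le => //; exact: le_trans H_Hb.
have CL0 : 0 <= CL by apply: mulr_ge0; [exact: ltW|apply: divr_ge0; exact: ltW].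
have Cc0 : 0 <= C0 / c0 by apply: divr_ge0; exact: ltW.
have a1 : CL * dec ^+ 2 * y <= CL * Hb ^+ 2 * (CIs * x).
  apply: ler_pM => //; last exact: ler_wpM2l.
  by apply: mulr_ge0 => //; exact: sqr_ge0.
have a2 : C0 / c0 * y <= C0 / c0 * (CIs * x) by exact: ler_wpM2l.
have -> : fine_const * x = 4 * x + 4 * (CIs * x) + 4 * (CL * Hb ^+ 2 * (CIs * x))
  + 4 * (C0 / c0 * (CIs * x)) by rewrite /fine_const; ring.
move: h1 h2 h3 h4 h5 h6 a1 a2; lra.
Qed.

Lemma ms_fine_stable v : Vh v ->
  h1norm Om (v - I v + corrector RkK (I v)) ^+ 2 <= fine_const * h1norm Om v ^+ 2.
Proof.
move=> hv; have hI : Vh (I v) by apply: coarse_fe; case: qI => h _ _ _ _; exact: h.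
have hR := Vf_V (corrector_fine hI); have hRk := Vf_V (local_corrector_fine hI).
have hB := subspaceB sV hRk hR; have hvI := subspaceB sV hv hI.
have e3 := h1norm_sqD hB hR; rewrite subrK in e3.
exact: (fine_arith (sqr_ge0 _) (sqr_ge0 _) (interp_stable hv) (corrector_error hI)
  (corrector_stable hI) (h1norm_sqD hvI hRk) (h1norm_sqB hv hI) e3).
Qed.

End correctors.

(** * Bounds for the data *)

Section time_integrals.
Variables (R : realType) (T : R).
Local Notation leb1 := (@lebesgue_measure R).
Hypothesis T_gt0 : 0 < T.

Lemma ae_lebesgueS (P Q : R -> Prop) : (forall x, P x -> Q x) ->
  {ae leb1, forall x, P x} -> {ae leb1, forall x, Q x}.
Proof. by move=> PQ; apply: filterS => //; exact: (ae_filter_ringOfSetsType leb1). Qed.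

Lemma ae_exists (P : R -> Prop) s t : s < t -> {ae leb1, forall r, P r} ->
  exists2 r, s <= r <= t & P r.
Proof.
move=> st [Nn [mN N0 hN]]; apply: contrapT => h.
have : (leb1 `[s, t]%classic <= leb1 Nn)%E.
  apply: le_measure; rewrite ?inE//; move=> r /=; rewrite in_itv /= => rst.
  by apply: hN => /= Pr; apply: h; exists r.
by rewrite N0 lebesgue_measure_itv /= lte_fin st -EFinD lee_fin; lra.
Qed.

Lemma Linf_norm_ge0 (N : R -> \bar R) : (forall t, 0 <= t <= T -> (0 <= N t)%E) ->
  (0 <= Linf_norm T N)%E.
Proof.
(* The essential supremum over a null space would be [-oo]; the unit interval shows that the measure
   is positive. *)
move=> N0; apply: ess_sup_gee.
  by apply: (lt_le_trans (y := leb1 `[0, 1]%classic));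
    [rewrite lebesgue_measure_itv /= lte_fin ltr01 -EFinD lte_fin; lra|by apply: le_measure; rewrite ?inE].
by apply: aeW => t; case: ifP => //; exact: N0.
Qed.

Lemma ae_le_Linf_norm (N : R -> \bar R) : (forall t, 0 <= t <= T -> (0 <= N t)%E) ->
  (Linf_norm T N < +oo)%E ->
  {ae leb1, forall t, 0 <= t <= T -> (N t <= (fine (Linf_norm T N))%:E)%E}.
Proof.
move=> N0 Noo; rewrite fineK; last by rewrite ge0_fin_numE// Linf_norm_ge0.
have := ess_sup_ge leb1 (fun t => if 0 <= t <= T then N t else 0%E).
by apply: filterS => t + tT; rewrite tT.
Qed.

(** Used with [c = 0] for Lipschitz bounds and with a value at a time node for second
    differences. *)
Lemma integral_deviation (h : R -> R) (c K s t : R) : 0 <= s -> s <= t -> t <= T ->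
  measurable_fun `[0, T] h ->
  {ae leb1, forall r, s <= r <= t -> `|h r - c| <= K} ->
  `|\int[leb1]_(r in `[s, t]) h r - c * (t - s)| <= K * (t - s).
Proof.
move=> s0 st tT mh ae; have sub : `[s, t]%classic `<=` `[0, T]%classic.
  by apply: subset_itv; rewrite bnd_simp.
have ms : measurable (`[s, t]%classic : set R) by [].
have {}mh : measurable_fun `[s, t] h by exact: measurable_funS mh.
have cst k : leb1.-integrable `[s, t] (EFin \o (fun=> k : R)).
  have fin : (@lebesgue_measure R `[s, t]%classic < +oo)%E.
    by rewrite lebesgue_measure_itv /=; case: ifP; rewrite ?ltry.
  by apply: measurable_bounded_integrable => //; exact: bounded_cst.
have cstE k : \int[leb1]_(r in `[s, t]) k = k * (t - s) :> R.
  rewrite Rintegral_cst//; congr (_ * _).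
  have e : @lebesgue_measure R `[s, t]%classic = (t - s)%:E.
    rewrite lebesgue_measure_itv /= lte_fin; case: ltP => //= h'; congr EFin.
    by apply/eqP; rewrite eq_sym subr_eq0 eq_le h' st.
  exact: (congr1 fine e).
have ae' : {ae leb1, forall r, `[s, t]%classic r -> `|h r - c| <= K}.
  by apply: ae_lebesgueS ae => r + /=; rewrite in_itv.
have ih : leb1.-integrable `[s, t] (EFin \o h).
  apply: (@ae_le_integrable _ _ _ leb1 _ ms _ (fun=> `|c| + K) mh); first exact: cst.
  apply: ae_lebesgueS ae' => r /[apply] hr; rewrite -[h r](subrK c).
  by apply: le_trans (ler_normD _ _) _; rewrite addrC lerD2l.
have up : \int[leb1]_(r in `[s, t]) h r <= (c + K) * (t - s).
  rewrite -cstE; apply: ae_le_Rintegral => //.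
  by apply: ae_lebesgueS ae' => r /[apply]; rewrite ler_norml; lra.
have lo : (c - K) * (t - s) <= \int[leb1]_(r in `[s, t]) h r.
  rewrite -cstE; apply: ae_le_Rintegral => //.
  by apply: ae_lebesgueS ae' => r /[apply]; rewrite ler_norml; lra.
suff arith (X a : R) : X <= (c + K) * a -> (c - K) * a <= X -> `|X - c * a| <= K * a.
  exact: arith up lo.
by rewrite mulrDl mulrBl ler_norml => h1 h2; apply/andP; split; lra.
Qed.

(** The norms of the data control almost every time, but the schemes evaluate at the nodes;
    Lipschitz continuity carries the bound over from nearby good times. *)
Lemma ae_bound_everywhere (phi : R -> R) (L B : R) : 0 <= L ->
  (forall s t, 0 <= s -> s <= t -> t <= T -> `|phi t - phi s| <= L * (t - s)) ->
  {ae leb1, forall t, 0 <= t <= T -> `|phi t| <= B} ->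
  forall t, 0 <= t <= T -> `|phi t| <= B.
Proof.
move=> L0 lip ae t /andP[t0 tT]; apply/ler_addgt0Pr => e e0.
(* [T / 2] keeps one of [t + dd] and [t - dd] in the interval; the second entry makes [L * dd] at
   most [e], with 1 added for [L = 0]. *)
pose dd := Num.min (T / 2) (e / (L + 1)).
have dT : dd <= T / 2 by rewrite ge_min lexx.
have L1 : 0 < L + 1 by lra.
have d0 : 0 < dd by rewrite lt_min !divr_gt0.
have dL : L * dd <= e.
  apply: (@le_trans _ _ ((L + 1) * (e / (L + 1)))); last by rewrite mulrC divfK ?gt_eqF.
  apply: ler_pM; rewrite ?(ltW d0)//; first by lra.
  by rewrite ge_min lexx orbT.
have [r [r0 rT rt pr]] : exists r, [/\ 0 <= r, r <= T, `|t - r| <= dd & `|phi r| <= B].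
  have [h|h] := leP (t + dd) T.
    have st : t < t + dd by lra.
    have [r /andP[r1 r2] pr] := ae_exists st ae.
    exists r; split; [lra|lra| |].
      by rewrite ler_norml; apply/andP; split; lra.
    by apply: pr; apply/andP; split; lra.
  have st : t - dd < t by lra.
  have [r /andP[r1 r2] pr] := ae_exists st ae.
  have r0 : 0 <= r by lra.
  exists r; split; [by []|lra| |].
    by rewrite ler_norml; apply/andP; split; lra.
  by apply: pr; apply/andP; split; lra.
have d1 : `|phi t - phi r| <= L * `|t - r|.
  have [rt'|tr] := leP r t; first by rewrite (ger0_norm (x := t - r)) ?subr_ge0//; exact: lip.
  by rewrite distrC (distrC t) (ger0_norm (x := r - t)) ?subr_ge0 ?(ltW tr)//; apply: lip => //; exact: ltW.
have -> : phi t = phi t - phi r + phi r by rewrite subrK.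
apply: le_trans (ler_normD _ _) _; rewrite addrC; apply: lerD => //.
by apply: le_trans d1 _; apply: le_trans dL; exact: ler_wpM2l.
Qed.

End time_integrals.

(** * Dual norms *)

Section dual.
Variables (R : realType) (d m : nat) (Om : set 'rV[R]_d).
Local Notation fct := ('rV[R]_d -> 'rV[R]_m).
Variables (M : nat) (Mm : mesh R d M).
Hypotheses (oOm : open Om) (triM : triangulation Om Mm).
Let mO : measurable Om. Proof. exact: open_measurable_rV. Qed.

Lemma dual_norm_ge0 (l : fct -> R) : (0 <= dual_norm Om l)%E.
Proof.
apply: (@le_trans _ _ `|l 0|%:E); first by rewrite lee_fin.
apply: ereal_sup_ubound; exists 0, 0; split => //; first exact: H1_0.
by rewrite H1norm0.
Qed.

(** The norm of [v] may vanish, so [v] is scaled by an arbitrary [s] above its norm and [s] then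
    decreases to the norm. *)
Lemma dual_norm_le (l : fct -> R) K v G :
  (forall a v Gv w Gw, H1 Om v Gv -> H1 Om w Gw -> l (a *: v + w) = a * l v + l w) ->
  (dual_norm Om l <= K%:E)%E -> H1 Om v G -> `|l v| <= K * H1norm Om v G.
Proof.
move=> ll lK hv; have h0 := H1_0 oOm m.
have l0 : l 0 = 0 by have := ll 1 _ _ _ _ h0 h0; rewrite scale1r addr0; lra.
have K0 : 0 <= K by rewrite -lee_fin; exact: le_trans (dual_norm_ge0 l) lK.
set n := H1norm Om v G; have n0 : 0 <= n by exact: sqrtr_ge0.
have key (s : R) : n < s -> `|l v| <= K * s.
  move=> ns; have s0 : 0 < s by exact: le_lt_trans ns.
  have hs := H1_lin oOm triM s^-1 hv h0.
  have up : (`|l (s^-1 *: v + 0)|%:E <= dual_norm Om l)%E.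
    apply: ereal_sup_ubound; exists (s^-1 *: v + 0), (s^-1 *: G + 0); split => //.
    case: hv => v2 G2 _; case: h0 => z2 Z2 _.
    apply: le_trans (H1norm_le_lin mO s^-1 v2 G2 z2 Z2) _.
    by rewrite H1norm0// addr0 ger0_norm ?invr_ge0 ?(ltW s0)// ler_pdivrMl// mulr1 ltW.
  have := le_trans up lK.
  rewrite lee_fin (ll _ _ _ _ _ hv h0) l0 addr0 normrM ger0_norm ?invr_ge0 ?(ltW s0)//.
  by rewrite ler_pdivrMl// mulrC.
apply/ler_addgt0Pr => e e0.
have eK : 0 < e / (K + 1) by apply: divr_gt0 => //; lra.
have := key (n + e / (K + 1)); rewrite ltrDl eK => /(_ isT) /le_trans; apply.
rewrite mulrDr lerD2l mulrCA ler_piMr//; first exact: ltW.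
by rewrite ler_pdivrMr; lra.
Qed.

End dual.

(** * Data at the time nodes *)

Section data_bounds.
Variables (R : realType) (d : nat) (Om : set 'rV[R]_d) (T : R).
Local Notation pt := 'rV[R]_d.
Local Notation leb1 := (@lebesgue_measure R).
Variables (M : nat) (Mm : mesh R d M).
Hypotheses (oOm : open Om) (triM : triangulation Om Mm).
Hypothesis T_gt0 : 0 < T.
Variables (f f1 : R -> pt -> pt) (f2 : R -> (pt -> pt) -> R)
  (g : R -> pt -> 'rV[R]_1) (g1 : R -> (pt -> 'rV[R]_1) -> R).
Hypothesis reg : regular_data Om T f f1 f2 g g1.
Let D := data_norm Om T f f1 f2 g g1.
Let mO : measurable Om. Proof. exact: open_measurable_rV. Qed.

Let L2_ge0 m (h : R -> pt -> 'rV[R]_m) : 0 <= fine (Linf_L2_norm Om T h).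
Proof.
by apply: fine_ge0; apply: Linf_norm_ge0 => t _; rewrite lee_fin; exact: sqrtr_ge0.
Qed.

Let dual_ge0 m (l : R -> (pt -> 'rV[R]_m) -> R) : 0 <= fine (Linf_dual_norm Om T l).
Proof.
by apply: fine_ge0; apply: Linf_norm_ge0 => t _; exact: (dual_norm_ge0 oOm).
Qed.

Let sum5_le (a b c e x : R) : 0 <= a -> 0 <= b -> 0 <= c -> 0 <= e -> 0 <= x ->
  [/\ 0 <= a + b + c + e + x, a <= a + b + c + e + x, b <= a + b + c + e + x &
   [/\ c <= a + b + c + e + x, e <= a + b + c + e + x & x <= a + b + c + e + x]].
Proof. by move=> *; do !split; lra. Qed.

Let D_parts := sum5_le (L2_ge0 g) (dual_ge0 g1) (L2_ge0 f) (L2_ge0 f1) (dual_ge0 f2).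

Lemma data_norm_ge0 : 0 <= D. Proof. by case: D_parts. Qed.

Let Dg : fine (Linf_L2_norm Om T g) <= D. Proof. have [_ h _ _] := D_parts; exact: h. Qed.
Let Dg1 : fine (Linf_dual_norm Om T g1) <= D. Proof. have [_ _ h _] := D_parts; exact: h. Qed.
Let Df : fine (Linf_L2_norm Om T f) <= D. Proof. have [_ _ _ [h _ _]] := D_parts; exact: h. Qed.
Let Df1 : fine (Linf_L2_norm Om T f1) <= D. Proof. have [_ _ _ [_ h _]] := D_parts; exact: h. Qed.
Let Df2 : fine (Linf_dual_norm Om T f2) <= D. Proof. have [_ _ _ [_ _ h]] := D_parts; exact: h. Qed.

Let ae_L2 m (h : R -> pt -> 'rV[R]_m) v : Linf_L2 Om T h -> L2 Om v ->
  {ae leb1, forall t, 0 <= t <= T ->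
    `|ip Om (h t) v| <= fine (Linf_L2_norm Om T h) * l2norm Om v}.
Proof.
move=> [hL2 _ hoo] hv.
apply: (ae_lebesgueS _ (ae_le_Linf_norm (N := fun t => (l2norm Om (h t))%:E) _ hoo)).
  move=> t + tT => /(_ tT); rewrite lee_fin => le.
  apply: le_trans (ip_CS mO (hL2 t tT) hv) _; apply: ler_wpM2r le; exact: sqrtr_ge0.
by move=> t _; rewrite lee_fin; exact: sqrtr_ge0.
Qed.

Let ae_dual m (l : R -> (pt -> 'rV[R]_m) -> R) v G : Linf_dual Om T l -> H1 Om v G ->
  {ae leb1, forall t, 0 <= t <= T ->
    `|l t v| <= fine (Linf_dual_norm Om T l) * H1norm Om v G}.
Proof.
move=> [hl _ hoo] hv.
apply: (ae_lebesgueS _ (ae_le_Linf_norm (N := fun t => dual_norm Om (l t)) _ hoo)).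
  move=> t + tT => /(_ tT) le; have [_ ll] := hl t tT.
  exact: (dual_norm_le oOm triM ll le hv).
by move=> t _; exact: (dual_norm_ge0 oOm).
Qed.

Let lipschitz (F F' : R -> R) (K s t : R) : 0 <= s -> s <= t -> t <= T ->
  measurable_fun `[0, T] F' -> F t - F s = \int[leb1]_(r in `[s, t]) F' r ->
  {ae leb1, forall r, 0 <= r <= T -> `|F' r| <= K} -> `|F t - F s| <= K * (t - s).
Proof.
move=> s0 st tT mF -> ae.
have := integral_deviation (c := 0) (K := K) s0 st tT mF; rewrite mul0r subr0; apply.
apply: ae_lebesgueS ae => r hr /andP[sr rt]; rewrite subr0; apply: hr.
by rewrite (le_trans s0 sr) (le_trans rt tT).
Qed.

Lemma f_diff_le s t v : 0 <= s -> s <= t -> t <= T -> L2 Om v ->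
  `|ip Om (f t) v - ip Om (f s) v| <= D * l2norm Om v * (t - s).
Proof.
move=> s0 st tT hv; have [[_ hf1 _ _ _] [tf _ _]] := reg.
have [_ mf1 _] := hf1.
apply: (@lipschitz (fun t => ip Om (f t) v) (fun t => ip Om (f1 t) v)) => //.
- exact: mf1.
- exact: tf.
apply: ae_lebesgueS (ae_L2 hf1 hv) => r h hr; apply: le_trans (h hr) _.
by apply: ler_wpM2r; [exact: sqrtr_ge0|exact: Df1].
Qed.

Lemma f_le t v : 0 <= t <= T -> L2 Om v -> `|ip Om (f t) v| <= D * l2norm Om v.
Proof.
move=> tT hv; have [[hf _ _ _ _] _] := reg.
apply: (@ae_bound_everywhere _ T T_gt0 (fun t => ip Om (f t) v) (D * l2norm Om v) (D * l2norm Om v)).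
- by apply: mulr_ge0; [exact: data_norm_ge0|exact: sqrtr_ge0].
- by move=> s r s0 sr rT; exact: f_diff_le.
- apply: ae_lebesgueS (ae_L2 hf hv) => r h hr; apply: le_trans (h hr) _.
  by apply: ler_wpM2r; [exact: sqrtr_ge0|exact: Df].
- exact: tT.
Qed.

Lemma g_diff_le s t v G : 0 <= s -> s <= t -> t <= T -> H1 Om v G ->
  `|ip Om (g t) v - ip Om (g s) v| <= D * H1norm Om v G * (t - s).
Proof.
move=> s0 st tT hv; have [[_ _ _ _ hg1] [_ _ tg]] := reg.
have [_ mg1 _] := hg1.
apply: (@lipschitz (fun t => ip Om (g t) v) (fun t => g1 t v)) => //.
- exact: mg1 hv.
- by apply: tg => //; exists G.
apply: ae_lebesgueS (ae_dual hg1 hv) => r h hr; apply: le_trans (h hr) _.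
by apply: ler_wpM2r; [exact: sqrtr_ge0|exact: Dg1].
Qed.

(** The bound involves only the L2 norm of [v], but continuity in time of [g] is known only against
    H1 functions. *)
Lemma g_le t v G : 0 <= t <= T -> H1 Om v G -> `|ip Om (g t) v| <= D * l2norm Om v.
Proof.
move=> tT hv; have [[_ _ _ hg _] _] := reg.
apply: (@ae_bound_everywhere _ T T_gt0 (fun t => ip Om (g t) v) (D * H1norm Om v G) (D * l2norm Om v)).
- by apply: mulr_ge0; [exact: data_norm_ge0|exact: sqrtr_ge0].
- by move=> s r s0 sr rT; exact: g_diff_le.
- have [v2 _ _] := hv; apply: ae_lebesgueS (ae_L2 hg v2) => r h hr; apply: le_trans (h hr) _.
  by apply: ler_wpM2r; [exact: sqrtr_ge0|exact: Dg].
- exact: tT.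
Qed.

(** Each first difference is [tau] times the derivative at the middle node, up to [D * tau ^+ 2]
    times the norm of [v]; the middle terms cancel, and two errors give the factor 2. *)
Lemma f_second_diff_le s tau v G : 0 <= s -> 0 <= tau -> s + tau + tau <= T -> H1 Om v G ->
  `|ip Om (f (s + tau + tau)) v - ip Om (f (s + tau)) v
    - (ip Om (f (s + tau)) v - ip Om (f s) v)| <= tau ^+ 2 * (2 * D) * H1norm Om v G.
Proof.
move=> s0 tau0 sT hv; have [[_ hf1 hf2 _ _] [tf tf1 _]] := reg.
have [v2 _ _] := hv; have [_ mf1 _] := hf1; have [_ mf2 _] := hf2.
set K := D * H1norm Om v G.
have lip a b : 0 <= a -> a <= b -> b <= T ->
    `|ip Om (f1 b) v - ip Om (f1 a) v| <= K * (b - a).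
  move=> a0 ab bT; apply: (@lipschitz (fun t => ip Om (f1 t) v) (fun t => f2 t v)) => //.
  - exact: mf2 hv.
  - by apply: tf1 => //; exists G.
  apply: ae_lebesgueS (ae_dual hf2 hv) => r h hr; apply: le_trans (h hr) _.
  by apply: ler_wpM2r; [exact: sqrtr_ge0|exact: Df2].
have K0 : 0 <= K by apply: mulr_ge0; [exact: data_norm_ge0|exact: sqrtr_ge0].
have e1 : s <= s + tau by lra.
have e2 : s + tau <= s + tau + tau by lra.
have e3 : s + tau <= T by lra.
have e4 : 0 <= s + tau by lra.
rewrite (tf v v2 _ _ e4 e2 sT) (tf v v2 _ _ s0 e1 e3).
set c := ip Om (f1 (s + tau)) v.
have Kt : K * tau = K * tau by [].
have d1 := @integral_deviation _ T (fun t => ip Om (f1 t) v) c (K * tau) _ _ e4 e2 sT (mf1 v v2).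
have d2 := @integral_deviation _ T (fun t => ip Om (f1 t) v) c (K * tau) _ _ s0 e1 e3 (mf1 v v2).
have {}d1 := d1 (aeW _ _); have {}d2 := d2 (aeW _ _).
suff arith (x y a b : R) : a = tau -> b = tau -> `|x - c * a| <= K * tau * a ->
    `|y - c * b| <= K * tau * b -> `|x - y| <= tau ^+ 2 * (2 * D) * H1norm Om v G.
  apply: arith (d1 _) (d2 _).
  - by ring.
  - by ring.
  - move=> r /andP[r1 r2]; apply: le_trans (lip _ _ e4 r1 (le_trans r2 sT)) _.
    by apply: ler_wpM2l => //; lra.
  - move=> r /andP[r1 r2]; rewrite distrC.
    apply: le_trans (lip _ _ (le_trans s0 r1) r2 e3) _.
    by apply: ler_wpM2l => //; lra.
move=> -> -> h1 h2.
have -> : tau ^+ 2 * (2 * D) * H1norm Om v G = K * tau * tau + K * tau * tau by rewrite /K; ring.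
have -> : x - y = (x - c * tau) - (y - c * tau) by ring.
by apply: le_trans (ler_normB _ _) _; exact: lerD.
Qed.

End data_bounds.

(** * The schemes *)

Section divergence.
Variables (R : realType) (d : nat) (Om GD1 GD2 : set 'rV[R]_d) (c : coefficients R d).
Local Notation pt := 'rV[R]_d.
Local Notation leb := (lebesgue_rV R d).
Hypotheses (d_gt0 : (0 < d)%N) (oOm : open Om).
Variables (ka1 ka2 mu1 mu2 la1 la2 al1 al2 : R).
Hypotheses (al1_gt0 : 0 < al1) (al2_ge0 : 0 <= al2).
Hypothesis cb : coefficient_bounds Om c ka1 ka2 mu1 mu2 la1 la2 al1 al2.
Variables (Mh : nat) (Th : mesh R d Mh).
Hypothesis triTh : triangulation Om Th.
Local Notation X1 := (sub_space (subspace_fe d GD1 d_gt0 oOm triTh)).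
Local Notation X2 := (sub_space (subspace_fe 1 GD2 d_gt0 oOm triTh)).
Let mO : measurable Om. Proof. exact: open_measurable_rV. Qed.

Let delta (x : pt) (A : 'rV[R]_1) (B : 'M[R]_d) := (alpha c x *: A) ord0 ord0 * \tr B.

Let delta_l x k A B C : delta x (k *: A + B) C = k * delta x A C + delta x B C.
Proof. by rewrite /delta !mxE; ring. Qed.

Let delta_r x k A B C : delta x C (k *: A + B) = k * delta x C A + delta x C B.
Proof. by rewrite /delta linearD linearZ /=; ring. Qed.

Let delta_le : {ae leb, forall x, Om x -> forall A B,
  `|delta x A B| <= al2 * d%:R * (frob A A + frob B B)}.
Proof.
have [_ _ _ _ hae] := cb; apply: filterS hae => x /[apply] -[_ _ _ _ /andP[a1 a2]] A B.
rewrite /delta !mxE normrM normrM.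
have -> : frob A A = A ord0 ord0 ^+ 2 by rewrite /frob !big_ord1 expr2.
have := mxtrace_sq_le B; move: (frob_sq_ge0 B).
move: (A ord0 ord0) (\tr B) (frob B B) => a t b b0 tb.
have al0 : 0 <= alpha c x by move: al1_gt0 a1; lra.
have d1 : 1 <= d%:R :> R by rewrite ler1n.
rewrite (ger0_norm al0) -!mulrA; apply: ler_pM => //.
have := sqr_ge0 (`|a| - `|t|); rewrite sqrrB !real_normK ?num_real// => h.
have a0 : 0 <= a ^+ 2 by exact: sqr_ge0.
have : a ^+ 2 <= d%:R * a ^+ 2 by exact: ler_peMl.
have : 0 <= d%:R * b by apply: mulr_ge0.
have : 0 <= d%:R * a ^+ 2 by apply: mulr_ge0.
rewrite mulrDr; move: h tb; lra.
Qed.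

Section subdomain.
Variable w : set pt.
Hypotheses (mw : measurable w) (wO : w `<=` Om).

Let delta_m F G : measurable_field w F -> measurable_field w G ->
  measurable_fun w (fun x => delta x (F x) (G x)).
Proof.
have [_ _ _ mal _] := cb => mF mG; apply: measurable_funM.
  apply: (@eq_measurable_fun _ _ _ _ _ (fun x : pt => alpha c x * F x ord0 ord0)).
    by move=> x _; rewrite mxE.
  by apply: measurable_funM; [exact: measurable_funS mal|exact: mF].
by rewrite /mxtrace; apply: measurable_sum => i; exact: mG.
Qed.

Let delta_le_w : {ae leb, forall x, w x -> forall A B,
  `|delta x A B| <= al2 * d%:R * (frob A A + frob B B)}.
Proof. by apply: filterS delta_le => x h wx; apply: h; exact: wO. Qed.

Let P2 (u : X2) : L2 w (val u).
Proof. exact: (L2_sub mO mw wO (fe_L2 (sub_spaceP u))). Qed.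

Let P1 (u : X1) : L2 w (grad (val u)).
Proof. exact: (L2_sub mO mw wO (fe_grad_L2 (sub_spaceP u))). Qed.

Let L2lin k (u v : X2) : {ae leb, forall x, w x -> val (k *: u + v) x = k *: val u x + val v x}.
Proof. by apply: aeW => x _; rewrite val_sub_lin. Qed.

Let L1lin k (u v : X1) : {ae leb, forall x, w x ->
  grad (val (k *: u + v)) x = k *: grad (val u) x + grad (val v) x}.
Proof.
have := fe_grad_lin d_gt0 triTh k (sub_spaceP u) (sub_spaceP v).
by apply: filterS => x h wx; rewrite val_sub_lin; apply: h; exact: wO.
Qed.

Lemma div_form_linl (v : X1) :
  linear_functional (fun q : X2 => div_form w (times_alpha c (val q)) (val v)).
Proof.
exact: (@density_linl _ _ w mw _ _ _ _ delta delta_l delta_m _ delta_le_w X2 X1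
  (fun q => val q) (fun v => grad (val v)) P2 P1 L2lin v).
Qed.

Lemma div_form_linr (q : X2) :
  linear_functional (fun v : X1 => div_form w (times_alpha c (val q)) (val v)).
Proof.
exact: (@density_linr _ _ w mw _ _ _ _ delta delta_r delta_m _ delta_le_w X2 X1
  (fun q => val q) (fun v => grad (val v)) P2 P1 L1lin q).
Qed.

Lemma div_form_bound (q : X2) (v : X1) :
  `|div_form w (times_alpha c (val q)) (val v)| <=
  al2 * d%:R * (ip w (val q) (val q) + ip w (grad (val v)) (grad (val v))).
Proof.
have iq := rint_frob mw (P2 q) (P2 q); have iv := rint_frob mw (P1 v) (P1 v).
have id := @rint_density _ _ w mw _ _ _ _ delta delta_m _ delta_le_w _ _ (P2 q) (P1 v).
rewrite /ip -RintegralD// -RintegralZl//; last exact: rintD.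
have ir := rintZ mw (al2 * d%:R) (rintD mw iq iv).
rewrite ler_norml; apply/andP; split; last first.
  apply: ae_le_Rintegral => //.
  by apply: filterS delta_le_w => x h wx; exact: le_trans (ler_norm _) (h wx _ _).
rewrite -mulN1r -RintegralZl//; apply: ae_le_Rintegral => //; first exact: rintZ.
apply: filterS delta_le_w => x h wx; rewrite mulN1r lerNl.
by apply: le_trans (h wx _ _); rewrite -normrN; exact: ler_norm.
Qed.

(** The additive bound is made multiplicative by scaling [q] and requiring the discriminant of the
    resulting quadratic to be nonpositive. *)
Lemma div_form_le (q : X2) (v : X1) :
  div_form w (times_alpha c (val q)) (val v) ^+ 2 <=
  (2 * (al2 * d%:R)) ^+ 2 * (ip w (val q) (val q) * ip w (grad (val v)) (grad (val v))).
Proof.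
have p2 : psd_form (fun u v : X2 => ip w (val u) (val v)) by exact: psd_ip_gen.
have K0 : 0 <= al2 * d%:R by apply: mulr_ge0.
have q0 := ip_ge0 w (val q); have v0 := ip_ge0 w (grad (val v)).
have key t : 0 <= t ^+ 2 * (al2 * d%:R * ip w (val q) (val q))
    + 2 * t * (2^-1 * div_form w (times_alpha c (val q)) (val v))
    + al2 * d%:R * ip w (grad (val v)) (grad (val v)).
  have := div_form_bound (t *: q) v.
  rewrite (lfunZ (div_form_linl v)) (psdZl p2) (psdZr p2).
  move: (div_form w _ _) (ip w (val q) _) (ip w (grad _) _) => x y z.
  rewrite ler_norml => /andP[h _].
  have -> : t ^+ 2 * (al2 * d%:R * y) + 2 * t * (2^-1 * x) + al2 * d%:R * z =
    t * x + al2 * d%:R * (t * (t * y) + z) by field.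
  by move: h; lra.
have := le_of_nonneg_quadratic (mulr_ge0 K0 q0) (mulr_ge0 K0 v0) key.
move: (div_form w _ _) (ip w (val q) _) (ip w (grad _) _) => x y z h.
have -> : x ^+ 2 = 4 * (2^-1 * x) ^+ 2 by field.
have -> : (2 * (al2 * d%:R)) ^+ 2 * (y * z) = 4 * (al2 * d%:R * y * (al2 * d%:R * z)) by ring.
by rewrite ler_pM2l.
Qed.

End subdomain.
End divergence.

Section lift.
Variables (R : realType) (E : lmodType R) (P : E -> Prop) (sP : subspace P).

(** Total, with default 0, so that whole sequences can be lifted although membership is known only
    up to the last time step. *)
Definition lift (x : E) : sub_space sP :=
  if pselect (P x) is left Px then to_sub_space sP Px else 0.

Lemma val_lift x : P x -> val (lift x) = x.
Proof. by rewrite /lift; case: pselect. Qed.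

Lemma subspace_val (Q : E -> Prop) : subspace Q -> subspace (fun x : sub_space sP => Q (val x)).
Proof.
move=> sQ; split; first by rewrite raddf0; exact: subspace0.
by move=> k x y Qx Qy; rewrite val_sub_lin; exact: (proj2 sQ).
Qed.

Lemma val_subD (x y : sub_space sP) : val (x + y) = val x + val y.
Proof. exact: raddfD. Qed.

Lemma val_subB (x y : sub_space sP) : val (x - y) = val x - val y.
Proof. exact: raddfB. Qed.

Lemma val_subZ k (x : sub_space sP) : val (k *: x) = k *: val x.
Proof. exact: linearZ. Qed.

Lemma lift_split (v : sub_space sP) x y : P x -> P y -> val v = x + y -> v = lift x + lift y.
Proof. by move=> Px Py e; apply: val_inj; rewrite val_subD !val_lift. Qed.

Lemma lift_pred (Q : E -> Prop) x : P x -> Q x -> Q (val (lift x)).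
Proof. by move=> Px; rewrite val_lift. Qed.
End lift.

Lemma nth_le_sum (R : realType) (s : seq R) i : all (fun x => 0 <= x) s ->
  s`_i <= 1 + \sum_(x <- s) x.
Proof.
elim: s i => [|x s IH] i /=; first by rewrite nth_nil big_nil addr0.
move=> /andP[x0 s0]; rewrite big_cons.
have S0 : 0 <= \sum_(y <- s) y by rewrite big_seq; apply: sumr_ge0 => y /(allP s0).
by case: i => [|i] /=; [lra|have := IH i s0; lra].
Qed.

(** Passes from squares to norms: dividing by [t] creates the factor [t] to the power -1/2, and 1 +
    2 |C| is a crude bound for the square root of 2 |C|. *)
Lemma root_estimate (R : realType) (x y t h e D th C : R) : 0 <= x -> 0 <= y -> 0 < t ->
  0 <= h -> 0 <= e -> 0 <= D -> 0 <= th ->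
  t * (x ^+ 2 + y ^+ 2) <= C * h ^+ 2 * (th ^+ 2 + t * D ^+ 2) ->
  x + y <= (1 + 2 * `|C|) * (h + e) * (D + t `^ (- 2^-1) * th).
Proof.
move=> x0 y0 t0 h0 e0 D0 th0 le; set p := t `^ _.
have p0 : 0 <= p by exact: powR_ge0.
have pp : p ^+ 2 = t^-1.
  by rewrite -[LHS]powR_mulrn// -powRrM mulNr mulVf// powR_inv1// ltW.
have C0 : 0 <= `|C| by exact: normr_ge0.
have a0 : 0 <= D + p * th by apply: addr_ge0 => //; exact: mulr_ge0.
have b0 : 0 <= 1 + 2 * `|C| by lra.
have le2 : (x + y) ^+ 2 <= 2 * (x ^+ 2 + y ^+ 2) by have := sqr_ge0 (x - y); lra.
have le3 : x ^+ 2 + y ^+ 2 <= `|C| * (h * (D + p * th)) ^+ 2.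
  apply: (@le_trans _ _ (t^-1 * (`|C| * h ^+ 2 * (th ^+ 2 + t * D ^+ 2)))).
    rewrite ler_pdivlMl//; apply: le_trans le _; apply: ler_wpM2r.
      by apply: addr_ge0; rewrite ?sqr_ge0// mulr_ge0 ?sqr_ge0// ltW.
    by apply: ler_wpM2r; [exact: sqr_ge0|exact: ler_norm].
  have -> : t^-1 * (`|C| * h ^+ 2 * (th ^+ 2 + t * D ^+ 2)) =
      `|C| * (h ^+ 2 * (t^-1 * th ^+ 2 + D ^+ 2)) by field; rewrite gt_eqF.
  rewrite -pp; apply: ler_wpM2l => //; rewrite exprMn; apply: ler_wpM2l; first exact: sqr_ge0.
  have : 0 <= p * th * D by rewrite !mulr_ge0.
  by lra.
have q0 : 0 <= h * (D + p * th) by exact: mulr_ge0.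
rewrite -[leLHS]ger0_norm ?addr_ge0// -[leRHS]ger0_norm; last first.
  by rewrite !mulr_ge0 ?addr_ge0 ?mulr_ge0.
rewrite -ler_sqr ?nnegrE// !real_normK ?num_real//.
apply: (@le_trans _ _ (((1 + 2 * `|C|) * (h * (D + p * th))) ^+ 2)); last first.
  rewrite !expr2; apply: ler_pM; try exact: mulr_ge0;
    by rewrite mulrA; apply: ler_wpM2r => //; apply: ler_wpM2l => //; rewrite lerDl.
apply: le_trans le2 _; rewrite exprMn.
apply: (@le_trans _ _ (2 * (`|C| * (h * (D + p * th)) ^+ 2))); first by rewrite ler_pM2l.
rewrite mulrA; apply: ler_wpM2r; first exact: sqr_ge0.
by have := sqr_ge0 `|C|; lra.
Qed.

Section constants.
Variables (R : realType) (d : nat) (gam q CI al2 cs Cs ck Ck Cloc Cort Cco : R).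
Hypotheses (al2_gt0 : 0 < al2).
Hypotheses (cs_gt0 : 0 < cs) (Cs_gt0 : 0 < Cs) (ck_gt0 : 0 < ck) (Ck_gt0 : 0 < Ck).
Hypotheses (Cloc_gt0 : 0 < Cloc) (Cort_gt0 : 0 < Cort) (Cco_gt0 : 0 < Cco).

(** The smallness assumption on the mesh size doubles as an upper bound that is independent of the
    mesh. *)
Definition height_bound : R := 1 / (4 * Cco).

(** All constants that the single [K] of the coupled problem has to dominate, addressed by position
    later. The last one compares [cs] with [cs - del]. *)
Definition const_seq : seq R := [:: Cs; cs^-1; ck^-1; Ck; 2 * (al2 * d%:R);
  CI ^+ 2 * (patch_bound d gam q)%:R; fine_const d gam q CI ck Ck Cloc height_bound;
  orth_const d gam q CI ck Ck Cloc height_bound; Cort; Cco; (Cco + Cort) / Cco].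

Definition scheme_const : R := 1 + \sum_(x <- const_seq) x.

Lemma const_seq_ge0 : all (fun x => 0 <= x) const_seq.
Proof.
have N0 : 0 <= (patch_bound d gam q)%:R :> R by exact: ler0n.
have I0 : 0 <= interp_const d gam q CI height_bound.
  apply: addr_ge0 => //; apply: mulr_ge0 => //; apply: addr_ge0; last exact: sqr_ge0.
  by apply: mulr_ge0 => //; exact: sqr_ge0.
have L0 : 0 <= Cloc * (Ck / ck) by apply: mulr_ge0; [exact: ltW|apply: divr_ge0; exact: ltW].
apply/allP => x; rewrite !inE => /or4P[/eqP->|/eqP->|/eqP->|/or4P[/eqP->|/eqP->|/eqP->|/or4P[/eqP->|/eqP->|/eqP->|/orP[]/eqP->]]].
- exact: ltW.
- by rewrite invr_ge0 ltW.
- by rewrite invr_ge0 ltW.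
- exact: ltW.
- by apply: mulr_ge0 => //; apply: mulr_ge0; [exact: ltW|].
- by apply: mulr_ge0 => //; exact: sqr_ge0.
- apply: mulr_ge0 => //; apply: addr_ge0; first by apply: addr_ge0.
  apply: mulr_ge0 => //; apply: addr_ge0; last by apply: divr_ge0; exact: ltW.
  by apply: mulr_ge0 => //; exact: sqr_ge0.
- by apply: mulr_ge0 => //; apply: mulr_ge0 => //; exact: sqr_ge0.
- exact: ltW.
- exact: ltW.
- by apply: divr_ge0; [apply: addr_ge0|]; exact: ltW.
Qed.

Lemma const_le i : const_seq`_i <= scheme_const.
Proof. exact: nth_le_sum const_seq_ge0. Qed.

Lemma scheme_const_ge1 : 1 <= scheme_const.
Proof.
rewrite lerDl big_seq; apply: sumr_ge0 => x; exact: (allP const_seq_ge0).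
Qed.

Lemma const_le_sq i : const_seq`_i <= scheme_const ^+ 2.
Proof.
apply: le_trans (const_le i) _; rewrite expr2; apply: ler_peMl scheme_const_ge1.
exact: le_trans scheme_const_ge1.
Qed.
End constants.

(** * Verification of the abstract hypotheses *)

Section scheme_error.
Variables (R : realType) (d : nat) (Om GuD GuN GtD GtN : set 'rV[R]_d) (T : R).
Local Notation pt := 'rV[R]_d.
Hypotheses (d_gt0 : (0 < d)%N) (oOm : open Om) (rOm : (closure Om)° = Om).
Hypotheses (GuO : forall x, Om x -> ~ GuN x) (GtO : forall x, Om x -> ~ GtN x).
Hypothesis T_gt0 : 0 < T.
Variables (gam q CI : R).
Hypotheses (gam_gt0 : 0 < gam) (q_gt0 : 0 < q) (CI_gt0 : 0 < CI).
Variables (ka1 ka2 mu1 mu2 la1 la2 al1 al2 : R).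
Hypotheses (ka1_gt0 : 0 < ka1) (mu1_gt0 : 0 < mu1) (la1_gt0 : 0 < la1)
  (al1_gt0 : 0 < al1) (al2_gt0 : 0 < al2).
Variables (cs Cs ck Ck xi Cloc Cort Cco : R).
Hypotheses (cs_gt0 : 0 < cs) (Cs_gt0 : 0 < Cs) (ck_gt0 : 0 < ck) (Ck_gt0 : 0 < Ck).
Hypotheses (xi_ge0 : 0 <= xi) (Cloc_gt0 : 0 < Cloc) (Cort_gt0 : 0 < Cort) (Cco_gt0 : 0 < Cco).
Variable c : coefficients R d.
Hypothesis cb : coefficient_bounds Om c ka1 ka2 mu1 mu2 la1 la2 al1 al2.
Hypotheses (ec : elastic_coercive Om GuD c cs Cs) (hc : heat_coercive Om GtD c ck Ck).
Variables (Mh MH : nat) (Th : mesh R d Mh) (TH : mesh R d MH).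
Hypotheses (triTh : triangulation Om Th) (triTH : triangulation Om TH).
Hypotheses (srT : shape_regular gam TH) (quT : quasi_uniform q TH) (rf : refines Th TH).
Local Notation H := (mesh_size TH).
Hypothesis H_gt0 : 0 < H.
Local Notation V1h := (@fe_space R d d Om GuD Mh Th).
Local Notation V1H := (@fe_space R d d Om GuD MH TH).
Local Notation V2h := (@fe_space R d 1 Om GtD Mh Th).
Local Notation V2H := (@fe_space R d 1 Om GtD MH TH).
Variables (I1 : (pt -> pt) -> pt -> pt) (I2 : (pt -> 'rV[R]_1) -> pt -> 'rV[R]_1).
Hypotheses (qI1 : quasi_interpolation CI V1h V1H TH I1)
  (qI2 : quasi_interpolation CI V2h V2H TH I2).
Local Notation V1f := (fine_space V1h I1).
Local Notation V2f := (fine_space V2h I2).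
Variable k : nat.
Local Notation dec := (decay d xi k).
Hypothesis dec_H : dec <= H.
Local Notation W1 := (fun i => local_fine_space Om GuN V1h I1 (omega TH k i)).
Local Notation W2 := (fun i => local_fine_space Om GtN V2h I2 (omega TH k i)).
Variables (RkK1 : 'I_MH -> (pt -> pt) -> pt -> pt)
  (RK2 RkK2 : 'I_MH -> (pt -> 'rV[R]_1) -> pt -> 'rV[R]_1).
Hypothesis hRK2 : element_correctors (heat_form c) V2h TH (fun=> Om) (fun=> V2f) RK2.
Hypothesis hRkK1 : element_correctors (elastic_form c) V1h TH (omega TH k) W1 RkK1.
Hypothesis hRkK2 : element_correctors (heat_form c) V2h TH (omega TH k) W2 RkK2.
Local Notation V1ms := (ms_space V1H (corrector RkK1)).
Local Notation V2ms := (ms_space V2H (corrector RkK2)).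
Hypothesis loc2 : corrector_localization Om Cloc xi k V2h RkK2 RK2.
Hypothesis orth : almost_orthogonal Om c Cort xi k V1ms V1f.
Hypothesis corr : almost_corrected Om c Cco xi k TH V2ms V1f W1.
Hypotheses (H_co : H <= 1 / (4 * Cco)) (H_ort : H <= cs / (Cco + Cort)).
Variables (tau : R) (N : nat).
Hypotheses (tau_gt0 : 0 < tau) (tauN : N%:R * tau = T).
Variables (f f1 : R -> pt -> pt) (f2 : R -> (pt -> pt) -> R)
  (g : R -> pt -> 'rV[R]_1) (g1 : R -> (pt -> 'rV[R]_1) -> R).
Hypothesis reg : regular_data Om T f f1 f2 g g1.
Variables (theta0 : pt -> 'rV[R]_1).
Variables (uh : nat -> pt -> pt) (thetah : nat -> pt -> 'rV[R]_1).
Hypothesis classical : classical_scheme Om c tau N f g V1h V2h theta0 uh thetah.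
Variables (ums : nat -> pt -> pt) (ufK : nat -> 'I_MH -> pt -> pt)
  (thetams : nat -> pt -> 'rV[R]_1).
Hypothesis localized :
  localized_scheme Om c tau N f g TH V1ms V2ms W1 theta0 ums ufK thetams.

Let D := data_norm Om T f f1 f2 g g1.
Let K := scheme_const d gam q CI al2 cs Cs ck Ck Cloc Cort Cco.
Let del := Cort * dec.
Let eps := Cco * dec.
Let mO : measurable Om. Proof. exact: open_measurable_rV. Qed.
Let sV1 : subspace V1h := subspace_fe d GuD d_gt0 oOm triTh.
Let sV2 : subspace V2h := subspace_fe 1 GtD d_gt0 oOm triTh.
Local Notation X1 := (sub_space (subspace_fe d GuD d_gt0 oOm triTh)).
Local Notation X2 := (sub_space (subspace_fe 1 GtD d_gt0 oOm triTh)).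
Let A (v : X1) := V1ms (val v).
Let F (v : X1) := V1f (val v).
Let B (v : X2) := V2ms (val v).
Let G (v : X2) := V2f (val v).
Let a (u v : X1) := elastic_form c Om (val u) (val v).
Let h1 (u v : X1) := ip Om (val u) (val v) + ip Om (grad (val u)) (grad (val v)).
Let m1 (u v : X1) := ip Om (val u) (val v).
Let b (u v : X2) := heat_form c Om (val u) (val v).
Let h2 (u v : X2) := ip Om (val u) (val v) + ip Om (grad (val u)) (grad (val v)).
Let m (u v : X2) := ip Om (val u) (val v).
Let dv (q : X2) (v : X1) := div_form Om (times_alpha c (val q)) (val v).
(** A relation closed under linear combinations, so that difference quotients of fine corrections
    are again fine corrections. *)
Let fc (q : X2) (v : X1) := exists uK, fine_correction Om c TH W1 uK (val q) /\
  val v = \sum_i uK i.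

Let ebe := elastic_density oOm mu1_gt0 la1_gt0 cb.
Let ebh := heat_density oOm ka1_gt0 cb.

Let pa : psd_form a. Proof. exact: (psd_energy_form GuD d_gt0 oOm triTh ebe mO (@subset_refl _ Om)). Qed.
Let pb : psd_form b. Proof. exact: (psd_energy_form GtD d_gt0 oOm triTh ebh mO (@subset_refl _ Om)). Qed.
Let ph1 : psd_form h1. Proof. exact: psd_h1_form. Qed.
Let ph2 : psd_form h2. Proof. exact: psd_h1_form. Qed.
Let pm1 : psd_form m1.
Proof.
apply: psd_ip_gen => //; first by move=> u; apply: fe_L2; exact: sub_spaceP.
by move=> l u v; apply: aeW => x _; rewrite val_sub_lin.
Qed.
Let pm : psd_form m.
Proof.
apply: psd_ip_gen => //; first by move=> u; apply: fe_L2; exact: sub_spaceP.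
by move=> l u v; apply: aeW => x _; rewrite val_sub_lin.
Qed.

Let fn1 v : fnorm h1 v = h1norm Om (val v).
Proof. by rewrite /fnorm /h1norm /H1norm !l2norm_sq. Qed.
Let fn2 v : fnorm h2 v = h1norm Om (val v).
Proof. by rewrite /fnorm /h1norm /H1norm !l2norm_sq. Qed.

Let oS l i : omega TH l i `<=` Om. Proof. exact: (omega_sub rOm triTH). Qed.

Let dl v : linear_functional (dv^~ v).
Proof. exact: (div_form_linl al1_gt0 cb mO (@subset_refl _ Om) v). Qed.
Let dr q' : linear_functional (dv q').
Proof. exact: (div_form_linr al1_gt0 cb mO (@subset_refl _ Om) q'). Qed.

Let fe_coercive1 v : V1h v ->
  cs * h1norm Om v ^+ 2 <= elastic_form c Om v v <= Cs * h1norm Om v ^+ 2.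
Proof. by case=> _ _ _ _ /ec. Qed.
Let fe_coercive2 v : V2h v ->
  ck * h1norm Om v ^+ 2 <= heat_form c Om v v <= Ck * h1norm Om v ^+ 2.
Proof. by case=> _ _ _ _ /hc. Qed.

Let sA : subspace A.
Proof.
have h := subspace_ms d_gt0 oOm rOm GuO triTh triTH rf qI1 ebe cs_gt0 fe_coercive1 hRkK1.
exact: (@subspace_val _ _ _ sV1 _ h).
Qed.
Let sB : subspace B.
Proof.
have h := subspace_ms d_gt0 oOm rOm GtO triTh triTH rf qI2 ebh ck_gt0 fe_coercive2 hRkK2.
exact: (@subspace_val _ _ _ sV2 _ h).
Qed.
Let be (x : pt) (P Q : 'M[R]_d) : R := frob (stress c x P) (strain Q).
Let bh (x : pt) (P Q : 'M[R]_(d, 1)) : R := frob (kappa c x *m P) Q.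
Let hk1 : element_correctors (energy_form be) V1h TH (omega TH k) W1 RkK1 := hRkK1.
Let hk2 : element_correctors (energy_form bh) V2h TH (omega TH k) W2 RkK2 := hRkK2.
Let sf1 := subspace_fine d_gt0 oOm triTh qI1.
Let sW i := subspace_local_fine GuN d_gt0 oOm triTh qI1 k i.

Let K_ge1 : 1 <= K. Proof. exact: scheme_const_ge1. Qed.
Let Kle i : (const_seq d gam q CI al2 cs Cs ck Ck Cloc Cort Cco)`_i <= K.
Proof. exact: const_le. Qed.
Let Kle2 i : (const_seq d gam q CI al2 cs Cs ck Ck Cloc Cort Cco)`_i <= K ^+ 2.
Proof. exact: const_le_sq. Qed.
Let K0 : 0 <= K. Proof. exact: le_trans K_ge1. Qed.
Let D0 : 0 <= D. Proof. exact: data_norm_ge0. Qed.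
Let dec0 : 0 <= dec. Proof. by apply: mulr_ge0; [exact: powR_ge0|exact: exprn_ge0]. Qed.
Let del_ge0 : 0 <= del. Proof. by apply: mulr_ge0 => //; exact: ltW. Qed.
Let eps_ge0 : 0 <= eps. Proof. by apply: mulr_ge0 => //; exact: ltW. Qed.

Let a_bounds v : cs * h1 v v <= a v v <= Cs * h1 v v.
Proof.
exact: (eq_ind _ (fun x => cs * x <= a v v <= Cs * x) (fe_coercive1 (sub_spaceP v)) _
  (h1norm_sq Om (val v))).
Qed.
Let b_bounds v : ck * h2 v v <= b v v <= Ck * h2 v v.
Proof.
exact: (eq_ind _ (fun x => ck * x <= b v v <= Ck * x) (fe_coercive2 (sub_spaceP v)) _
  (h1norm_sq Om (val v))).
Qed.

Let a_lo v : cs * h1 v v <= a v v. Proof. by have /andP[] := a_bounds v. Qed.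
Let a_hi v : a v v <= K * h1 v v.
Proof.
have /andP[_ h] := a_bounds v; apply: le_trans h _; apply: ler_wpM2r; first exact: (psd_ge0 ph1).
exact: (Kle 0).
Qed.
Let csK : 1 <= K * cs.
Proof. by rewrite -ler_pdivrMr// mul1r; exact: (Kle 1). Qed.
Let b_lo q' : h2 q' q' <= K * b q' q'.
Proof.
have /andP[h _] := b_bounds q'; apply: (@le_trans _ _ (ck^-1 * b q' q')).
  by rewrite ler_pdivlMl.
apply: ler_wpM2r; [exact: (psd_ge0 pb)|exact: (Kle 2)].
Qed.
Let b_hi q' : b q' q' <= K * h2 q' q'.
Proof.
have /andP[_ h] := b_bounds q'; apply: le_trans h _; apply: ler_wpM2r; first exact: (psd_ge0 ph2).
exact: (Kle 3).
Qed.
Let m_le q' : m q' q' <= h2 q' q'. Proof. by rewrite lerDl; exact: ip_ge0. Qed.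
Let m1_le v : m1 v v <= h1 v v. Proof. by rewrite lerDl; exact: ip_ge0. Qed.

Let abs_le_of_sq (x y : R) : 0 <= y -> x ^+ 2 <= y ^+ 2 -> `|x| <= y.
Proof.
by move=> y0 h; rewrite -ler_sqr ?nnegrE// real_normK ?num_real.
Qed.

Let d_arith (x l p r gg : R) : l <= K -> 0 <= l -> 0 <= p -> 0 <= r -> 0 <= gg ->
  gg <= r ^+ 2 -> x ^+ 2 <= l ^+ 2 * (p ^+ 2 * gg) -> `|x| <= K * p * r.
Proof.
move=> lK l0 p0 r0 g0 gr h; apply: abs_le_of_sq; first by rewrite !mulr_ge0.
apply: le_trans h _; rewrite !exprMn -mulrA; apply: ler_pM.
- exact: sqr_ge0.
- by apply: mulr_ge0 => //; exact: sqr_ge0.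
- by rewrite !expr2; exact: ler_pM.
- by apply: ler_wpM2l => //; exact: sqr_ge0.
Qed.

Let d_le q' v : `|dv q' v| <= K * fnorm m q' * fnorm h1 v.
Proof.
have al0 : 0 <= 2 * (al2 * d%:R) by rewrite !mulr_ge0// ltW.
apply: (@d_arith _ (2 * (al2 * d%:R)) _ _ (ip Om (grad (val v)) (grad (val v)))) => //.
- exact: (Kle 4).
- exact: fnorm_ge0.
- exact: fnorm_ge0.
- exact: ip_ge0.
- by rewrite (fnorm2 ph1) lerDr; exact: ip_ge0.
- by rewrite (fnorm2 pm); exact: (div_form_le al1_gt0 (ltW al2_gt0) cb mO (@subset_refl _ Om) q' v).
Qed.

Let fine_arith (x gg hh C : R) : C <= K ^+ 2 -> 0 <= gg -> gg <= hh -> x <= C * H ^+ 2 * gg ->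
  x <= (K * H) ^+ 2 * hh.
Proof.
move=> CK g0 gh h; apply: le_trans h _; rewrite exprMn.
have h0 : 0 <= H ^+ 2 by exact: sqr_ge0.
apply: (@le_trans _ _ (K ^+ 2 * H ^+ 2 * gg)).
  by apply: ler_wpM2r => //; exact: ler_wpM2r.
by apply: ler_wpM2l => //; apply: mulr_ge0 => //; exact: sqr_ge0.
Qed.

Let F_m1 w : F w -> m1 w w <= (K * H) ^+ 2 * h1 w w.
Proof.
move=> Fw; apply: (@fine_arith _ (ip Om (grad (val w)) (grad (val w))) _ (CI ^+ 2 * (patch_bound d gam q)%:R)).
- exact: (Kle2 5).
- exact: ip_ge0.
- by rewrite lerDr; exact: ip_ge0.
- exact: (fine_L2_le d_gt0 oOm rOm triTh triTH rf gam_gt0 q_gt0 srT quT H_gt0 qI1 Fw).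
Qed.
Let G_m w : G w -> m w w <= (K * H) ^+ 2 * h2 w w.
Proof.
move=> Gw; apply: (@fine_arith _ (ip Om (grad (val w)) (grad (val w))) _ (CI ^+ 2 * (patch_bound d gam q)%:R)).
- exact: (Kle2 5).
- exact: ip_ge0.
- by rewrite lerDr; exact: ip_ge0.
- exact: (fine_L2_le d_gt0 oOm rOm triTh triTH rf gam_gt0 q_gt0 srT quT H_gt0 qI2 Gw).
Qed.

Let decomp1 v : exists vA vF, [/\ A vA, F vF & v = vA + vF].
Proof.
have [vA [vF [hA hF e _ _]]] := ms_decomposition d_gt0 oOm triTh rf qI1 hk1 (sub_spaceP v).
have hA' := ms_fe d_gt0 oOm triTh rf qI1 hk1 hA; have [hF' _] := hF.
exists (lift sV1 vA), (lift sV1 vF); split.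
- exact: lift_pred.
- exact: lift_pred.
- exact: lift_split.
Qed.

Let stable_arith (x y x' y' C : R) : C <= K -> y ^+ 2 = y' -> x ^+ 2 = x' ->
  x ^+ 2 <= C * y ^+ 2 -> x' <= K * y'.
Proof. by move=> CK <- <- h; apply: le_trans h _; apply: ler_wpM2r => //; exact: sqr_ge0. Qed.

Let decomp2 v : exists vB vG,
  [/\ B vB, G vG, v = vB + vG & h2 vG vG <= K * h2 v v].
Proof.
have hv := sub_spaceP v.
have [vB [vG [hB hG e _ eG]]] := ms_decomposition d_gt0 oOm triTh rf qI2 hk2 hv.
have hB' := ms_fe d_gt0 oOm triTh rf qI2 hk2 hB; have [hG' _] := hG.
exists (lift sV2 vB), (lift sV2 vG); split.
- exact: lift_pred.
- exact: lift_pred.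
- exact: lift_split.
- have st := ms_fine_stable d_gt0 oOm rOm triTh triTH rf gam_gt0 q_gt0 CI_gt0 srT quT H_gt0 qI2
    ebh ck_gt0 Ck_gt0 fe_coercive2 hRK2 hk2 Cloc_gt0 xi_ge0 loc2 H_co dec_H hv.
  apply: (stable_arith (Kle 6) (h1norm_sq Om (val v)) (h1norm_sq Om (val (lift sV2 vG)))).
  rewrite -eG in st; exact: (@lift_pred _ _ _ sV2 (fun x => h1norm Om x ^+ 2 <=
    fine_const d gam q CI ck Ck Cloc (height_bound Cco) * h1norm Om (val v) ^+ 2) vG hG' st).
Qed.

(** The assumed bound is one-sided; applying it to [- w] gives the absolute value. *)
Let a_orth v w : A v -> F w -> `|a v w| <= del * fnorm h1 v * fnorm h1 w.
Proof.
move=> Av Fw; have h : a v w <= del * fnorm h1 v * fnorm h1 w by rewrite !fn1; exact: orth.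
have Fn : F (- w) by rewrite /F raddfN -scaleN1r; exact: (subspaceZ sf1).
have : a v (- w) <= del * fnorm h1 v * fnorm h1 (- w) by rewrite !fn1; exact: orth.
by rewrite (psdNr pa) (fnormN ph1) ler_norml h andbT lerNl.
Qed.

Let b_arith (x v w C : R) : C <= K ^+ 2 -> 0 <= v -> 0 <= w ->
  x ^+ 2 <= C * (dec * v * w) ^+ 2 -> `|x| <= K * H * v * w.
Proof.
move=> CK v0 w0 h; have H0 := ltW H_gt0; apply: abs_le_of_sq; first by rewrite !mulr_ge0.
have le : dec * v * w <= H * v * w := ler_wpM2r w0 (ler_wpM2r v0 dec_H).
have e0 : 0 <= dec * v * w := mulr_ge0 (mulr_ge0 dec0 v0) w0.
have -> : K * H * v * w = K * (H * v * w) by rewrite !mulrA.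
rewrite exprMn; apply: le_trans h _.
apply: (@le_trans _ _ (K ^+ 2 * (dec * v * w) ^+ 2)); first by apply: ler_wpM2r => //; exact: sqr_ge0.
apply: ler_wpM2l; first exact: sqr_ge0.
by rewrite !expr2; exact: ler_pM.
Qed.

(** For the heat form almost orthogonality is derived from the localization estimate, through
    [ms_fine_orth]. *)
Let b_orth v w : B v -> G w -> `|b v w| <= K * H * fnorm h2 v * fnorm h2 w.
Proof.
move=> Bv Gw; apply: (b_arith (Kle2 7) (fnorm_ge0 _ _) (fnorm_ge0 _ _)); rewrite !fn2.
exact: (ms_fine_orth d_gt0 oOm rOm triTh triTH rf gam_gt0 q_gt0 CI_gt0 srT quT H_gt0 qI2
    ebh ck_gt0 Ck_gt0 fe_coercive2 hRK2 hk2 Cloc_gt0 loc2 H_co Bv Gw).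
Qed.

Let W_fe i z : W1 i z -> V1h z. Proof. by case=> -[]. Qed.

Let fc_lin l q1 v1 q2 v2 : fc q1 v1 -> fc q2 v2 -> fc (l *: q1 + q2) (l *: v1 + v2).
Proof.
move=> [uK [hu e1]] [wK [hw e2]]; exists (fun i => l *: uK i + wK i); split; last first.
  by rewrite val_sub_lin e1 e2 big_split /= scaler_sumr.
move=> i; have [Wu eu] := hu i; have [Ww ew] := hw i.
split; first exact: (proj2 (sW i)).
move=> z Wz; have hz := W_fe Wz; have {}eu := eu z Wz; have {}ew := ew z Wz.
have lin := rform_lin (sP := sV1) (a := elastic_form c Om) pa l (W_fe Wu) (W_fe Ww) hz.
have dlin := div_form_linl al1_gt0 cb (measurable_omega TH 0 i) (@oS 0%N i) (to_sub_space sV1 hz) l q1 q2.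
suff arith (x x1 x2 y y1 y2 : R) : x1 - y1 = 0 -> x2 - y2 = 0 -> x = l * x1 + x2 ->
  y = l * y1 + y2 -> x - y = 0 by exact: (arith _ _ _ _ _ _ eu ew lin dlin).
by move=> /eqP; rewrite subr_eq0 => /eqP-> /eqP; rewrite subr_eq0 => /eqP-> -> ->; rewrite subrr.
Qed.

Let fcF q' v : fc q' v -> F v.
Proof.
move=> [uK [hu e]]; rewrite /F e; apply: (subspace_sum sf1) => i.
by have [[]] := hu i.
Qed.

Let fc_le q' v : B q' -> fc q' v -> forall w, F w ->
  `|a v w - dv q' w| <= eps * fnorm m q' * fnorm h1 w.
Proof.
by move=> Bq [uK [hu e]] w Fw; rewrite /a e fn1; exact: (corr Bq hu Fw).
Qed.

Let co_pos : 0 < Cco + Cort. Proof. exact: addr_gt0. Qed.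
Let delH : del <= K * H.
Proof. by apply: ler_pM => //; [exact: ltW|exact: (Kle 8)]. Qed.
Let epsH : eps <= K * H.
Proof. by apply: ler_pM => //; [exact: ltW|exact: (Kle 9)]. Qed.
Let eps4 : 4 * eps <= 1.
Proof.
have h := le_trans dec_H H_co; rewrite ler_pdivlMr ?mulr_gt0// in h.
by rewrite /eps mulrA mulrC.
Qed.
Let dec_co : dec * (Cco + Cort) <= cs.
Proof. by rewrite -ler_pdivlMr//; exact: le_trans dec_H H_ort. Qed.
Let del_eps : del + eps <= cs.
Proof. by rewrite /del /eps -mulrDl addrC mulrC addrC [Cort + _]addrC. Qed.
(** Multiplied by [Cco + Cort], the difference [cs - del] is at least [cs * Cco]: the loss is at
    most [cs * Cort] by [dec_co]. *)
Let del_cs : cs <= K * (cs - del).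
Proof.
have h : cs * Cco <= (cs - del) * (Cco + Cort).
  rewrite mulrBl mulrDr lerBrDr lerD2l /del -mulrA mulrC.
  by apply: ler_wpM2r dec_co; exact: ltW.
have c0 : 0 <= cs - del.
  by rewrite -(pmulr_lge0 _ co_pos); apply: le_trans h; apply: mulr_ge0; exact: ltW.
apply: (@le_trans _ _ ((Cco + Cort) / Cco * (cs - del))).
  by rewrite mulrAC ler_pdivlMr// [leRHS]mulrC.
by apply: ler_wpM2r => //; exact: (Kle 10).
Qed.

Let node_le n : (n <= N)%N -> 0 <= tnode tau n <= T.
Proof.
move=> nN; apply/andP; split; first by apply: mulr_ge0 => //; exact: ltW.
by rewrite -tauN ler_pM2r// ler_nat.
Qed.
Let nodeS n : tnode tau n.+1 = tnode tau n + tau.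
Proof. by rewrite /tnode -natr1 mulrDl mul1r. Qed.

(** Zero beyond the last step: linearity is required for every [n], while [f] is known to be square
    integrable only for times in [[0, T]]. *)
Let fn n (v : X1) := if (n <= N)%N then ip Om (f (tnode tau n)) (val v) else 0.
Let gn n (v : X2) := if (n <= N)%N then ip Om (g (tnode tau n)) (val v) else 0.

Let ip_linear mm (u : pt -> 'rV[R]_mm) l v w : L2 Om u -> L2 Om v -> L2 Om w ->
  ip Om u (l *: v + w) = l * ip Om u v + ip Om u w.
Proof.
move=> hu hv hw; have sL := subspace_L2 mO 1 mm.
have p : psd_form (fun x y : sub_space sL => ip Om (val x) (val y)).
  apply: psd_ip_gen => //; first exact: sub_spaceP.
  by move=> l' x y; apply: aeW => z _; rewrite val_sub_lin.
have := psd_funr p (to_sub_space sL hu) l (to_sub_space sL hv) (to_sub_space sL hw).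
by rewrite val_sub_lin.
Qed.

Let lf n : linear_functional (fn n).
Proof.
move=> l x y; rewrite /fn; case: ifP => nN; last by rewrite mulr0 addr0.
have [[[hf _ _] _ _ _ _] _] := reg.
rewrite val_sub_lin; apply: ip_linear; first exact: hf (node_le nN).
  by apply: fe_L2; exact: sub_spaceP.
by apply: fe_L2; exact: sub_spaceP.
Qed.

Let fn_le n : (n <= N)%N -> forall v, `|fn n v| <= D * fnorm m1 v.
Proof.
move=> nN v; rewrite /fn nN.
exact: (f_le oOm T_gt0 reg (node_le nN) (fe_L2 (sub_spaceP v))).
Qed.

Let step_arith (x y s t : R) : t = s + tau -> x <= D * y * (t - s) -> x <= tau * D * y.
Proof. by move=> ->; rewrite addrAC subrr add0r mulrC mulrA. Qed.

Let dfn_le n : (n < N)%N -> forall v, `|fn n.+1 v - fn n v| <= tau * D * fnorm m1 v.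
Proof.
move=> nN v; rewrite /fn nN (ltnW nN).
have /andP[t0 _] := node_le (ltnW nN); have /andP[_ t1] := node_le nN.
apply: (step_arith (nodeS n)); apply: (f_diff_le oOm reg t0 _ t1 (fe_L2 (sub_spaceP v))).
by rewrite nodeS lerDl ltW.
Qed.

Let fe_H1 mm GD (v : pt -> 'rV[R]_mm) : fe_space Om GD Th v -> H1 Om v (grad v).
Proof. by case=> _ _ _ _ []. Qed.

Let ddfn_le n : (n.+1 < N)%N -> forall v,
  `|fn n.+2 v - fn n.+1 v - (fn n.+1 v - fn n v)| <= tau ^+ 2 * (2 * D) * fnorm h1 v.
Proof.
move=> nN v; rewrite /fn nN (ltnW nN) (ltnW (ltnW nN)) !nodeS fn1.
have /andP[t0 _] := node_le (ltnW (ltnW nN)); have /andP[_ t1] := node_le nN.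
rewrite !nodeS in t1.
exact: (f_second_diff_le oOm triTh reg t0 (ltW tau_gt0) t1 (fe_H1 (sub_spaceP v))).
Qed.

Let gn_le n : (n < N)%N -> forall q', `|gn n.+1 q'| <= D * fnorm m q'.
Proof.
move=> nN v; rewrite /gn nN.
exact: (g_le oOm triTh T_gt0 reg (node_le nN) (fe_H1 (sub_spaceP v))).
Qed.

Let dgn_le n : (n.+1 < N)%N -> forall q',
  `|gn n.+2 q' - gn n.+1 q'| <= tau * D * fnorm h2 q'.
Proof.
move=> nN v; rewrite /gn nN (ltnW nN) fn2.
have /andP[t0 _] := node_le (ltnW nN); have /andP[_ t1] := node_le nN.
apply: (step_arith (nodeS n.+1)); apply: (g_diff_le oOm triTh reg t0 _ t1 (fe_H1 (sub_spaceP v))).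
by rewrite (nodeS n.+1) lerDl ltW.
Qed.

Let uX n : X1 := lift sV1 (uh n).
Let thX n : X2 := lift sV2 (thetah n).
Let uA n : X1 := lift sV1 (ums n).
Let uF n : X1 := lift sV1 (\sum_i ufK n i).
Let thB n : X2 := lift sV2 (thetams n).

Let uXE n : (n <= N)%N -> val (uX n) = uh n.
Proof. by move=> nN; apply: val_lift; have [_ /(_ n nN)[]] := classical. Qed.
Let thXE n : (n <= N)%N -> val (thX n) = thetah n.
Proof. by move=> nN; apply: val_lift; have [_ /(_ n nN)[]] := classical. Qed.
Let uAE n : (n <= N)%N -> val (uA n) = ums n.
Proof.
move=> nN; apply: val_lift; have [_ /(_ n nN)[h _] _ _ _] := localized.
exact: (ms_fe d_gt0 oOm triTh rf qI1 hk1 h).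
Qed.
Let thBE n : (n <= N)%N -> val (thB n) = thetams n.
Proof.
move=> nN; apply: val_lift; have [_ /(_ n nN)[_ h] _ _ _] := localized.
exact: (ms_fe d_gt0 oOm triTh rf qI2 hk2 h).
Qed.
Let uFE n : (n <= N)%N -> val (uF n) = \sum_i ufK n i.
Proof.
move=> nN; apply: val_lift; have [_ _ _ _ /(_ n nN) h] := localized.
by apply: (subspace_sum sV1) => i; have [/W_fe] := h i.
Qed.

Let bdiff_val mm GD (X := sub_space (subspace_fe mm GD d_gt0 oOm triTh)) (v : nat -> X)
    (w : nat -> pt -> 'rV[R]_mm) n : (n < N)%N -> (forall l, (l <= N)%N -> val (v l) = w l) ->
  val (dquot tau v n.+1) = bdiff tau w n.+1.
Proof.
move=> nN e; rewrite /dquot /bdiff val_subZ val_subB /=.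
by rewrite (e _ nN) (e _ (ltnW nN)).
Qed.

Let u_eq n : (n <= N)%N -> forall v, a (uX n) v - dv (thX n) v = fn n v.
Proof.
move=> nN v; rewrite /a /dv /fn nN (uXE nN) (thXE nN).
have [_ _ /(_ n nN) h _] := classical; exact: h (sub_spaceP v).
Qed.

Let th_eq n : (n < N)%N -> forall z,
  m (dquot tau thX n.+1) z + b (thX n.+1) z + dv z (dquot tau uX n.+1) = gn n.+1 z.
Proof.
move=> nN z; rewrite /m /b /dv /gn nN (thXE nN) (bdiff_val nN uXE) (bdiff_val nN thXE).
have [_ _ _ /(_ n.+1) h] := classical; exact: h (sub_spaceP z).
Qed.

Let uA_A n : (n <= N)%N -> A (uA n).
Proof. by move=> nN; rewrite /A (uAE nN); have [_ /(_ n nN)[]] := localized. Qed.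

Let thB_B n : (n <= N)%N -> B (thB n).
Proof. by move=> nN; rewrite /B (thBE nN); have [_ /(_ n nN)[]] := localized. Qed.

Let uF_fc n : (n <= N)%N -> fc (thB n) (uF n).
Proof.
move=> nN; exists (ufK n); rewrite (thBE nN); split; last exact: uFE nN.
by have [_ _ _ _ /(_ n nN)] := localized.
Qed.

Let utE n : (n <= N)%N -> val (uA n + uF n) = ums n + \sum_i ufK n i.
Proof.
by move=> nN; exact: etrans (val_subD (uA n) (uF n)) (f_equal2 +%R (uAE nN) (uFE nN)).
Qed.

Let ut_eq n : (n <= N)%N -> forall v, A v -> a (uA n + uF n) v - dv (thB n) v = fn n v.
Proof.
move=> nN v Av; rewrite /a /dv /fn nN (utE nN) (thBE nN).
have [_ _ /(_ n nN) h _ _] := localized; exact: h Av.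
Qed.

Let tht_eq n : (n < N)%N -> forall z, B z ->
  m (dquot tau thB n.+1) z + b (thB n.+1) z + dv z (dquot tau (fun n => uA n + uF n) n.+1)
  = gn n.+1 z.
Proof.
move=> nN z Bz; rewrite /m /b /dv /gn nN (thBE nN) (bdiff_val nN utE) (bdiff_val nN thBE).
have [_ _ _ /(_ n.+1) h _] := localized; exact: h Bz.
Qed.

Let tht0 z : B z -> b (thX 0 - thB 0) z = 0.
Proof.
move=> Bz; have [e0 _ _ _] := classical; have [h _ _ _ _] := localized.
have e : val (thX 0 - thB 0) = theta0 - thetams 0%N := etrans (val_subB (thX 0) (thB 0))
  (f_equal2 (fun x y => x - y) (etrans (thXE (leq0n N)) e0) (thBE (leq0n N))).
exact: (eq_ind_r (fun x => heat_form c Om x (val z) = 0) (h _ Bz) e).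
Qed.

Let phi1 n (v : X1) := vertex_value Th n (val v).
Let phi2 n (v : X2) := vertex_value Th n (val v).
Let lphi1 n : linear_functional (phi1 n).
Proof. by move=> l x y; rewrite /phi1 val_sub_lin; exact: vertex_value_linear. Qed.
Let lphi2 n : linear_functional (phi2 n).
Proof. by move=> l x y; rewrite /phi2 val_sub_lin; exact: vertex_value_linear. Qed.
Let phi1_inj v : (forall n, (n < vertex_count d d Mh)%N -> phi1 n v = 0) -> v = 0.
Proof.
move=> h; apply: val_inj; rewrite raddf0.
exact: (vertex_value_inj triTh (sub_spaceP v) h).
Qed.
Let phi2_inj v : (forall n, (n < vertex_count d 1 Mh)%N -> phi2 n v = 0) -> v = 0.
Proof.
move=> h; apply: val_inj; rewrite raddf0.
exact: (vertex_value_inj triTh (sub_spaceP v) h).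
Qed.

Let squared_error n : (1 <= n <= N)%N ->
  n%:R * tau * (h1 (uX n - (uA n + uF n)) (uX n - (uA n + uF n))
    + h2 (thX n - thB n) (thX n - thB n))
  <= Ccoupled K T * H ^+ 2 * (h2 (thX 0) (thX 0) + n%:R * tau * D ^+ 2).
Proof.
have tauN' : N%:R * tau <= T by rewrite tauN.
exact: (@coupled_error R X1 X2 a h1 m1 b h2 m dv A F B G fc K H T D tau cs del eps N
  pa ph1 pm1 pb ph2 pm dl dr sA sB K_ge1 H_gt0 D0 tau_gt0 del_ge0 eps_ge0 tauN' a_lo a_hi csK
  b_lo b_hi m_le m1_le d_le F_m1 G_m decomp1 decomp2 a_orth b_orth fc_lin fcF fc_le
  delH epsH eps4 del_eps del_cs _ _ phi1 phi2 lphi1 lphi2 phi1_inj phi2_inj fn gn lf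
  fn_le dfn_le ddfn_le gn_le dgn_le uX thX u_eq th_eq uA uF thB uA_A thB_B uF_fc ut_eq tht_eq
  tht0 n).
Qed.

Let sq_subst (x y z x' y' z' t C e : R) : x ^+ 2 = x' -> y ^+ 2 = y' -> z ^+ 2 = z' ->
  t * (x' + y') <= C * (z' + e) -> t * (x ^+ 2 + y ^+ 2) <= C * (z ^+ 2 + e).
Proof. by move=> -> -> ->. Qed.

Lemma scheme_error n : (1 <= n <= N)%N ->
  h1norm Om (uh n - (ums n + \sum_i ufK n i)) + h1norm Om (thetah n - thetams n)
  <= (1 + 2 * `|Ccoupled K T|) * (H + dec) * (D + tnode tau n `^ (- 2^-1) * h1norm Om theta0).
Proof.
move=> nN; have /andP[n1 nN'] := nN.
have e1 : val (uX n - (uA n + uF n)) = uh n - (ums n + \sum_i ufK n i).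
  exact: etrans (val_subB _ _) (f_equal2 (fun x y => x - y) (uXE nN') (utE nN')).
have e2 : val (thX n - thB n) = thetah n - thetams n.
  exact: etrans (val_subB _ _) (f_equal2 (fun x y => x - y) (thXE nN') (thBE nN')).
have e3 : val (thX 0) = theta0 by rewrite (thXE (leq0n N)); have [] := classical.
rewrite -e1 -e2 -e3 -!fn1 -!fn2.
apply: root_estimate; rewrite ?fnorm_ge0//.
- by apply: mulr_gt0 => //; rewrite ltr0n.
- exact: ltW.
- exact: (sq_subst (fnorm2 ph1 _) (fnorm2 ph2 _) (fnorm2 ph2 _) (squared_error nN)).
Qed.

End scheme_error.

Lemma boundary_part_disjoint (R : realType) d (Om GD GN : set 'rV[R]_d) : open Om ->
  boundary_splitting Om GD GN -> forall x, Om x -> ~ GN x.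
Proof.
move=> oOm [e _] x Ox Gx; have : (GD `|` GN) x by right.
by rewrite e => -[_]; apply; apply: open_nbhs_nbhs.
Qed.

Lemma mesh_size_ge0 (R : realType) d M (T : mesh R d M) : 0 <= mesh_size T.
Proof. exact: bigmax_ge_id. Qed.

Theorem theorem5p2 (R : realType) (d : nat) (d23 : d = 2%N \/ d = 3%N)
  (Om GuD GuN GtD GtN : set 'rV[R]_d) (T : R)
  (Om_poly : polyhedral_domain Om) (Gu : boundary_splitting Om GuD GuN)
  (Gt : boundary_splitting Om GtD GtN) (T_gt0 : 0 < T)
  (* mesh regularity and interpolation constants *)
  (gam q CI : R) (gam_gt0 : 0 < gam) (q_gt0 : 0 < q) (CI_gt0 : 0 < CI)
  (* coefficient bounds *)
  (ka1 ka2 mu1 mu2 la1 la2 al1 al2 : R)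
  (ka_bd : 0 < ka1 <= ka2) (mu_bd : 0 < mu1 <= mu2)
  (la_bd : 0 < la1 <= la2) (al_bd : 0 < al1 <= al2)
  (* coercivity and continuity constants *)
  (cs Cs ck Ck : R) (cs_gt0 : 0 < cs) (Cs_gt0 : 0 < Cs)
  (ck_gt0 : 0 < ck) (Ck_gt0 : 0 < Ck)
  (* constants of the localization estimates *)
  (xi Cloc Cort Cco : R) (xi01 : 0 < xi < 1) (Cloc_gt0 : 0 < Cloc)
  (Cort_gt0 : 0 < Cort) (Cco_gt0 : 0 < Cco) :
  exists C : R, 0 < C /\
  forall (c : coefficients R d),
    coefficient_bounds Om c ka1 ka2 mu1 mu2 la1 la2 al1 al2 ->
    elastic_coercive Om GuD c cs Cs -> heat_coercive Om GtD c ck Ck ->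
  forall (Mh MH : nat) (Th : mesh R d Mh) (TH : mesh R d MH),
    triangulation Om Th -> triangulation Om TH ->
    shape_regular gam Th -> shape_regular gam TH -> quasi_uniform q TH ->
    refines Th TH -> mesh_size Th < mesh_size TH ->
  let H := mesh_size TH in
  let V1h := @fe_space R d d Om GuD Mh Th in
  let V1H := @fe_space R d d Om GuD MH TH in
  let V2h := @fe_space R d 1 Om GtD Mh Th in
  let V2H := @fe_space R d 1 Om GtD MH TH in
  forall (I1 : ('rV[R]_d -> 'rV[R]_d) -> 'rV[R]_d -> 'rV[R]_d)
         (I2 : ('rV[R]_d -> 'rV[R]_1) -> 'rV[R]_d -> 'rV[R]_1),
    quasi_interpolation CI V1h V1H TH I1 ->
    quasi_interpolation CI V2h V2H TH I2 ->
  let V1f := fine_space V1h I1 in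
  let V2f := fine_space V2h I2 in
  forall k : nat, (1 <= k)%N -> decay d xi k <= H ->
  let W1 i := local_fine_space Om GuN V1h I1 (omega TH k i) in
  let W2 i := local_fine_space Om GtN V2h I2 (omega TH k i) in
  forall (RK1 RkK1 : 'I_MH -> ('rV[R]_d -> 'rV[R]_d) -> 'rV[R]_d -> 'rV[R]_d)
         (RK2 RkK2 : 'I_MH -> ('rV[R]_d -> 'rV[R]_1) -> 'rV[R]_d -> 'rV[R]_1),
    element_correctors (elastic_form c) V1h TH (fun=> Om) (fun=> V1f) RK1 ->
    element_correctors (heat_form c) V2h TH (fun=> Om) (fun=> V2f) RK2 ->
    element_correctors (elastic_form c) V1h TH (omega TH k) W1 RkK1 ->
    element_correctors (heat_form c) V2h TH (omega TH k) W2 RkK2 ->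
  let V1ms := ms_space V1H (corrector RkK1) in
  let V2ms := ms_space V2H (corrector RkK2) in
    corrector_localization Om Cloc xi k V1h RkK1 RK1 ->
    corrector_localization Om Cloc xi k V2h RkK2 RK2 ->
    divergence_localization Om c Cloc xi k TH V1f W1 ->
    almost_orthogonal Om c Cort xi k V1ms V1f ->
    almost_corrected Om c Cco xi k TH V2ms V1f W1 ->
    H <= Num.min (1 / (4 * Cco)) (cs / (Cco + Cort)) ->
  forall (tau : R) (N : nat), 0 < tau -> N%:R * tau = T ->
  forall f f1 f2 g g1, regular_data Om T f f1 f2 g g1 ->
  forall (theta0 : 'rV[R]_d -> 'rV[R]_1) Gtheta0, H1D Om GtD theta0 Gtheta0 ->
  forall theta0h, V2h theta0h ->
  forall uh thetah, classical_scheme Om c tau N f g V1h V2h theta0h uh thetah ->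
  forall ums ufK thetams,
    localized_scheme Om c tau N f g TH V1ms V2ms W1 theta0h ums ufK thetams ->
  forall n : nat, (1 <= n <= N)%N ->
    h1norm Om (uh n - (ums n + \sum_i ufK n i)) + h1norm Om (thetah n - thetams n)
    <= C * (H + decay d xi k)
       * (data_norm Om T f f1 f2 g g1
          + tnode tau n `^ (- 2^-1) * h1norm Om theta0h).
Proof.
have /andP[ka1_gt0 _] := ka_bd; have /andP[mu1_gt0 _] := mu_bd.
have /andP[la1_gt0 _] := la_bd; have /andP[al1_gt0 al12] := al_bd.
have al2_gt0 : 0 < al2 := lt_le_trans al1_gt0 al12.
have /andP[xi_gt0 _] := xi01.
have d_gt0 : (0 < d)%N by case: d23 => ->.
have [oOm _ _ rOm _] := Om_poly.
have GuO := boundary_part_disjoint oOm Gu; have GtO := boundary_part_disjoint oOm Gt.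
(* Built from the bounds alone, before coefficients, meshes and data are introduced. *)
exists (1 + 2 * `|Ccoupled (scheme_const d gam q CI al2 cs Cs ck Ck Cloc Cort Cco) T|).
split; first by apply: ltr_pwDl => //; apply: mulr_ge0.
move=> c cb ec hc Mh MH Th TH triTh triTH _ srT quT rf hH H V1h V1H V2h V2H I1 I2 qI1 qI2
  V1f V2f k _ decH W1 W2 RK1 RkK1 RK2 RkK2 _ hRK2 hRkK1 hRkK2 V1ms V2ms _ loc2 _ orth corr Hmin
  tau N tau_gt0 tauN f f1 f2 g g1 reg theta0 Gtheta0 _ theta0h _ uh thetah cl ums ufK thetams lo
  n nN.
have H_gt0 : 0 < mesh_size TH := le_lt_trans (mesh_size_ge0 Th) hH.
move: Hmin; rewrite le_min => /andP[H_co H_ort].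
exact: (scheme_error d_gt0 oOm rOm GuO GtO T_gt0 gam_gt0 q_gt0 CI_gt0 ka1_gt0 mu1_gt0 la1_gt0
  al1_gt0 al2_gt0 cs_gt0 Cs_gt0 ck_gt0 Ck_gt0 (ltW xi_gt0) Cloc_gt0 Cort_gt0 Cco_gt0 cb ec hc
  triTh triTH srT quT rf H_gt0 qI1 qI2 decH hRK2 hRkK1 hRkK2 loc2 orth corr H_co H_ort
  tau_gt0 tauN reg cl lo nN).
Qed.
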